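(* Let $K$ be a simplicial complex on $[m]$ and $L_1,\ldots,L_m$ simplicial complexes on $n_1,\dots,n_m$ vertices respectively (allowing ghost vertices). If none of $K,L_1,\ldots,L_m$ is contractible, then the non-trivial Steenrod operations on $K,L_1,\ldots,L_m$ propagate to non-trivial Steenrod operations on the moment-angle complex over the composition complex $(\underline\Delta,\underline L)^{*K}$; that is, for $n\ge1$, if $Sq^n$ is non-zero on the cohomology of at least one of $K,L_1,\dots,L_m$, then $Sq^n$ is non-zero on $H^*(\mathcal Z_{(\underline\Delta,\underline L)^{*K}})$.
   Context: $H^*(-)$ denotes cohomology with $\mathbb F_2$ coefficients (of the geometric realization, for simplicial complexes), and $Sq^n$ is the $n$-th mod 2 Steenrod square. Simplicial complexes contain $\emptyset$; $K$ on $[m]=\{1,\dots,m\}$ has vertices labelled by $[m]$; a ghost vertex of $L_i$ is an element $j\in[n_i]$ with $\{j\}\notin L_i$. Composition complex: $(\underline\Delta,\underline L)^{*K}$ with $(\underline\Delta,\underline L)=(\Delta^{n_i-1},L_i)_{i=1}^m$, where $\Delta^{n_i-1}$ is the full simplex on $[n_i]$ and $(\underline X,\underline A)^{*K}=\bigcup_{\sigma\in K}Y_1^\sigma*\cdots*Y_m^\sigma\subseteq X_1*\cdots*X_m$ is the polyhedral join ($*$ is the join; $Y_i^\sigma=X_i$ if $i\in\sigma$, $Y_i^\sigma=A_i$ if $i\notin\sigma$). For a simplicial complex $M$ on $[r]$, the moment-angle complex is $\mathcal Z_M=(D^2,S^1)^M=\bigcup_{\sigma\in M}\prod_{i=1}^rY_i^\sigma\subseteq(D^2)^r$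 with $Y_i^\sigma=D^2$ if $i\in\sigma$ and $Y_i^\sigma=S^1$ if $i\notin\sigma$. *)

(* Defs.v *)
From HB Require Import structures.
From mathcomp Require Import all_boot all_order all_algebra generic_quotient.
From mathcomp Require Import ring_quotient.
From mathcomp Require Import all_classical reals topology normedtype.

Set Implicit Arguments.
Unset Strict Implicit.
Unset Printing Implicit Defensive.

Import Order.TTheory GRing.Theory Num.Theory.
Import numFieldNormedType.Exports.

Local Open Scope quotient_scope.
Local Open Scope classical_set_scope.
Local Open Scope ring_scope.

Section SimplicialComplexes.
Implicit Types V : finType.

(* The empty face is required, the vertices [set v] are not: v is a ghost vertex
   of K when [set v] \notin K. *)
Definition simplicial_complex V (K : {set {set V}}) : Prop :=
  finset.set0 \in K /\
  forall s t : {set V}, t \in K -> s \subset t -> s \in K.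

Definition full_simplex V : {set {set V}} := powerset [set: V].

Definition slice (I : finType) (V : I -> finType) (t : {set {i & V i}}) i :
  {set V i} := [set v | Tagged V v \in t].

Definition big_join (I : finType) (V : I -> finType)
    (Y : forall i, {set {set V i}}) : {set {set {i & V i}}} :=
  [set t : {set {i & V i}} | [forall i, slice t i \in Y i]].

Definition polyhedral_join (I : finType) (V : I -> finType)
    (X A : forall i, {set {set V i}}) (K : {set {set I}}) :
    {set {set {i & V i}}} :=
  (\bigcup_(s in K) big_join (fun i => if i \in s then X i else A i))%SET.

Definition composition_complex (m : nat) (nv : 'I_m -> nat)
    (K : {set {set 'I_m}}) (L : forall i, {set {set 'I_(nv i)}}) :
    {set {set {i : 'I_m & 'I_(nv i)}}} :=
  polyhedral_join (fun i => full_simplex 'I_(nv i)) L K.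

Lemma polyhedral_join_complex (I : finType) (V : I -> finType)
    (X A : forall i, {set {set V i}}) (K : {set {set I}}) :
  (forall i, simplicial_complex (X i)) ->
  (forall i, simplicial_complex (A i)) ->
  simplicial_complex K -> simplicial_complex (polyhedral_join X A K).
Proof.
move=> Xc Ac [K0 _]; split=> [|s t].
  apply/bigcupP; exists finset.set0 => //; rewrite inE; apply/forallP => i.
  rewrite inE (_ : slice _ i = finset.set0); first by have [] := Ac i.
  by apply/setP => v; rewrite !inE.
move=> /bigcupP[r rK]; rewrite inE => /forallP tY /fintype.subsetP st.
apply/bigcupP; exists r => //; rewrite inE; apply/forallP => i.
have sti : slice s i \subset slice t i.
  by apply/fintype.subsetP => v; rewrite !inE; exact: st.
move: (tY i); case: ifP => _ ti.
  by have [_ h] := Xc i; exact: h ti sti.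
by have [_ h] := Ac i; exact: h ti sti.
Qed.

Lemma composition_complexP (m : nat) (nv : 'I_m -> nat)
    (K : {set {set 'I_m}}) (L : forall i, {set {set 'I_(nv i)}}) :
  simplicial_complex K -> (forall i, simplicial_complex (L i)) ->
  simplicial_complex (composition_complex K L).
Proof.
move=> Kc Lc; apply: polyhedral_join_complex => // i.
split=> [|s t _ _]; rewrite powersetE; first exact: finset.sub0set.
exact: finset.subsetT.
Qed.

End SimplicialComplexes.

Section Spaces.
Variable R : realType.

Definition barycentric (V : finType) : set {ptws V -> R} :=
  [set x | (forall v, 0 <= x v) /\ \sum_v x v = 1].

(* {ptws V -> R} is R^V with the product topology. *)
Definition realization (V : finType) (K : {set {set V}}) : topologicalType :=
  set_type [set x : {ptws V -> R} |
    barycentric x /\ [set v | x v != 0]%SET \in K].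

Definition disk2 : set (R * R) := [set z | z.1 ^+ 2 + z.2 ^+ 2 <= 1].
Definition circle1 : set (R * R) := [set z | z.1 ^+ 2 + z.2 ^+ 2 = 1].

Definition moment_angle (V : finType) (M : {set {set V}}) : topologicalType :=
  set_type (\bigcup_(s in [set` M])
    [set z : {ptws V -> (R * R)%type} |
      forall v, (if v \in s then disk2 else circle1) (z v)]).

Definition contractible (X : topologicalType) : Prop :=
  exists (x0 : X) (h : X * R -> X),
    [/\ {within [set: X] `*` `[0, 1], continuous h},
        forall x, h (x, 0) = x & forall x, h (x, 1) = x0].

End Spaces.

Section SubsetsOfOrdinals.

(* For J = {j_0 < ... < j_i}, blocks false J is [0, j_0] U [j_1, j_2] U ... and
   blocks true J is [j_0, j_1] U [j_2, j_3] U ... ; they cover 'I_N.+1 and meet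
   exactly in J. *)
Definition blocks N (b : bool) (J : {set 'I_N.+1}) : {set 'I_N.+1} :=
  [set k | (k \in J) || (odd #|[set j in J | (j < k)%N]| == b)]%SET.

Lemma F2_addxx (x : 'F_2) : x + x = 0.
Proof. by apply: addrr_pchar2; rewrite pchar_Fp. Qed.

Lemma F2_opp (x : 'F_2) : - x = x.
Proof. by apply/eqP; rewrite eq_sym -addr_eq0 F2_addxx. Qed.

Lemma enum_setD1 N (A : {set 'I_N}) a : a \in A -> enum (A :\ a)%SET = rem a (enum A).
Proof.
move=> aA; rewrite (rem_filter _ (enum_uniq _)) /enum_mem -filter_predI.
by apply: eq_filter => x; rewrite !inE.
Qed.

Lemma nth_rem_bump (T : eqType) (x0 : T) (s : seq T) k j : uniq s -> (k < size s)%N ->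
  nth x0 (rem (nth x0 s k) s) j = nth x0 s (bump k j).
Proof.
elim: s k j => //= x s IH [|k] j /andP[xs us] ks /=.
  by rewrite eqxx.
rewrite ifN; last by apply: contra xs => /eqP ->; exact: mem_nth.
case: j => [|j] //=; by rewrite IH // bumpS.
Qed.

Lemma enum_lift N (k : 'I_N.+1) (J : {set 'I_N}) :
  enum [set lift k x | x in J]%SET = map (lift k) (enum J).
Proof.
have tr : transitive (fun i j : 'I_N.+1 => (i < j)%N) by move=> ? ? ?; exact: ltn_trans.
have en M (B : {set 'I_M}) : sorted (fun i j : 'I_M => (i < j)%N) (enum B).
  have: sorted (fun i j : 'I_M => (i < j)%N) (enum 'I_M).
    by have := iota_ltn_sorted 0 M; rewrite -val_enum_ord sorted_map.
  have -> : enum B = seq.filter [in B] (enum 'I_M).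
    by rewrite {2}/enum_mem -filter_predI; apply: eq_filter => x; rewrite !inE andbT.
  by apply: sorted_filter => ? ? ?; exact: ltn_trans.
apply: (irr_sorted_eq tr) => //.
- by move=> x; rewrite /= ltnn.
- exact: en.
- rewrite sorted_map; apply: sub_sorted (en _ J) => x y /= xy.
  by rewrite ltnNge leq_bump2 -ltnNge.
- move=> x; rewrite mem_enum; apply/imsetP/mapP => -[y yJ ->]; exists y => //;
  by rewrite ?mem_enum // -mem_enum.
Qed.

Lemma imset_liftD1 N (k : 'I_N.+1) (A : {set 'I_N.+1}) :
  [set lift k x | x in [set x | lift k x \in A]]%SET = (A :\ k)%SET.
Proof.
apply/setP => y; rewrite !inE; apply/imsetP/andP => [[x]|[yk yA]].
  by rewrite !inE => xA ->; rewrite eq_sym neq_lift.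
move: yk; rewrite eq_sym => yk; case: (unlift_some yk) => x ey ux.
by exists x; rewrite // inE -ey.
Qed.

Lemma lift_ltn N (k : 'I_N.+1) (i j : 'I_N) : (lift k i < lift k j)%N = (i < j)%N.
Proof. by rewrite !ltnNge; congr negb; exact: leq_bump2. Qed.

Lemma blocks_lift N (k : 'I_N.+2) (J : {set 'I_N.+1}) b :
  [set lift k x | x in blocks b J]%SET = (blocks b [set lift k x | x in J] :\ k)%SET.
Proof.
rewrite -imset_liftD1.
suff -> : blocks b J =
    [set x | lift k x \in blocks b [set lift k x | x in J]%SET]%SET by [].
apply/setP => x.
rewrite !inE (mem_imset _ _ lift_inj); congr (_ || (odd _ == _)).
rewrite -(card_imset _ (@lift_inj _ k)); apply: eq_card => y.
rewrite inE; apply/imsetP/andP => [[z]|[/imsetP[z zJ ->]]].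
  by rewrite inE => /andP[zJ zx] ->; rewrite lift_ltn zx imset_f.
by rewrite lift_ltn => zx; exists z; rewrite // inE zJ.
Qed.

Lemma sum_lift N m (k : 'I_N.+2) (F : {set 'I_N.+2} -> 'F_2) :
  \sum_(J : {set 'I_N.+1} | #|J| == m) F [set lift k x | x in J]%SET =
  \sum_(J : {set 'I_N.+2} | (#|J| == m) && (k \notin J)) F J.
Proof.
rewrite [RHS](reindex_onto (fun J : {set 'I_N.+1} => [set lift k x | x in J]%SET)
   (fun J : {set 'I_N.+2} => [set x | lift k x \in J]%SET)) /=.
  apply: eq_bigl => J; rewrite (card_imset _ lift_inj).
  rewrite -andbA; case: (#|J| == m) => //=; symmetry; apply/andP; split.
    by apply/imsetP => -[x _ /eqP]; rewrite (negPf (neq_lift _ _)).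
  by apply/eqP/setP => x; rewrite inE (mem_imset _ _ lift_inj).
move=> J /andP[_ kJ]; rewrite imset_liftD1.
by apply/setP => x; rewrite !inE; case: eqP => // ->; rewrite (negPf kJ).
Qed.

Lemma blocksI N (J : {set 'I_N.+1}) k : k \notin J ->
  (k \in blocks true J) = ~~ (k \in blocks false J).
Proof. by rewrite !inE => /negPf -> /=; case: odd. Qed.

Lemma blocksJ N (J : {set 'I_N.+1}) k b : k \in J -> k \in blocks b J.
Proof. by rewrite !inE => ->. Qed.

Lemma setD1_out N (A : {set 'I_N}) k : k \notin A -> (A :\ k)%SET = A.
Proof. by move=> kA; apply/setP => x; rewrite !inE; case: eqP => // ->; rewrite (negPf kA). Qed.

Lemma sum_setU1 N m (G : {set 'I_N} -> 'I_N -> 'F_2) :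
  \sum_(J : {set 'I_N} | #|J| == m.+1) \sum_(a in J) G J a =
  \sum_(J : {set 'I_N} | #|J| == m) \sum_(a | a \notin J) G (a |: J)%SET a.
Proof.
rewrite (exchange_big_dep predT) //= [RHS](exchange_big_dep predT) //=.
apply: eq_bigr => a _.
rewrite (reindex_onto (fun J => a |: J)%SET (fun J => J :\ a)%SET) /=; last first.
  by move=> J /andP[_ aJ]; rewrite finset.setD1K.
apply: eq_bigl => J; rewrite finset.setU11 andbT cardsU1.
have [aJ|aJ] /= := boolP (a \in J).
  rewrite andbF; apply/negbTE; rewrite negb_and; apply/orP; right.
  by apply/eqP => e; have := finset.setD11 a (a |: J)%SET; rewrite e aJ.
by rewrite andbT add1n eqSS finset.setU1K // eqxx andbT.
Qed.

Definition split_blocks N (t : nat) b (J : {set 'I_N.+1}) : {set 'I_N.+1} :=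
  [set k | (k \in J) || (odd #|[set j in J | (j < k)%N]| (+) (t <= k)%N == b)]%SET.

Lemma card_ltU1 N (J : {set 'I_N.+1}) (a k : 'I_N.+1) : a \notin J ->
  #|[set j in (a |: J)%SET | (j < k)%N]%SET| =
  ((a < k) + #|[set j in J | (j < k)%N]%SET|)%N.
Proof.
move=> aJ; have [ak|ka] /= := ltnP a k; last first.
  by apply: eq_card => x; rewrite !inE; case: eqP => //= ->; rewrite (negPf aJ) ltnNge ka.
rewrite -[RHS]/(true + _)%N (_ : true = (a \notin [set j in J | (j < k)%N]%SET)); last first.
  by rewrite inE (negPf aJ).
rewrite -cardsU1; apply: eq_card => x; rewrite !inE.
by case: eqP => //= ->; rewrite ak.
Qed.

Lemma blocksU1D1 N (J : {set 'I_N.+1}) (a : 'I_N.+1) b : a \notin J ->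
  (blocks b (a |: J) :\ a)%SET = (split_blocks (if odd #|[set j in J | (j < a)%N]%SET| == b then (a : nat) else a.+1) b J)%SET /\
  blocks b (a |: J) = (split_blocks (if odd #|[set j in J | (j < a)%N]%SET| == b then a.+1 else (a : nat)) b J)%SET.
Proof.
move=> aJ; split; apply/setP => k; rewrite !inE card_ltU1 // oddD oddb;
  have [->|ka] /= := eqVneq k a.
- by rewrite (negPf aJ) /=; case: ifP => e; rewrite ?leqnn ?ltnn ?addbF ?e //;
  move: e; case: odd; case: b.
- have -> : ((if odd #|[set j in J | (j < a)%N]%SET| == b then (a : nat) else a.+1) <= k)%N = (a < k)%N.
    by case: ifP => // _; rewrite leq_eqVlt eq_sym (negPf (ka : (k != a :> nat))).
  by rewrite addbC.
- by case: ifP => e; rewrite ?leqnn ?ltnn ?addbF ?e ?orbT // ; move: e; case: odd; case: b; rewrite ?orbT.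
- have -> : ((if odd #|[set j in J | (j < a)%N]%SET| == b then a.+1 else (a : nat)) <= k)%N = (a < k)%N.
    by case: ifP => // _; rewrite leq_eqVlt eq_sym (negPf (ka : (k != a :> nat))).
  by rewrite addbC.
Qed.

Lemma telescope_F2 n (T : nat -> 'F_2) : \sum_(a < n) (T a + T a.+1) = T 0%N + T n.
Proof.
elim: n => [|n IH]; first by rewrite big_ord0 F2_addxx.
by rewrite big_ord_recr /= IH addrA -[_ + T n + T n]addrA F2_addxx addr0.
Qed.

End SubsetsOfOrdinals.

Section SingularCohomology.
Variables (R : realType) (X : topologicalType).

Definition std_simplex (p : nat) : set {ptws 'I_p.+1 -> R} :=
  @barycentric R 'I_p.+1.
Arguments std_simplex : clear implicits.

Definition push p q (f : 'I_p.+1 -> 'I_q.+1) (x : {ptws 'I_p.+1 -> R}) :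
  {ptws 'I_q.+1 -> R} := fun j => \sum_(i | f i == j) x i.

Lemma push_subproof p q (f : 'I_p.+1 -> 'I_q.+1) (x : std_simplex p) :
  push f (val x) \in std_simplex q.
Proof.
have [x0 x1] := set_mem (valP x).
apply/mem_set; split=> [j|]; first by apply: sumr_ge0 => i _; exact: x0.
by rewrite -[RHS]x1 [RHS](partition_big f predT).
Qed.

Definition simplex_map p q (f : 'I_p.+1 -> 'I_q.+1) (x : std_simplex p) :
  std_simplex q := SigSub (push_subproof f x).

Lemma simplex_map_continuous p q (f : 'I_p.+1 -> 'I_q.+1) :
  continuous (simplex_map f).
Proof.
apply/continuous_comp_initial => x.
apply/cvg_sup; first exact/fmap_filter/nbhs_filter.
move=> j; move: x; apply: continuous_comp_initial.
apply: (@continuous_big R _ +%R 0 (fun i => f i == j) _ _ _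
  (fun i (x : std_simplex p) => (val x : {ptws 'I_p.+1 -> R}) i)) => [|i _].
  exact: add_continuous.
have vc : continuous (set_val : std_simplex p -> {ptws 'I_p.+1 -> R}).
  exact: initial_continuous.
have pc : continuous (fun y : {ptws 'I_p.+1 -> R} => y i).
  exact: (@proj_continuous _ (fun=> R) i).
move=> x; exact: (continuous_comp (vc x) (pc _)).
Qed.

HB.instance Definition _ p q (f : 'I_p.+1 -> 'I_q.+1) :=
  isContinuous.Build _ _ (simplex_map f)
    (@simplex_map_continuous p q f).

Definition singular_simplex p := continuousType (std_simplex p) X.

Definition restr p q (f : 'I_p.+1 -> 'I_q.+1) (s : singular_simplex q) :
  singular_simplex p := s \o simplex_map f.

Lemma restr_comp p q r (f : 'I_p.+1 -> 'I_q.+1) (g : 'I_q.+1 -> 'I_r.+1)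
  (s : singular_simplex r) : restr f (restr g s) = restr (g \o f) s.
Proof.
apply/continuousEP => x /=; congr (s _); apply/val_inj/funext => k.
rewrite /= /push [RHS](partition_big f (fun j => g j == k)) => [|i ->] //=.
apply: eq_bigr => j /eqP gj; apply: eq_bigl => i.
by case: eqP => [->|]; rewrite ?andbF // gj eqxx.
Qed.

Definition cochain p := singular_simplex p -> 'F_2.
HB.instance Definition _ p := GRing.Zmodule.copy (cochain p)
  (singular_simplex p -> 'F_2).

Definition coboundary p (u : cochain p) : cochain p.+1 :=
  fun s => \sum_(k < p.+2) u (restr (lift k) s).

(* u on the face of s spanned by the vertices in A; 0 if it is not p-dimensional. *)
Definition face_eval p N (u : cochain p) (s : singular_simplex N) (A : {set 'I_N.+1}) : 'F_2 :=
  if #|A| == p.+1 then u (restr (fun k : 'I_p.+1 => nth ord0 (enum A) k) s)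
  else 0.

(* Steenrod's cup-i formula at the chain level, m = i + 1 being the number of
   cut vertices j_0 < ... < j_i.  Since #|blocks false J| + #|blocks true J| =
   N + 1 + m, all the terms vanish unless N = p + q - i. *)
Definition overlap p q N (m : nat) (u : cochain p) (v : cochain q) : cochain N :=
  fun s => \sum_(J : {set 'I_N.+1} | #|J| == m)
     face_eval u s (blocks false J) * face_eval v s (blocks true J).

Lemma face_eval_coboundary p N (u : cochain p) (s : singular_simplex N) A :
  face_eval (coboundary u) s A = \sum_(a in A) face_eval u s (A :\ a)%SET.
Proof.
rewrite /face_eval /coboundary; case: eqP => [cA|cA]; last first.
  rewrite big1 // => a aA; rewrite ifN //; apply/eqP => cAa; apply: cA.
  by rewrite (cardsD1 a) aA cAa.
rewrite [RHS](eq_bigr (fun a => u (restr (fun k : 'I_p.+1 => nth ord0 (enum (A :\ a)%SET) k) s))); last first.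
  by move=> a aA; rewrite ifT //; apply/eqP; have := cardsD1 a A; rewrite aA cA add1n => -[].
have sz : size (enum A) = p.+2 by rewrite -cardE.
rewrite -[RHS]big_enum /= [RHS](big_nth ord0) sz big_mkord; apply: eq_bigr => k _.
congr u; rewrite restr_comp; congr restr; apply: funext => j /=.
rewrite enum_setD1; last by rewrite -mem_enum mem_nth // sz.
by rewrite nth_rem_bump ?enum_uniq ?sz.
Qed.

Lemma face_eval_lift p N (u : cochain p) (s : singular_simplex N.+1) (k : 'I_N.+2) A :
  face_eval u (restr (lift k) s) A = face_eval u s [set lift k x | x in A]%SET.
Proof.
rewrite /face_eval (card_imset _ (lift_inj)); case: ifP => // /eqP cA.
rewrite restr_comp; congr u; congr restr; apply: funext => j /=.
by rewrite enum_lift (nth_map ord0) // -cardE cA.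
Qed.

Lemma coboundary_overlap_aux p q N m (u : cochain p) (v : cochain q) (s : singular_simplex N.+1) :
  let U := face_eval u s in let V := face_eval v s in
  coboundary (overlap (N := N) m u v) s + overlap m (coboundary u) v s
    + overlap m u (coboundary v) s =
  \sum_(J : {set 'I_N.+2} | #|J| == m) \sum_(a in J)
    (U (blocks false J :\ a)%SET * V (blocks true J) +
     U (blocks false J) * V (blocks true J :\ a)%SET).
Proof.
move=> U V.
have -> : coboundary (overlap (N := N) m u v) s =
    \sum_(J : {set 'I_N.+2} | #|J| == m) \sum_(a | a \notin J)
    (U (blocks false J :\ a)%SET * V (blocks true J :\ a)%SET).
  rewrite /coboundary /overlap.
  rewrite (eq_bigr (fun a => \sum_(J : {set 'I_N.+2} | (#|J| == m) && (a \notin J))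
     (U (blocks false J :\ a)%SET * V (blocks true J :\ a)%SET))); last first.
    move=> k _; rewrite -(sum_lift m k (fun J => U (blocks false J :\ k)%SET * V (blocks true J :\ k)%SET)).
    by apply: eq_bigr => J _; rewrite !face_eval_lift !blocks_lift.
  rewrite (exchange_big_dep (fun J : {set 'I_N.+2} => #|J| == m)) /=; last by move=> ? ? _ /andP[].
  by apply: eq_bigr => J /eqP ->; apply: eq_bigl => a; rewrite eqxx.
rewrite /overlap -!big_split /=; apply: eq_bigr => J _.
rewrite !face_eval_coboundary -/U -/V mulr_suml mulr_sumr.
rewrite (big_mkcond [in blocks false J]) (big_mkcond [in blocks true J]).
rewrite [X in X + _ + _]big_mkcond [RHS]big_mkcond -!big_split /=.
apply: eq_bigr => a _; have [aJ|aJ] /= := boolP (a \in J).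
  by rewrite !blocksJ // add0r.
rewrite blocksI //; have [aA|aA] /= := boolP (a \in blocks false J).
  by rewrite addr0 (@setD1_out _ (blocks true J)) ?F2_addxx // blocksI // negbK.
by rewrite addr0 (@setD1_out _ (blocks false J)) ?F2_addxx.
Qed.

(* d (u cup_i v) = du cup_i v + u cup_i dv + u cup_(i-1) v + v cup_(i-1) u *)
Lemma coboundary_overlap p q N m (u : cochain p) (v : cochain q) (s : singular_simplex N.+1) :
  coboundary (overlap (N := N) m.+1 u v) s =
  overlap m.+1 (coboundary u) v s + overlap m.+1 u (coboundary v) s +
  overlap m u v s + overlap m v u s.
Proof.
have := coboundary_overlap_aux m.+1 u v s; cbv zeta.
set U := face_eval u s; set V := face_eval v s.
rewrite sum_setU1 (eq_bigr (fun J : {set 'I_N.+2} =>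
   U (blocks false J) * V (blocks true J) + V (blocks false J) * U (blocks true J))); last first.
  move=> J _; pose T t := U (split_blocks t false J) * V (split_blocks t true J).
  have -> : U (blocks false J) * V (blocks true J) + V (blocks false J) * U (blocks true J)
     = T 0%N + T N.+2.
    have e0 b : split_blocks 0 b J = blocks (~~ b) J.
      by apply/setP => k; rewrite !inE leq0n addbT; case: odd; case: b.
    have e1 b : split_blocks N.+2 b J = blocks b J.
      by apply/setP => k; rewrite !inE leqNgt ltn_ord addbF.
    by rewrite /T !e0 !e1 /= addrC [V _ * _]mulrC.
  rewrite -telescope_F2 big_mkcond; apply: eq_bigr => a _.
  have [aJ|aJ] /= := boolP (a \in J).
    suff -> : T a = T a.+1 by rewrite F2_addxx.
    have e b : split_blocks a b J = split_blocks a.+1 b J.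
      apply/setP => k; rewrite !inE; have [->|ka] := eqVneq k a; first by rewrite aJ.
      suff -> : (a <= k)%N = (a < k)%N by [].
      by rewrite leq_eqVlt eq_sym (negPf (ka : (k != a :> nat))).
    by rewrite /T !e.
  have [A0 A1] := blocksU1D1 false aJ; have [B0 B1] := blocksU1D1 true aJ.
  rewrite A0 A1 B0 B1 /T; case: odd => //=.
  by rewrite addrC.
rewrite big_split /= -/(overlap m u v s) -/(overlap m v u s) => e.
have h (x y z t : 'F_2) : z + x + y = t -> z = x + y + t.
  by move=> <-; rewrite -[z + x + y]addrA [RHS]addrCA F2_addxx addr0.
by rewrite -addrA; apply: h.
Qed.
Lemma cochainDE p (u v : cochain p) s : (u + v) s = u s + v s.
Proof. by []. Qed.

Lemma cochainNE p (u : cochain p) s : (- u) s = - u s.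
Proof. by []. Qed.

Lemma coboundaryD p (u v : cochain p) :
  coboundary (u + v) = coboundary u + coboundary v.
Proof. by apply: funext => s; rewrite cochainDE /coboundary -big_split. Qed.

Lemma coboundaryN p (u : cochain p) : coboundary (- u) = - coboundary u.
Proof. by apply: funext => s; rewrite cochainNE /coboundary -sumrN. Qed.

Lemma coboundary0 p : coboundary (0 : cochain p) = 0.
Proof. by apply: funext => s; rewrite /coboundary big1. Qed.

Lemma face_evalD p N (u v : cochain p) (s : singular_simplex N) A :
  face_eval (u + v) s A = face_eval u s A + face_eval v s A.
Proof. by rewrite /face_eval; case: ifP => // _; rewrite addr0. Qed.

Lemma face_eval0 p N (s : singular_simplex N) A :
  face_eval (0 : cochain p) s A = 0.
Proof. by rewrite /face_eval; case: ifP. Qed.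

Lemma overlapDl p q N m (u u' : cochain p) (v : cochain q) :
  overlap m (u + u') v = overlap m u v + overlap m u' v :> cochain N.
Proof.
apply: funext => s; rewrite cochainDE /overlap -big_split; apply: eq_bigr => J _ /=.
by rewrite face_evalD mulrDl.
Qed.

Lemma overlapDr p q N m (u : cochain p) (v v' : cochain q) :
  overlap m u (v + v') = overlap m u v + overlap m u v' :> cochain N.
Proof.
apply: funext => s; rewrite cochainDE /overlap -big_split; apply: eq_bigr => J _ /=.
by rewrite face_evalD mulrDr.
Qed.

Lemma overlap0l p q N m (v : cochain q) :
  overlap m (0 : cochain p) v = 0 :> cochain N.
Proof.
by apply: funext => s; rewrite /overlap big1 // => J _; rewrite face_eval0 mul0r.
Qed.

Lemma overlap0r p q N m (u : cochain p) :
  overlap m u (0 : cochain q) = 0 :> cochain N.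
Proof.
by apply: funext => s; rewrite /overlap big1 // => J _; rewrite face_eval0 mulr0.
Qed.

Lemma overlap_zero p q N (u : cochain p) (v : cochain q) :
  overlap 0 u v = 0 :> cochain N.
Proof.
apply: funext => s; rewrite /overlap big1 // => J /eqP/cards0_eq ->.
rewrite [X in _ * X]/face_eval.
suff -> : blocks true (finset.set0 : {set 'I_N.+1}) = finset.set0.
  by rewrite cards0 mulr0.
apply/setP => k; rewrite !inE /=.
rewrite (_ : #|_| = 0%N) //; apply/eqP; rewrite cards_eq0.
by apply/eqP/setP => j; rewrite !inE.
Qed.

Lemma coboundary_overlapE p q N m (u : cochain p) (v : cochain q) :
  coboundary (overlap m.+1 u v : cochain N) =
  overlap m.+1 (coboundary u) v + overlap m.+1 u (coboundary v) +
  overlap m u v + overlap m v u.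
Proof. by apply: funext => s; rewrite coboundary_overlap. Qed.

Lemma cochain_addxx p (u : cochain p) : u + u = 0.
Proof. by apply: funext => s; exact: F2_addxx. Qed.

Definition cocycle_pred p : {pred cochain p} := fun u => `[< coboundary u = 0 >].

Lemma cocycle_zmod_closed p : zmod_closed (@cocycle_pred p).
Proof.
split=> [|u v]; rewrite !unfold_in; first by apply/asboolP; rewrite coboundary0.
move=> /asboolP u0 /asboolP v0; apply/asboolP.
by rewrite coboundaryD coboundaryN u0 v0 subrr.
Qed.

HB.instance Definition _ p :=
  GRing.isZmodClosed.Build (cochain p) (@cocycle_pred p)
    (@cocycle_zmod_closed p).

Record cocycle p := Cocycle {
  cocycle_val :> cochain p;
  cocycleP : cocycle_val \in @cocycle_pred p }.

HB.instance Definition _ p := [isSub for @cocycle_val p].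
HB.instance Definition _ p := [Choice of cocycle p by <:].
HB.instance Definition _ p := [SubChoice_isSubZmodule of cocycle p by <:].

(* p-coboundaries; the only 0-coboundary is 0. *)
Definition is_coboundary p : cochain p -> Prop :=
  if p is q.+1 then fun u => exists w : cochain q, u = coboundary w
  else fun u => u = 0.

Definition coboundary_pred p : {pred cocycle p} :=
  fun z => `[< is_coboundary (val z) >].

Lemma coboundary_zmod_closed p : zmod_closed (@coboundary_pred p).
Proof.
case: p => [|p]; split=> [|u v]; rewrite !unfold_in.
- exact/asboolP.
- by move=> /asboolP /= u0 /asboolP /= v0; apply/asboolP; rewrite /= u0 v0 subrr.
- by apply/asboolP; exists 0; rewrite coboundary0.
- move=> /asboolP[w u0] /asboolP[x v0]; apply/asboolP; exists (w - x).
  by rewrite /= u0 v0 coboundaryD coboundaryN.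
Qed.

HB.instance Definition _ p :=
  GRing.isZmodClosed.Build (cocycle p) (@coboundary_pred p)
    (@coboundary_zmod_closed p).

Definition cohomology p := Quotient.quot (@coboundary_pred p).
HB.instance Definition _ p := GRing.Zmodule.on (cohomology p).

Definition cup_i (i p q N : nat) (u : cochain p) (v : cochain q) : cochain N :=
  overlap i.+1 u v.

(* Sq^n [z] = [z cup_(p - n) z] for z of degree p >= n, and 0 for p < n. *)
Definition steenrod_cochain n p (z : cochain p) : cochain (p + n)%N :=
  if (n <= p)%N then cup_i (p - n) z z else 0.
Arguments steenrod_cochain n%_N {p}%_N z.

Lemma steenrod_cochainP n p (z : cocycle p) :
  steenrod_cochain n z \in @cocycle_pred (p + n)%N.
Proof.
have /asboolP z0 := cocycleP z.
apply/asboolP; rewrite /steenrod_cochain; case: ifP => _.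
  rewrite coboundary_overlapE z0 overlap0l overlap0r !add0r.
  exact: cochain_addxx.
exact: coboundary0.
Qed.

Definition steenrod_cocycle n p (z : cocycle p) : cocycle (p + n)%N :=
  Cocycle (steenrod_cochainP n z).
Arguments steenrod_cocycle n%_N {p}%_N z.

Definition Sq n p (x : cohomology p) : cohomology (p + n)%N :=
  \pi_(cohomology (p + n)%N) (steenrod_cocycle n (repr x)).
Arguments Sq n%_N {p}%_N x.

Lemma steenrod_cocycle_equiv n p (z z' : cocycle p) :
  z' - z \in @coboundary_pred p ->
  steenrod_cocycle n z' - steenrod_cocycle n z \in @coboundary_pred (p + n)%N.
Proof.
have /asboolP z0 := cocycleP z; have /asboolP z'0 := cocycleP z'.
rewrite !unfold_in => /asboolP; rewrite /= => zz'; apply/asboolP.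
rewrite /= /steenrod_cochain.
case: p z z' z0 z'0 zz' => [|p] z z' z0 z'0 /=.
  by move/eqP; rewrite subr_eq0 => /eqP ->; rewrite subrr; case: n => [|n];
    [|exists 0; rewrite coboundary0].
case=> w zz'; case: ifP => _; last by exists 0; rewrite subrr coboundary0.
set i := (p.+1 - n)%N; rewrite /cup_i.
have d0 : coboundary (coboundary w) = 0.
  by rewrite -zz' coboundaryD coboundaryN z0 z'0 subrr.
have -> : cocycle_val z' = cocycle_val z + coboundary w.
  by rewrite -zz' addrCA subrr addr0.
have sq_dw : overlap i.+1 (coboundary w) (coboundary w) =
    coboundary (overlap i.+1 w (coboundary w) + overlap i w w : cochain (p + n)).
  rewrite coboundaryD coboundary_overlapE d0 overlap0r addr0.
  have -> : coboundary (overlap i w w : cochain (p + n)) =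
      overlap i w (coboundary w) + overlap i (coboundary w) w.
    case: i => [|j]; first by rewrite !overlap_zero coboundary0 addr0.
    by rewrite coboundary_overlapE -addrA cochain_addxx addr0 addrC.
  by rewrite -[X in _ = X + _]addrA -addrA cochain_addxx addr0.
exists (overlap i.+2 (cocycle_val z) (coboundary w) +
  (overlap i.+1 w (coboundary w) + overlap i w w)).
rewrite coboundaryD -sq_dw coboundary_overlapE z0 d0 overlap0l overlap0r !add0r.
rewrite !overlapDl !overlapDr -addrA.
set a := overlap _ z z; set b := overlap _ z _.
by rewrite [a + b]addrC addrACA subrr addr0 addrA.
Qed.

Lemma Sq_pi n p (z : cocycle p) :
  Sq n (\pi_(cohomology p) z) = \pi_(cohomology (p + n)%N) (steenrod_cocycle n z).
Proof.
apply/eqP; rewrite /Sq -Quotient.idealrBE; apply: steenrod_cocycle_equiv.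
by rewrite Quotient.idealrBE reprK.
Qed.

Definition Sq_nonzero n : Prop :=
  exists p (x : cohomology p), Sq n x <> 0.

End SingularCohomology.

(* Main.v *)
(* Let Sq^n act nontrivially on K (resp. on some L_i0).  No L_i is a full simplex,
   so each has a minimal nonface, on which it restricts to a simplex boundary; and
   since K is not a cone with apex i0, it has a minimal nonface through i0.
   Restricting the composition complex to minimal nonfaces of the L_i (resp. to a
   minimal nonface of K through i0, all of L_i0, and minimal nonfaces of the other
   L_i) gives a full subcomplex N that is an iterated suspension of K (resp. of
   L_i0), and Z_N is a retract of the whole moment-angle complex.  Replacing the
   disk by a square turns Z_N into the polyhedral product of the pairs
   ([-1, 1], {-1, 1}) over N with every vertex replaced by an edge, again an
   iterated suspension.  In such a product RZ_N the positive orthant is a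
   contractible cone on |N|, and the commuting retractions z_v |-> -|z_v| make the
   connecting map from H^p(|N|) to H^{p+1}(RZ_N) injective for p > 0.

   The suspensions and this last map are all handled by one Mayer-Vietoris argument
   on singular cochains; it commutes with Sq^n because
   du cup_(i+1) du = d (u cup_(i+1) du + u cup_i u).  The small simplices theorem
   and homotopy invariance both come from coning operators on lists of points,
   dualised to functionals on lists so that no formal chains are needed. *)
Require Import Defs.
From HB Require Import structures.
From mathcomp Require Import all_boot all_order all_algebra.
From mathcomp Require Import all_classical reals topology normedtype.
From mathcomp Require Import generic_quotient ring_quotient sequences realfun.
From mathcomp Require Import ring lra.

Set Implicit Arguments.
Unset Strict Implicit.
Unset Printing Implicit Defensive.

Import Order.TTheory GRing.Theory Num.Theory.
Import numFieldNormedType.Exports.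

Local Open Scope classical_set_scope.
Local Open Scope ring_scope.

(** The class carried through the construction is a cocycle of degree [p >= n] whose square is not a
    coboundary; every suspension raises its degree by one. A connecting map has to be injective only
    at the square, whose degree is positive, so acyclicity is needed in positive degrees only and
    reduced cohomology never appears. Relative cohomology is replaced by cochains that vanish on the
    simplices inside a given set. Both restrictions of the composition complex have one common form,
    [block_complex]: a face must have its set of full blocks in a given complex, unless it misses a
    vertex that belongs to no block. This form survives the replacement of each vertex by an edge,
    so a single induction, adding one vertex at a time, produces all the suspensions. *)

Local Notation Delta R q := (set_type (@std_simplex R q)).

(** * Functionals on lists of points: boundary, cones, subdivision *)

Section ListCochains.
Variable P : Type.
Implicit Types (phi psi : seq P -> 'F_2) (l t : seq P).

(** The dual of the boundary of an ordered simplex. The complex is augmented: the only face of a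
    one-point list is the empty list. *)
Fixpoint ldiff phi l : 'F_2 :=
  if l is x :: t then phi t + ldiff (fun t' => phi (x :: t')) t else 0.

Lemma ldiff_ext phi psi l :
  (forall t, (size t).+1 = size l -> (forall x, List.In x t -> List.In x l) ->
     phi t = psi t) ->
  ldiff phi l = ldiff psi l.
Proof.
elim: l phi psi => //= x l IH phi psi e.
rewrite e //; last by move=> y; right.
congr (_ + _); apply: IH => t st tl; apply: e; first by rewrite /= st.
by move=> y [->|/tl]; [left|right].
Qed.

Lemma ldiffD phi psi l : ldiff (phi \+ psi) l = ldiff phi l + ldiff psi l.
Proof.
by elim: l phi psi => [|x l IH] phi psi /=; rewrite ?addr0 // addrACA -IH.
Qed.

Lemma ldiff0 l : ldiff (fun=> 0) l = 0.
Proof. by elim: l => //= x l ->; rewrite addr0. Qed.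

Lemma ldiffK phi l : ldiff (ldiff phi) l = 0.
Proof.
elim: l phi => //= x l IH phi; rewrite (ldiffD phi) addrA.
by rewrite F2_addxx add0r IH.
Qed.

Lemma ldiff_nth x0 phi l n : size l = n.+1 ->
  ldiff phi l = \sum_(k < n.+1) phi (mkseq (fun i => nth x0 l (bump k i)) n).
Proof.
elim: l n phi => // x l IH n phi [sl].
rewrite /= big_ord_recl /=; congr (phi _ + _).
  apply: (@eq_from_nth _ x0); first by rewrite size_mkseq.
  by move=> i il; rewrite nth_mkseq -?sl.
case: n sl => [|n] sl; first by rewrite (size0nil sl) big_ord0.
rewrite (IH n) //; apply: eq_bigr => k _; congr phi.
rewrite /mkseq /= -[1%N]addn0 iotaDl -map_comp; congr cons.
by apply: eq_map => i /=; rewrite add1n /bump /= ltnS; case: leqP.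
Qed.

End ListCochains.

Lemma ldiff_map (P P' : Type) (f : P -> P') (phi : seq P' -> 'F_2) l :
  ldiff phi (map f l) = ldiff (phi \o map f) l.
Proof. by elim: l phi => //= x l IH phi; rewrite IH. Qed.

Section Cones.
Variables (P P' : Type) (b : seq P -> P') (E : (seq P' -> 'F_2) -> seq P -> 'F_2).
Implicit Types (phi psi : seq P' -> 'F_2) (l : seq P).

(* The dual of the chain map [T l = b l :: (E l + T (d l))], a chain homotopy
   from [E] to [0]. *)
Fixpoint cone_htpy n phi l : 'F_2 :=
  if n is n'.+1 then
    let psi t := phi (b l :: t) in E psi l + ldiff (cone_htpy n' psi) l
  else 0.

Hypothesis ED : forall phi psi l, E (phi \+ psi) l = E phi l + E psi l.

Lemma cone_htpyD n phi psi l :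
  cone_htpy n (phi \+ psi) l = cone_htpy n phi l + cone_htpy n psi l.
Proof.
elim: n phi psi l => [|n IH] phi psi l /=; first by rewrite addr0.
rewrite addrACA -ED -ldiffD; congr (_ + _).
by apply: ldiff_ext => t _ _; rewrite /= -IH.
Qed.

Lemma cone_htpy0 n phi l : (forall t, phi t = 0) -> cone_htpy n phi l = 0.
Proof.
move=> /funext ->; have := cone_htpyD n (fun=> 0) (fun=> 0) l.
rewrite (_ : _ \+ _ = fun=> 0); last by apply: funext => t /=; rewrite addr0.
by move/eqP; rewrite -subr_eq0 opprD addNKr oppr_eq0 => /eqP.
Qed.

Hypothesis E_nil : forall phi, E phi [::] = 0.
Hypothesis E_diff : forall phi x l, E (ldiff phi) (x :: l) = ldiff (E phi) (x :: l).

(** Coning gives [ldiff phi (b l :: t) = phi t + ldiff phib t]. By induction on the facets of [l],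
    [cone_htpy n (ldiff phib)] is [E phib] plus a coboundary; the coboundary dies by [ldiffK], and
    [E phib] cancels [E (ldiff phib)] because [E] commutes with [ldiff]. *)
Lemma cone_htpyP phi l :
  ldiff (cone_htpy (size l).-1 phi) l + cone_htpy (size l) (ldiff phi) l = E phi l.
Proof.
move: {2}(size l) (erefl (size l)) => n; elim: n phi l => [|n IH] phi l sl.
  by rewrite (size0nil sl) /= addr0 E_nil.
case: l sl => // x l' sl; set l := x :: l' in sl *; rewrite sl.
set phib := fun t => phi (b l :: t).
have e t : ldiff phi (b l :: t) = (phi \+ ldiff phib) t by [].
have -> : cone_htpy n.+1 (ldiff phi) l =
  E (phi \+ ldiff phib) l + ldiff (cone_htpy n (phi \+ ldiff phib)) l by [].
have -> : ldiff (cone_htpy n (phi \+ ldiff phib)) l =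
    ldiff ((cone_htpy n phi \+ E phib) \+ ldiff (cone_htpy n.-1 phib)) l.
  apply: ldiff_ext => t; rewrite sl => -[st] _; rewrite cone_htpyD /=.
  by rewrite -addrA; congr (_ + _); rewrite -(IH phib t st) st addrAC F2_addxx add0r.
rewrite ED E_diff !ldiffD ldiffK addr0 -/l /= [E phi l + _ + _]addrACA.
by rewrite F2_addxx addr0 addrCA F2_addxx addr0.
Qed.

End Cones.

Section Subdivision.
Variables (P : Type) (b : seq P -> P).
Implicit Types (phi psi : seq P -> 'F_2) (l : seq P).

(* The dual of the chain map [S l = b l :: S (d l)], i.e. barycentric
   subdivision when [b] is the barycenter. *)
Fixpoint cone_sd n phi l : 'F_2 :=
  if n is n'.+1 then ldiff (cone_sd n' (fun t => phi (b l :: t))) l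
  else phi l.

Lemma cone_sdD n phi psi l :
  cone_sd n (phi \+ psi) l = cone_sd n phi l + cone_sd n psi l.
Proof.
elim: n phi psi l => [|n IH] phi psi l //=; rewrite -ldiffD.
by apply: ldiff_ext => t _ _; rewrite /= -IH.
Qed.

Lemma cone_sd_ext n phi psi l : (forall t, size t = n -> phi t = psi t) ->
  size l = n -> cone_sd n phi l = cone_sd n psi l.
Proof.
elim: n l phi psi => [|n IH] l phi psi e sl; first exact: e.
apply: ldiff_ext => t; rewrite sl => -[st] _; apply: IH => // t' st'.
by apply: e; rewrite /= st'.
Qed.

Lemma cone_sd_diff n phi x l : size l = n ->
  cone_sd n.+1 (ldiff phi) (x :: l) = ldiff (cone_sd n phi) (x :: l).
Proof.
elim: n phi x l => [|n IH] phi x l sl; first by rewrite (size0nil sl) /= addr0.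
set phib := fun t => phi (b (x :: l) :: t).
have -> : cone_sd n.+2 (ldiff phi) (x :: l) =
  ldiff (cone_sd n.+1 (phi \+ ldiff phib)) (x :: l) by [].
rewrite (@ldiff_ext _ _ (cone_sd n.+1 phi \+ ldiff (cone_sd n phib))).
  by rewrite ldiffD ldiffK addr0.
move=> [|y t]; rewrite [size (x :: l)]/= sl // => -[st] _.
by rewrite cone_sdD IH.
Qed.

End Subdivision.

Lemma cone_sd_map (P P' : Type) (f : P -> P') b b' n phi l :
  (forall x t, b' (map f (x :: t)) = f (b (x :: t))) -> size l = n ->
  cone_sd b' n phi (map f l) = cone_sd b n (phi \o map f) l.
Proof.
move=> bf; elim: n phi l => //= n IH phi l sl.
have -> : b' (map f l) = f (b l) by case: l sl.
by rewrite ldiff_map; apply: ldiff_ext => t; rewrite sl => -[st] _; rewrite /= IH.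
Qed.

Lemma cone_htpy_map (P Q P' Q' : Type) (f : P -> Q) (f' : P' -> Q') b b' E E' n phi l :
  (forall x t, b' (map f (x :: t)) = f' (b (x :: t))) ->
  (forall phi t, E' phi (map f t) = E (phi \o map f') t) -> size l = n ->
  cone_htpy b' E' n phi (map f l) = cone_htpy b E n (phi \o map f') l.
Proof.
move=> bf Ef; elim: n phi l => //= n IH phi l sl.
have -> : b' (map f l) = f' (b l) by case: l sl.
rewrite ldiff_map Ef; congr (_ + _).
by apply: ldiff_ext => t; rewrite sl => -[st] _; rewrite /= IH.
Qed.


(** * Barycentric subdivision shrinks simplices *)

Section Diameter.
Variables (R : realFieldType) (P I : Type) (c : I -> P -> R) (b : seq P -> P).
Hypothesis bE : forall i x l,
  c i (b (x :: l)) = (\sum_(y <- x :: l) c i y) / (size l).+1%:R.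
Implicit Types (phi : seq P -> 'F_2) (l t : seq P).

Definition diam_le (D : R) l := forall x y i,
  List.In x l -> List.In y l -> `|c i x - c i y| <= D.

(** A substitute for convex hulls: boxes suffice because diameters are measured coordinate by
    coordinate. *)
Definition in_hull t l := forall i lo hi,
  (forall x, List.In x l -> lo <= c i x <= hi) ->
  forall x, List.In x t -> lo <= c i x <= hi.

Lemma sum_seq_le (F : P -> R) l D : (forall x, List.In x l -> F x <= D) ->
  \sum_(x <- l) F x <= D * (size l)%:R.
Proof.
elim: l => [|x l IH] h; first by rewrite big_nil mulr0.
rewrite big_cons /= -natr1 mulrDr mulr1 addrC lerD //.
  by apply: IH => y yl; apply: h; right.
by apply: h; left.
Qed.

Lemma sum_seq_le_pred (F : P -> R) l D v : List.In v l -> F v = 0 ->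
  (forall x, List.In x l -> F x <= D) ->
  \sum_(x <- l) F x <= D * (size l).-1%:R.
Proof.
elim: l => //= x l IH vl Fv h; rewrite big_cons; case: vl => [xv|vl].
  by rewrite xv Fv add0r sum_seq_le // => y yl; apply: h; right.
have -> : (size l) = (size l).-1.+1 by case: l vl {IH h}.
rewrite -natr1 mulrDr mulr1 addrC lerD //.
  by apply: IH => // y yl; apply: h; right.
by apply: h; left.
Qed.

Lemma barycenter_hull x l : in_hull [:: b (x :: l)] (x :: l).
Proof.
move=> i lo hi h _ [<-|//]; rewrite bE.
rewrite ler_pdivlMr ?ltr0n // ler_pdivrMr ?ltr0n //; apply/andP; split.
  rewrite -lerN2 -mulNr -sumrN; apply: (@sum_seq_le (fun y => - c i y)) => y yl.
  by rewrite lerN2; have /andP[] := h y yl.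
by apply: (@sum_seq_le (fun y => c i y)) => y yl; have /andP[] := h y yl.
Qed.

(** One of the averaged differences, the one at [v] itself, is zero; hence the factor n / (n + 1),
    with n the dimension. *)
Lemma barycenter_dist D x l v i : diam_le D (x :: l) -> List.In v (x :: l) ->
  `|c i (b (x :: l)) - c i v| <= D * ((size l)%:R / (size l).+1%:R).
Proof.
move=> dl vl; rewrite bE mulrA ler_pdivlMr ?ltr0n //.
rewrite -{2}[(size l).+1%:R]ger0_norm ?ler0n // -normrM mulrBl.
rewrite divfK ?pnatr_eq0 //.
have -> : \sum_(y <- x :: l) c i y - c i v * (size l).+1%:R =
    \sum_(y <- x :: l) (c i y - c i v).
  by rewrite sumrB big_const_seq count_predT iter_addr_0 mulr_natr.
rewrite (le_trans (ler_norm_sum _ _ _)) //.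
apply: (@sum_seq_le_pred (fun y => `|c i y - c i v|) _ _ v) => //.
  by rewrite subrr normr0.
by move=> y yl; exact: dl.
Qed.

(** A simplex of the subdivision is the barycenter of [l] coned over a simplex [t'] of a subdivided
    facet. The induction carries [in_hull] because the barycenter must also be close to the vertices
    of [t'], which need not be vertices of [l]. *)
Lemma cone_sd_small_hull n phi l D : 0 <= D -> size l = n.+1 -> diam_le D l ->
  (forall t, size t = n.+1 -> in_hull t l -> diam_le (D * (n%:R / n.+1%:R)) t ->
     phi t = 0) ->
  cone_sd b n.+1 phi l = 0.
Proof.
move=> D0; elim: n phi l => [|n IH] phi l.
  case: l => [|x [|]] // _ dl h /=; rewrite addr0; apply: h => //.
    exact: barycenter_hull.
  by move=> y z i [<-|//] [<-|//]; rewrite subrr normr0 mul0r mulr0.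
case: l => // x l [sl] dl h.
have -> : cone_sd b n.+2 phi (x :: l) =
  ldiff (cone_sd b n.+1 (fun t => phi (b (x :: l) :: t))) (x :: l) by [].
rewrite -[RHS](ldiff0 (x :: l)); apply: ldiff_ext => t [st] tl; apply: IH.
- by rewrite st sl.
- by move=> y z i /tl yl /tl zl; exact: dl.
move=> t' st' t'h dt'; have t'l : in_hull t' (x :: l).
  by move=> i lo hi lh; apply: t'h => y yt; apply: lh; exact: tl.
have bt' y i : List.In y t' ->
    `|c i (b (x :: l)) - c i y| <= D * (n.+1%:R / n.+2%:R).
  move=> yt; rewrite ler_distlC; apply: t'l yt => v vl.
  by rewrite -ler_distlC -sl; exact: barycenter_dist.
apply: h; first by rewrite /= st'.
  move=> i lo hi lh y [<-|]; last exact: t'l.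
  by apply: (barycenter_hull lh); left.
move=> y z i [<-|yt] [<-|zt].
- by rewrite subrr normr0 mulr_ge0 // divr_ge0.
- exact: bt'.
- by rewrite distrC; exact: bt'.
apply: le_trans (dt' _ _ _ yt zt) _; rewrite ler_wpM2l //.
rewrite ler_pdivrMr ?ltr0n // mulrAC ler_pdivlMr ?ltr0n // -!natrM ler_nat.
by rewrite [(n * n.+2)%N]mulnS mulSn leq_add2r.
Qed.

Lemma cone_sd_small n k phi l D : 0 <= D -> size l = n.+1 -> diam_le D l ->
  (forall t, size t = n.+1 -> diam_le (D * (n%:R / n.+1%:R) ^+ k) t ->
     phi t = 0) ->
  iter k (cone_sd b n.+1) phi l = 0.
Proof.
elim: k D l => [|k IH] D l D0 sl dl h; first by apply: h; rewrite ?expr0 ?mulr1.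
apply: (cone_sd_small_hull D0 sl dl) => t st _ dt.
apply: (IH _ _ _ st dt) => [|t' st']; first by rewrite mulr_ge0 // divr_ge0.
by rewrite -mulrA -exprS; exact: h.
Qed.

End Diameter.


(** * Affine simplices and the evaluation of cochains on lists *)

Section AffineSimplices.
Variable R : realType.

(* Points [P] that can be averaged: [comb f x] is the affine combination of the
   points [f i] with weights [x i]. *)
Record affine_space := AffineSpace {
  aff_sort :> topologicalType;
  aff_comb : forall q, ('I_q.+1 -> aff_sort) -> Delta R q -> aff_sort;
  aff_comb_continuous : forall q (f : 'I_q.+1 -> aff_sort), continuous (aff_comb f);
  aff_comb_push : forall p q (f : 'I_q.+1 -> aff_sort) (g : 'I_p.+1 -> 'I_q.+1) x,
    aff_comb f (simplex_map g x) = aff_comb (f \o g) x }.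

Definition affine_simplex (P : affine_space) q (f : 'I_q.+1 -> P) :
  continuousType (Delta R q) P := mkcts (@aff_comb_continuous P q f).

Section Eval.
Variables (P : affine_space) (X : topologicalType) (s : continuousType P X).

Definition seq_simplex (x : P) (l : seq P) q : singular_simplex R X q :=
  s \o affine_simplex (fun i : 'I_q.+1 => nth x l i).

(** Turns cochains into functionals on lists so that [coboundary] becomes [ldiff]. The head of the
    list only supplies the default of [nth], which is never reached. *)
Definition seq_eval q (u : cochain R X q) (l : seq P) : 'F_2 :=
  if l is x :: t then (if size t == q then u (seq_simplex x l q) else 0) else 0.

Lemma ldiff_seq_eval q (u : cochain R X q) :
  ldiff (seq_eval u) = seq_eval (coboundary u).
Proof.
apply: funext => l.
case: l => // x t; have [st|st] := eqVneq (size t) q.+1; last first.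
  rewrite [RHS]/= (negPf st) -(ldiff0 (x :: t)); apply: ldiff_ext => -[|y t'] //= [st'] _.
  by rewrite ifN // -eqSS st'.
rewrite (@ldiff_nth _ x _ (x :: t) q.+1) /= ?st // eqxx.
apply: eq_bigr => k _; rewrite /= size_map size_iota eqxx.
congr u; apply/continuousEP => y /=; congr (s _).
rewrite /mkcts aff_comb_push; congr aff_comb; apply: funext => i /=.
by rewrite -[RHS](@nth_mkseq _ x (fun i => nth x (x :: t) (bump k i)) q.+1 i) //;
  apply: set_nth_default; rewrite size_mkseq.
Qed.

Lemma seq_evalD q (u v : cochain R X q) l :
  seq_eval (u + v) l = seq_eval u l + seq_eval v l.
Proof. by rewrite /seq_eval; case: l => [|x t]; [|case: ifP]; rewrite // addr0. Qed.

End Eval.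

Fact simplex_comb_subproof p q (f : 'I_q.+1 -> Delta R p) (x : Delta R q) :
  (fun j => \sum_i val x i * val (f i) j : R) \in @std_simplex R p.
Proof.
have [x0 x1] := set_mem (valP x).
apply/mem_set; split=> [j|].
  by apply: sumr_ge0 => i _; rewrite mulr_ge0 //; have [] := set_mem (valP (f i)).
rewrite exchange_big -[RHS]x1; apply: eq_bigr => i _.
by rewrite -mulr_sumr; have [_ ->] := set_mem (valP (f i)); rewrite mulr1.
Qed.

Definition simplex_comb p q (f : 'I_q.+1 -> Delta R p) (x : Delta R q) : Delta R p :=
  SigSub (simplex_comb_subproof f x).

End AffineSimplices.

Section Continuity.
Variable R : realType.
Implicit Types B : topologicalType.

Lemma continuous_ptws B (V : Type) (T : topologicalType) (f : B -> {ptws V -> T}) :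
  (forall v, continuous (fun x => f x v)) -> continuous f.
Proof.
move=> fc x; apply/cvg_sup.
by move=> v; move: x; apply: continuous_comp_initial; exact: fc.
Qed.

Lemma continuous_eval (V : choiceType) (T : topologicalType) v :
  continuous (fun y : {ptws V -> T} => y v).
Proof. exact: (@proj_continuous _ (fun=> T) v). Qed.

Lemma continuous_val (T : topologicalType) (A : set T) : continuous (val : A -> T).
Proof. exact: initial_continuous. Qed.

Lemma continuous_compT B (T U : topologicalType) (f : B -> T) (g : T -> U) :
  continuous f -> continuous g -> continuous (g \o f).
Proof. by move=> fc gc x; exact: continuous_comp (fc x) (gc _). Qed.

Lemma continuous_sumr B (I : finType) (Q : pred I) (f : I -> B -> R) :
  (forall i, continuous (f i)) -> continuous (fun x => \sum_(i | Q i) f i x).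
Proof.
move=> fc; apply: (@continuous_big R _ +%R 0 Q _ _ _ f) => [|i _]; last exact: fc.
exact: add_continuous.
Qed.

Lemma continuous_mulr B (f g : B -> R) :
  continuous f -> continuous g -> continuous (fun x => f x * g x).
Proof. by move=> fc gc x; apply: (@cvgM _ _ _ _ _ _ (f x) _); [exact: fc|exact: gc]. Qed.

Lemma continuous_addr B (f g : B -> R) :
  continuous f -> continuous g -> continuous (fun x => f x + g x).
Proof. by move=> fc gc x; apply: (@cvgD _ _ _ _ _ _ _ (f x)); [exact: fc|exact: gc]. Qed.

Lemma continuous_oppr B (f : B -> R) :
  continuous f -> continuous (fun x => - f x).
Proof. by move=> fc x; apply: (@cvgN _ _ _ _ _ _ (f x)); exact: fc. Qed.

Lemma continuous_cst B (a : R) : continuous (fun _ : B => a).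
Proof. by move=> x; exact: cst_continuous. Qed.

Lemma continuous_exprn B (f : B -> R) n :
  continuous f -> continuous (fun x => f x ^+ n).
Proof.
move=> fc; elim: n => [|n IH]; first exact: continuous_cst.
by under eq_fun do rewrite exprS; exact: continuous_mulr.
Qed.

Lemma continuous_divr B (f g : B -> R) : continuous f -> continuous g ->
  (forall x, g x != 0) -> continuous (fun x => f x / g x).
Proof.
move=> fc gc g0 x; apply: (@cvgM _ _ _ _ _ _ (f x) _); first exact: fc.
by apply: (@cvgV _ _ _ _ g (g x)); [exact: g0|exact: gc].
Qed.

Lemma continuous_maxr B (f g : B -> R) :
  continuous f -> continuous g -> continuous (fun x => Num.max (f x) (g x)).
Proof. by move=> fc gc x; apply: (@continuous_max R B f g x); [exact: fc|exact: gc]. Qed.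

Lemma continuous_minr B (f g : B -> R) :
  continuous f -> continuous g -> continuous (fun x => Num.min (f x) (g x)).
Proof. by move=> fc gc x; apply: (@continuous_min R B f g x); [exact: fc|exact: gc]. Qed.

Lemma continuous_normr B (f : B -> R) :
  continuous f -> continuous (fun x => `|f x|).
Proof. by move=> fc; apply: (continuous_compT fc); exact: norm_continuous. Qed.

Lemma continuous_sqrtr B (f : B -> R) :
  continuous f -> continuous (fun x => Num.sqrt (f x)).
Proof. by move=> fc; apply: (continuous_compT fc); exact: sqrt_continuous. Qed.

Lemma continuous_pairT B (T U : topologicalType) (f : B -> T) (g : B -> U) :
  continuous f -> continuous g -> continuous (fun x => (f x, g x)).
Proof. by move=> fc gc x; apply: cvg_pair; [exact: fc|exact: gc]. Qed.

Lemma continuous_simplex_coord p B (f : B -> Delta R p) i :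
  continuous f -> continuous (fun x => val (f x) i).
Proof.
move=> fc.
have vc : continuous (val : Delta R p -> {ptws 'I_p.+1 -> R}) by exact: continuous_val.
have ec := @continuous_eval 'I_p.+1 R i.
exact: (continuous_compT (continuous_compT fc vc) ec).
Qed.

End Continuity.

Section SimplexAffine.
Variable R : realType.

Lemma simplex_ext p (x y : Delta R p) : (forall i, val x i = val y i) -> x = y.
Proof. by move=> e; apply/val_inj/funext. Qed.

Lemma simplex_coord01 p (x : Delta R p) i : 0 <= val x i <= 1.
Proof.
have [x0 <-] := set_mem (valP x).
by rewrite x0 (bigD1 i) //= lerDl; apply: sumr_ge0 => j _; exact: x0.
Qed.

Lemma continuous_to_simplex p (B : topologicalType) (f : B -> Delta R p) :
  (forall i, continuous (fun x => val (f x) i)) -> continuous f.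
Proof. by move=> fc; apply/continuous_comp_initial; exact: continuous_ptws. Qed.

Lemma simplex_comb_continuous p q (f : 'I_q.+1 -> Delta R p) :
  continuous (simplex_comb f).
Proof.
apply: continuous_to_simplex => j; apply: continuous_sumr => i.
apply: continuous_mulr; last exact: continuous_cst.
by apply: continuous_simplex_coord => x.
Qed.

Lemma simplex_comb_push p q r (f : 'I_q.+1 -> Delta R r) (g : 'I_p.+1 -> 'I_q.+1) x :
  simplex_comb f (simplex_map g x) = simplex_comb (f \o g) x.
Proof.
apply: simplex_ext => j /=; rewrite [RHS](partition_big g predT) //=; rewrite /push.
apply: eq_bigr => i _; rewrite mulr_suml; apply: eq_bigr => k /eqP gk.
by rewrite /= gk.
Qed.

Lemma simplex_comb_comp p q r (f : 'I_q.+1 -> Delta R r) (g : 'I_p.+1 -> Delta R q) x :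
  simplex_comb f (simplex_comb g x) = simplex_comb (simplex_comb f \o g) x.
Proof.
apply: simplex_ext => j /=.
under eq_bigr do rewrite mulr_suml.
rewrite exchange_big; apply: eq_bigr => k _; rewrite mulr_sumr.
by apply: eq_bigr => i _; rewrite mulrA.
Qed.

Definition simplex_affine p : affine_space R :=
  AffineSpace (@simplex_comb_continuous p) (fun p q => @simplex_comb_push p q _).

Fact vertex_subproof p (i : 'I_p.+1) :
  (fun j => (i == j)%:R : R) \in @std_simplex R p.
Proof.
apply/mem_set; split=> [j|]; first exact: ler0n.
rewrite (bigD1 i) //= eqxx big1 ?addr0 // => j; rewrite eq_sym => /negPf ->.
by rewrite mulr0n.
Qed.

Definition vertex p (i : 'I_p.+1) : Delta R p := SigSub (vertex_subproof i).

Lemma simplex_comb_vertex p q (f : 'I_q.+1 -> Delta R p) i :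
  simplex_comb f (vertex i) = f i.
Proof.
apply: simplex_ext => j /=.
rewrite (bigD1 i) //= eqxx mul1r big1 ?addr0 // => k; rewrite eq_sym => /negPf ->.
by rewrite mul0r.
Qed.

Lemma simplex_comb_id p (x : Delta R p) : simplex_comb (@vertex p) x = x.
Proof.
apply: simplex_ext => j /=.
rewrite (bigD1 j) //= eqxx mulr1 big1 ?addr0 // => k /negPf ->.
by rewrite mulr0.
Qed.

Fact centroid_subproof p : (fun=> p.+1%:R^-1 : R) \in @std_simplex R p.
Proof.
apply/mem_set; split=> [j|]; first by rewrite invr_ge0.
by rewrite sumr_const card_ord -[_ *+ _]mulr_natr mulVf // pnatr_eq0.
Qed.

Definition centroid p : Delta R p := SigSub (centroid_subproof p).

(* The value on the empty list is junk. *)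
Definition barycenter p (l : seq (Delta R p)) : Delta R p :=
  if l is x :: t then simplex_comb (fun i : 'I_(size t).+1 => nth x l i) (centroid _)
  else centroid p.

Lemma barycenterE p i (x : Delta R p) l :
  val (barycenter (x :: l)) i = (\sum_(y <- x :: l) val y i) / (size l).+1%:R.
Proof.
rewrite /= mulr_suml (big_nth x) big_mkord.
by apply: eq_bigr => k _; rewrite mulrC.
Qed.

Lemma barycenter_comb p q (f : 'I_q.+1 -> Delta R p) x l :
  barycenter (map (simplex_comb f) (x :: l)) = simplex_comb f (barycenter (x :: l)).
Proof.
apply: simplex_ext => i; rewrite barycenterE size_map.
have -> : val (simplex_comb f (barycenter (x :: l))) i =
  \sum_k val (barycenter (x :: l)) k * val (f k) i by [].
under [RHS]eq_bigr do rewrite barycenterE mulrAC.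
rewrite -mulr_suml; congr (_ / _); under [RHS]eq_bigr do rewrite mulr_suml.
by rewrite exchange_big -[_ :: map _ _]/(map (simplex_comb f) (x :: l)) big_map.
Qed.

Definition vertices p : seq (Delta R p) := map (@vertex p) (enum 'I_p.+1).

Lemma size_vertices p : size (vertices p) = p.+1.
Proof. by rewrite size_map size_enum_ord. Qed.

(** Any [q.+1] points are the affine image of the standard vertices, so operators defined at
    [vertices] alone are known on all such lists by naturality. *)
Lemma map_vertices p q (l : seq (Delta R p)) x :
  size l = q.+1 ->
  map (simplex_comb (fun i : 'I_q.+1 => nth x l i)) (vertices q) = l.
Proof.
move=> sl; apply: (@eq_from_nth _ x); rewrite size_map size_vertices ?sl // => i iq.
rewrite (nth_map (vertex ord0)); last by rewrite size_vertices.
rewrite (nth_map ord0); last by rewrite size_enum_ord.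
rewrite simplex_comb_vertex.
by rewrite nth_enum_ord.
Qed.

Lemma vertices_cons p : vertices p = vertex ord0 :: behead (vertices p).
Proof. by rewrite /vertices enum_ordSl. Qed.

Lemma seq_simplex_vertices p (X : topologicalType) (s : singular_simplex R X p) x :
  seq_simplex (s : continuousType (simplex_affine p) X) x (vertices p) p = s.
Proof.
apply/continuousEP => y /=; congr (s _); rewrite /mkcts /= -[RHS]simplex_comb_id.
congr simplex_comb; apply: funext => i.
rewrite (nth_map ord0) ?size_enum_ord //; congr vertex; apply: val_inj.
by rewrite /= nth_enum_ord.
Qed.

End SimplexAffine.

(** * The subdivision operator and its homotopy to the identity *)

Section SubdivisionOperator.
Variables (R : realType) (X : topologicalType).
Local Notation simp s := (s : continuousType (simplex_affine R _) X).

Lemma seq_eval_vertices q (u : cochain R X q) (s : singular_simplex R X q) :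
  seq_eval (simp s) u (vertices R q) = u s.
Proof.
rewrite vertices_cons /seq_eval -vertices_cons size_behead size_vertices eqxx.
by rewrite seq_simplex_vertices.
Qed.

Lemma coboundary_vertices q (u : cochain R X q) (s : singular_simplex R X q.+1) :
  coboundary u s = ldiff (seq_eval (simp s) u) (vertices R q.+1).
Proof. by rewrite ldiff_seq_eval seq_eval_vertices. Qed.

Lemma coboundaryK q (u : cochain R X q) : coboundary (coboundary u) = 0.
Proof.
apply: funext => s; rewrite coboundary_vertices -[RHS](ldiffK (seq_eval (simp s) u) (vertices R q.+2)).
by apply: ldiff_ext => t _ _; rewrite ldiff_seq_eval.
Qed.

Lemma seq_eval_comp p q r (s : singular_simplex R X p) (x : Delta R p) l
    (u : cochain R X r) t :
  seq_eval (simp (seq_simplex (simp s) x l q)) u t =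
  seq_eval (simp s) u (map (simplex_comb (fun i : 'I_q.+1 => nth x l i)) t).
Proof.
case: t => // y t; rewrite /seq_eval /= size_map; case: eqP => // st.
congr u; apply/continuousEP => z /=; congr (s _); rewrite /mkcts /= simplex_comb_comp.
congr simplex_comb; apply: funext => i /=.
by symmetry; apply: (@nth_map _ y _ _ _ i (y :: t)); rewrite /= st.
Qed.

Definition sd q (u : cochain R X q) : cochain R X q := fun s =>
  cone_sd (@barycenter R q) q.+1 (seq_eval (simp s) u) (vertices R q).

(** Identity plus subdivision: with this [E], [cone_htpy] is a homotopy between the two. *)
Let sdE p (phi : seq (Delta R p) -> 'F_2) l :=
  phi l + cone_sd (@barycenter R p) (size l) phi l.

Definition sd_htpy q (u : cochain R X q.+1) : cochain R X q := fun s =>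
  cone_htpy (@barycenter R q) (@sdE q) q.+1 (seq_eval (simp s) u) (vertices R q).

Lemma seq_eval_sd p q (s : singular_simplex R X p) (u : cochain R X q) l :
  size l = q.+1 ->
  seq_eval (simp s) (sd u) l = cone_sd (@barycenter R p) q.+1 (seq_eval (simp s) u) l.
Proof.
case: l => // x l sl; rewrite /seq_eval -/(seq_eval _ _); have [->] := sl; rewrite eqxx /sd.
rewrite (funext (@seq_eval_comp _ _ _ s x (x :: l) u)).
rewrite -[in RHS](map_vertices x sl); symmetry; apply: cone_sd_map.
  by move=> y t; exact: barycenter_comb.
exact: size_vertices.
Qed.

Lemma seq_eval_sd_htpy p q (s : singular_simplex R X p) (u : cochain R X q.+1) l :
  size l = q.+1 ->
  seq_eval (simp s) (sd_htpy u) l =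
  cone_htpy (@barycenter R p) (@sdE p) q.+1 (seq_eval (simp s) u) l.
Proof.
case: l => // x l sl; rewrite /seq_eval -/(seq_eval _ _); have [->] := sl; rewrite eqxx /sd_htpy.
rewrite (funext (@seq_eval_comp _ _ _ s x (x :: l) u)).
rewrite -[in RHS](map_vertices x sl); symmetry; apply: cone_htpy_map.
- by move=> y t; exact: barycenter_comb.
- move=> phi t; rewrite /sdE size_map (cone_sd_map _ (b := @barycenter R q)) //.
  by move=> z t'; exact: barycenter_comb.
exact: size_vertices.
Qed.

Lemma coboundary_sd q (u : cochain R X q) : coboundary (sd u) = sd (coboundary u).
Proof.
apply: funext => s; rewrite coboundary_vertices /sd.
rewrite -(ldiff_seq_eval (simp s) u) [in RHS]vertices_cons cone_sd_diff -?vertices_cons.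
  by apply: ldiff_ext => t; rewrite size_vertices => -[st] _; exact: seq_eval_sd.
by rewrite size_behead size_vertices.
Qed.

Lemma sd_htpyP q (u : cochain R X q.+1) :
  coboundary (sd_htpy u) + sd_htpy (coboundary u) = u + sd u.
Proof.
apply: funext => s; rewrite !cochainDE coboundary_vertices.
rewrite [X in _ + X]/sd_htpy -(ldiff_seq_eval (simp s) u).
have -> : u s + sd u s = sdE (seq_eval (simp s) u) (vertices R q.+1).
  by rewrite /sdE seq_eval_vertices size_vertices.
rewrite -(@cone_htpyP _ _ (@barycenter R q.+1) (@sdE q.+1)).
- rewrite size_vertices; congr (_ + _); apply: ldiff_ext => t.
  by rewrite size_vertices => -[st] _; exact: seq_eval_sd_htpy.
- by move=> phi psi l; rewrite /sdE cone_sdD addrACA.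
- by move=> phi; rewrite /sdE /= F2_addxx.
move=> phi x l; rewrite /sdE [size _]/= cone_sd_diff // -ldiffD.
by apply: ldiff_ext => t [st] _; rewrite /= st.
Qed.

End SubdivisionOperator.

(** * Lebesgue numbers and small simplices *)

Section Lebesgue.
Variables (R : realType) (q : nat).
Local Notation rV := ('rV[R]_q.+1).

Lemma coord_functional_continuous :
  continuous (fun v : rV => (fun j => v ord0 j) : {ptws 'I_q.+1 -> R}).
Proof. by apply: continuous_ptws => j; exact: coord_continuous. Qed.

Lemma compact_simplex_rows :
  compact [set v : rV | std_simplex (fun j => v ord0 j : R)].
Proof.
apply: (@subclosed_compact _ _ [set v : rV | forall j, `[0, 1]%classic (v ord0 j)]).
- rewrite (_ : [set v | _] =
     (\bigcap_(j in [set: 'I_q.+1]) [set v : rV | 0 <= v ord0 j]) `&`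
     [set v : rV | \sum_j v ord0 j = 1]); last first.
    by apply/seteqP; split=> v /= [v0 v1]; split=> // j *; exact: v0.
  apply: closedI; first apply: closed_bigI => j _.
    apply: (@preimage_closed _ _ (fun v : rV => v ord0 j) [set x | 0 <= x]).
      by move=> v _; exact: coord_continuous.
    exact: closed_ge.
  apply: (@preimage_closed _ _ (fun v : rV => \sum_j v ord0 j) [set x | x = 1]).
    by move=> v _; apply: continuous_sumr => j; exact: coord_continuous.
  exact: closed_eq.
- by apply: (@rV_compact R q.+1 (fun=> `[0, 1]%classic)) => j; exact: segment_compact.
move=> v /= [v0 v1] j; rewrite in_itv /= v0 -v1 (bigD1 j) //= lerDl.
exact: sumr_ge0.
Qed.

Lemma simplex_nbhs_box (x : Delta R q) (A : set (Delta R q)) : nbhs x A ->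
  exists2 e : R, 0 < e &
    forall z : Delta R q, (forall j, `|val x j - val z j| < e) -> A z.
Proof.
rewrite nbhsE => -[B [[O oO <-] Ox] BA].
pose row (z : Delta R q) : rV := \row_j val z j.
have rowE z : (fun j => row z ord0 j) = val z by apply: funext => j; rewrite mxE.
have : nbhs (row x) ((fun v : rV => (fun j => v ord0 j) : {ptws 'I_q.+1 -> R}) @^-1` O).
  apply: coord_functional_continuous; apply: open_nbhs_nbhs; split=> //.
  by rewrite rowE.
rewrite -nbhs_ballE => -[e /= e0 eO]; exists e => // z xz; apply: BA => /=.
have : ball (row x) e (row z).
  by split=> // i j; rewrite ord1 !mxE; exact: xz.
by move=> /eO /=; rewrite rowE.
Qed.

(** Half the radius of a box inside one [C i] also serves all points within that half; compactness,
    in its near-covering form, makes the radius uniform. *)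
Lemma simplex_lebesgue (I : Type) (C : I -> set (Delta R q)) :
  (forall x : Delta R q, exists i, nbhs x (C i)) ->
  exists2 e : R, 0 < e & forall y : Delta R q, exists i,
    forall z : Delta R q, (forall j, `|val y j - val z j| <= e) -> C i z.
Proof.
move=> Ccov.
pose P (e : R) (v : rV) := exists i, forall z : Delta R q,
  (forall j, `|v ord0 j - val z j| <= e) -> C i z.
have : \forall e \near (0 : R)^'+,
    [set v : rV | std_simplex (fun j => v ord0 j : R)] `<=` P e.
  have /compact_near_coveringP := compact_simplex_rows.
  apply => v vK.
  have vD : (fun j => v ord0 j : R) \in @std_simplex R q by exact/mem_set.
  have [i] := Ccov (SigSub vD).
  move=> /simplex_nbhs_box[d d0 dC].
  near=> v' e; exists i => z zv; apply: dC => j /=.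
  have : ball v (d / 2) v' by near: v'; apply: nbhsx_ballx; rewrite divr_gt0.
  move=> [_ /(_ ord0 j)]; rewrite /ball /= => vv'.
  have eS : e < d / 2 by near: e; apply: nbhs_right_lt; rewrite divr_gt0.
  rewrite -(subrKA (v' ord0 j)) (le_lt_trans (ler_normD _ _)) //.
  by rewrite [d in _ < d]splitr ltrD // (le_lt_trans (zv j)).
move=> /(filterI (nbhs_right_gt 0)) /filter_ex[e [/= e0 eP]].
exists e => // y; have [|i iC] := eP (\row_j val y j).
  rewrite /= (_ : (fun=> _) = val y); first exact: set_mem (valP y).
  by apply: funext => j; rewrite mxE.
by exists i => z yz; apply: iC => j; rewrite mxE; exact: yz.
Unshelve. all: by end_near. Qed.

End Lebesgue.

Section SmallSimplices.
Variables (R : realType) (X : topologicalType).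

Definition inside q (A : set X) (s : singular_simplex R X q) : Prop := forall x, A (s x).

Definition vanishes_on q (A : set X) (u : cochain R X q) : Prop :=
  forall s, inside A s -> u s = 0.

Lemma inside_restr p q (f : 'I_p.+1 -> 'I_q.+1) A s :
  inside A s -> inside A (restr f s).
Proof. by move=> sA x; exact: sA. Qed.

Lemma vanishes_coboundary q A (u : cochain R X q) :
  vanishes_on A u -> vanishes_on A (coboundary u).
Proof.
by move=> uA s sA; rewrite /coboundary big1 // => k _; apply: uA; exact: inside_restr.
Qed.

Lemma vanishes_add q A (u v : cochain R X q) :
  vanishes_on A u -> vanishes_on A v -> vanishes_on A (u + v).
Proof. by move=> uA vA s sA; rewrite cochainDE uA // vA // addr0. Qed.

Local Notation simp s := (s : continuousType (simplex_affine R _) X).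

Lemma vanishes_seq_eval p q A (u : cochain R X q) (s : singular_simplex R X p) :
  vanishes_on A u -> inside A s -> forall l, seq_eval (simp s) u l = 0.
Proof.
move=> uA sA [|x l] //; rewrite /seq_eval; case: eqP => // _.
by apply: uA => y; exact: sA.
Qed.

Lemma vanishes_sd q A (u : cochain R X q) : vanishes_on A u -> vanishes_on A (sd u).
Proof.
move=> uA s sA; rewrite /sd (funext (vanishes_seq_eval uA sA)).
have h n l : cone_sd (@barycenter R q) n (fun=> 0) l = 0; last exact: h.
by elim: n l => //= n IH l; rewrite -[RHS](ldiff0 l); apply: ldiff_ext.
Qed.

Lemma vanishes_iter_sd q A (u : cochain R X q) k :
  vanishes_on A u -> vanishes_on A (iter k (@sd R X q) u).
Proof. by move=> uA; elim: k => //= k; exact: vanishes_sd. Qed.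

Lemma vanishes_sd_htpy q A (u : cochain R X q.+1) :
  vanishes_on A u -> vanishes_on A (sd_htpy u).
Proof.
move=> uA s sA; rewrite /sd_htpy cone_htpy0 //; last exact: vanishes_seq_eval uA sA.
by move=> phi psi l; rewrite cone_sdD addrACA.
Qed.

Lemma seq_eval_iter_sd p q (s : singular_simplex R X p) (u : cochain R X q) k l :
  size l = q.+1 -> seq_eval (simp s) (iter k (@sd R X q) u) l =
  iter k (cone_sd (@barycenter R p) q.+1) (seq_eval (simp s) u) l.
Proof.
by elim: k l => //= k IH l sl; rewrite seq_eval_sd //; exact: cone_sd_ext.
Qed.

Variables (I : Type) (C : I -> set X).
Hypothesis Ccov : forall x : X, exists i, nbhs x (C i).

(** Diameters shrink by the factor [r = q / (q + 1)], so after enough subdivisions each piece of [s]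
    lies in one member of the cover. The number of steps depends on [s] because it comes from the
    Lebesgue number of the cover pulled back along [s]. *)
Lemma iter_sd_eventually0 q (s : singular_simplex R X q) : exists K, forall k,
  (K <= k)%N -> forall u : cochain R X q, (forall i, vanishes_on (C i) u) ->
  iter k (@sd R X q) u s = 0.
Proof.
have [e e0 eC] : exists2 e : R, 0 < e & forall y : Delta R q, exists i,
    forall z : Delta R q, (forall j, `|val y j - val z j| <= e) -> C i (s z).
  apply: (@simplex_lebesgue R q I (fun i => s @^-1` C i)) => x.
  by have [i] := Ccov (s x); exists i; exact: (@cts_fun _ _ s x).
pose r : R := q%:R / q.+1%:R.
have r0 : 0 <= r by rewrite divr_ge0.
have r1 : r < 1 by rewrite ltr_pdivrMr ?ltr0n // mul1r ltr_nat.
have : (fun n => r ^+ n) @ \oo --> 0 by apply: cvg_expr; rewrite ger0_norm.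
move=> /cvgrPdist_le /(_ _ e0)[K _ KP]; exists K => k Kk u uC.
rewrite -seq_eval_vertices seq_eval_iter_sd ?size_vertices //.
apply: (@cone_sd_small R _ 'I_q.+1 (fun j x => val x j) _ _ _ _ _ _ 1) => //.
- by move=> i x l; exact: barycenterE.
- exact: size_vertices.
- move=> x y j _ _.
  have /andP[x0 x1] := simplex_coord01 x j; have /andP[y0 y1] := simplex_coord01 y j.
  by rewrite ler_norml; lra.
case=> // x t [st] dt; rewrite /seq_eval st eqxx.
have [i iC] := eC x; apply: (uC i) => w; apply: iC => j /=.
have [w0 w1] := set_mem (valP w).
rewrite -[val x j]mul1r -{1}w1 mulr_suml -sumrB (le_trans (ler_norm_sum _ _ _)) //.
rewrite -[e]mul1r -w1 mulr_suml ler_sum // => m _.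
rewrite -mulrBr normrM (ger0_norm (w0 m)); apply: ler_wpM2l; first exact: w0.
apply: le_trans (_ : r ^+ k <= e); last first.
  by have /KP := Kk; rewrite /= sub0r normrN (ger0_norm (exprn_ge0 k r0)).
rewrite -[r ^+ k]mul1r; apply: dt; first by left.
have : (m < size (x :: t))%N by rewrite /= st.
elim: (x :: t) (m : nat) => //= y l IH [|n] nl; first by left.
by right; exact: IH.
Qed.

(* [S] is [sd], [T] is [sd_htpy].  For [k] large enough, depending on [s], the
   value at [s] of [\sum_(i < k) S^i T c] no longer depends on [k]; since [c]
   is killed by [S^k] for [k] large, these values form a primitive of [c]. *)
Lemma small_acyclic q (c : cochain R X q.+1) : coboundary c = 0 ->
  (forall i, vanishes_on (C i) c) ->
  exists2 w : cochain R X q, coboundary w = c & forall i, vanishes_on (C i) w.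
Proof.
move=> dc cC; pose K p (s : singular_simplex R X p) := projT1 (cid (iter_sd_eventually0 s)).
have KP p (s : singular_simplex R X p) := projT2 (cid (iter_sd_eventually0 s)).
have TC i : vanishes_on (C i) (sd_htpy c) by exact: vanishes_sd_htpy.
pose W n : cochain R X q := fun s => \sum_(i < n) iter i (@sd R X q) (sd_htpy c) s.
have WE n s : (K q s <= n)%N -> W n s = W (K q s) s.
  move=> /subnKC <-; elim: (n - _)%N => [|m IH]; first by rewrite addn0.
  rewrite addnS /W big_ord_recr /= -/(W _ s) IH KP ?addr0 ?leq_addr //.
exists (fun s => W (K q s) s); last first.
  by move=> i s si; rewrite /W big1 // => k _; exact: (vanishes_iter_sd _ (TC i)).
apply: funext => s.
pose n := maxn (K q.+1 s) (\max_(k < q.+2) K q (restr (lift k) s)).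
have -> : coboundary (fun s => W (K q s) s) s = coboundary (W n) s.
  apply: eq_bigr => k _; rewrite WE // /n (leq_trans _ (leq_maxr _ _)) //.
  exact: (leq_bigmax_cond (F := fun k : 'I_q.+2 => K q (restr (lift k) s)) k).
(* The sum telescopes: the coboundary of S^i T c is S^i c + S^(i+1) c. *)
have dW m : coboundary (W m) = c + iter m (@sd R X q.+1) c.
  elim: m => [|m IH] /=.
    rewrite cochain_addxx -[RHS](@coboundary0 R X q); congr coboundary.
    by apply: funext => s'; rewrite /W big_ord0.
  have -> : W m.+1 = W m + iter m (@sd R X q) (sd_htpy c).
    by apply: funext => s'; rewrite /W big_ord_recr.
  rewrite coboundaryD IH.
  have -> : coboundary (iter m (@sd R X q) (sd_htpy c)) =
      iter m (@sd R X q.+1) (coboundary (sd_htpy c)).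
    by elim: m {IH} => //= m IH; rewrite coboundary_sd IH.
  have -> : coboundary (sd_htpy c) = c + sd c.
    rewrite -sd_htpyP dc; suff -> : sd_htpy (0 : cochain R X q.+2) = 0 by rewrite addr0.
    by apply: funext => s'; apply: (@vanishes_sd_htpy _ setT).
  have sdD p (u v : cochain R X p) : sd (u + v) = sd u + sd v.
    apply: funext => s'; rewrite /sd cochainDE -cone_sdD.
    by congr cone_sd; apply: funext => l; rewrite seq_evalD.
  have -> : iter m (@sd R X q.+1) (c + sd c) =
      iter m (@sd R X q.+1) c + iter m.+1 (@sd R X q.+1) c.
    elim: m {IH} => //= m ->; exact: sdD.
  by rewrite addrA -[c + _ + _]addrA cochain_addxx addr0.
by rewrite dW cochainDE KP ?addr0 // leq_maxl.
Qed.

End SmallSimplices.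

(** * Pullback along partially continuous maps *)

Section Pullback.
Variables (R : realType) (X Y : topologicalType).

(** Tested on maps into [A] instead of through a subspace topology: this is directly what
    composition with singular simplices inside [A] requires. *)
Definition continuous_on (A : set X) (f : X -> Y) : Prop :=
  forall (B : topologicalType) (g : B -> X),
    continuous g -> (forall b, A (g b)) -> continuous (f \o g).

(* Total: a junk simplex unless [f \o s] is continuous. *)
Definition post (f : X -> Y) q (s : singular_simplex R X q) : singular_simplex R Y q :=
  if pselect (continuous (f \o s)) is left fs then mkcts fs
  else cst (f (s (centroid R q))).

Definition pull (f : X -> Y) q (u : cochain R Y q) : cochain R X q :=
  fun s => u (post f s).

Lemma postE f q (s : singular_simplex R X q) : continuous (f \o s) -> post f s =1 f \o s.
Proof. by rewrite /post => fs x; case: pselect => // -[]. Qed.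

Lemma post_restr f p q (g : 'I_p.+1 -> 'I_q.+1) (s : singular_simplex R X q) :
  continuous (f \o s) -> post f (restr g s) = restr g (post f s).
Proof.
move=> fs; have fgs : continuous (f \o restr g s).
  exact: (continuous_compT (@simplex_map_continuous R p q g) fs).
by apply/continuousEP => x; rewrite postE //= postE.
Qed.

Lemma coboundary_pull f q (u : cochain R Y q) (s : singular_simplex R X q.+1) :
  continuous (f \o s) -> coboundary (pull f u) s = coboundary u (post f s).
Proof. by move=> fs; apply: eq_bigr => k _; rewrite /pull post_restr. Qed.

Lemma overlap_pull f p q N m (u : cochain R Y p) (v : cochain R Y q)
    (s : singular_simplex R X N) : continuous (f \o s) ->
  overlap m (pull f u) (pull f v) s = overlap m u v (post f s).
Proof.
move=> fs; apply: eq_bigr => J _.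
by rewrite /face_eval /pull !post_restr.
Qed.

Lemma inside_post (A : set X) (B : set Y) f q (s : singular_simplex R X q) :
  continuous_on A f -> (forall x, A x -> B (f x)) -> inside A s -> inside B (post f s).
Proof.
move=> fc AB sA x; rewrite postE; first exact: AB.
by apply: fc => //; exact: cts_fun.
Qed.

End Pullback.

Lemma coboundary_eq_on (R : realType) (X : topologicalType) q (u v : cochain R X q) s :
  (forall g : 'I_q.+1 -> 'I_q.+2, u (restr g s) = v (restr g s)) ->
  coboundary u s = coboundary v s.
Proof. by move=> e; apply: eq_bigr => k _. Qed.

Lemma overlap_eq_on (R : realType) (X : topologicalType) p q N m
    (u u' : cochain R X p) (v v' : cochain R X q) (s : singular_simplex R X N) :
  (forall g : 'I_p.+1 -> 'I_N.+1, u (restr g s) = u' (restr g s)) ->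
  (forall g : 'I_q.+1 -> 'I_N.+1, v (restr g s) = v' (restr g s)) ->
  overlap m u v s = overlap m u' v' s.
Proof. by move=> eu ev; apply: eq_bigr => J _; rewrite /face_eval eu ev. Qed.

(** * Prisms and the acyclicity of contractible subsets *)

Section Prism.
Variables (R : realType) (X : topologicalType).

Definition prism_comb p q (f : 'I_q.+1 -> Delta R p * Delta R 1) (x : Delta R q) :
  (Delta R p * Delta R 1)%type := (simplex_comb (fst \o f) x, simplex_comb (snd \o f) x).

Lemma prism_comb_continuous p q (f : 'I_q.+1 -> Delta R p * Delta R 1) :
  continuous (prism_comb f).
Proof. by apply: continuous_pairT; exact: simplex_comb_continuous. Qed.

Lemma prism_comb_push r p q (f : 'I_q.+1 -> Delta R r * Delta R 1)
    (g : 'I_p.+1 -> 'I_q.+1) x :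
  prism_comb f (simplex_map g x) = prism_comb (f \o g) x.
Proof. by rewrite /prism_comb !simplex_comb_push. Qed.

Definition prism_affine p : affine_space R :=
  AffineSpace (@prism_comb_continuous p) (@prism_comb_push p).

Definition prism_map p (s : singular_simplex R X p) (y : prism_affine p) :
  (X * R)%type := (s y.1, val y.2 ord_max).

Lemma prism_map_continuous p (s : singular_simplex R X p) : continuous (prism_map s).
Proof.
apply: continuous_pairT.
  by apply: (@continuous_compT _ _ _ fst s); [move=> y; exact: cvg_fst|exact: cts_fun].
by apply: continuous_simplex_coord => y; exact: cvg_snd.
Qed.

Definition prism_simplex p (s : singular_simplex R X p) :
  continuousType (prism_affine p) (X * R)%type := mkcts (@prism_map_continuous p s).

Lemma slice_continuous q (s : singular_simplex R X q) (t : R) :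
  continuous (fun x => (s x, t)).
Proof.
by apply: continuous_pairT; [exact: cts_fun|exact: continuous_cst].
Qed.

Definition slice_simplex q (s : singular_simplex R X q) (t : R) :
  singular_simplex R (X * R)%type q := mkcts (@slice_continuous q s t).

Let end_ p (i : 'I_2) (x : Delta R p) : prism_affine p := (x, vertex R i).

Let apex p (l : seq (Delta R p)) : prism_affine p := (barycenter l, vertex R ord0).

Let ends p (phi : seq (prism_affine p) -> 'F_2) l :=
  phi (map (end_ ord0) l) + phi (map (end_ ord_max) l).

(** The prism is triangulated by coning its two ends and, recursively, its sides from the barycenter
    of the bottom. The cone on the bottom is flat, which is harmless for singular simplices. The
    interval is [Delta R 1], its coordinate at [ord_max] being the time. *)
Definition prism q (u : cochain R (X * R)%type q.+1) : cochain R X q := fun s =>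
  cone_htpy (@apex q) (@ends q) q.+1 (seq_eval (prism_simplex s) u) (vertices R q).

Let prism_face p q (f : 'I_q.+1 -> Delta R p) (y : prism_affine q) : prism_affine p :=
  (simplex_comb f y.1, y.2).

Lemma seq_eval_prism_comp p q r (s : singular_simplex R X p) (x : Delta R p) l
    (u : cochain R (X * R)%type r) t :
  seq_eval (prism_simplex
    (seq_simplex (s : continuousType (simplex_affine R p) X) x l q)) u t =
  seq_eval (prism_simplex s) u
    (map (prism_face (fun i : 'I_q.+1 => nth x l i)) t).
Proof.
case: t => // y t; rewrite /seq_eval /= size_map; case: eqP => // st.
have e i : (i < r.+1)%N -> nth (prism_face (fun i : 'I_q.+1 => nth x l i) y)
    (map (prism_face (fun i : 'I_q.+1 => nth x l i)) (y :: t)) i =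
    prism_face (fun i : 'I_q.+1 => nth x l i) (nth y (y :: t) i).
  by move=> ir; apply: nth_map; rewrite /= st.
congr u; apply/continuousEP => z /=; rewrite /mkcts /= /prism_map /prism_comb /=.
congr pair.
  congr (s _); rewrite /mkcts simplex_comb_comp; congr simplex_comb; apply: funext => i /=.
  by have /= -> := e i (ltn_ord i).
by apply: eq_bigr => i _; have /= -> := e i (ltn_ord i).
Qed.

Lemma seq_eval_prism p q (s : singular_simplex R X p) (u : cochain R (X * R)%type q.+1) l :
  size l = q.+1 ->
  seq_eval (s : continuousType (simplex_affine R p) X) (prism u) l =
  cone_htpy (@apex p) (@ends p) q.+1 (seq_eval (prism_simplex s) u) l.
Proof.
case: l => // x l sl; rewrite /seq_eval -/(seq_eval _ _); have [->] := sl; rewrite eqxx /prism.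
rewrite (funext (@seq_eval_prism_comp _ _ _ s x (x :: l) u)).
rewrite -[in RHS](map_vertices x sl); symmetry; apply: cone_htpy_map.
- by move=> y t; rewrite /apex barycenter_comb.
- by move=> phi t; rewrite /ends /= -!map_comp.
exact: size_vertices.
Qed.

Lemma seq_eval_end q (u : cochain R (X * R)%type q) (s : singular_simplex R X q) i :
  seq_eval (prism_simplex s) u (map (end_ i) (vertices R q)) =
  u (slice_simplex s (val (vertex R i) (ord_max : 'I_2))).
Proof.
rewrite vertices_cons /= size_map size_behead size_vertices eqxx.
congr u; apply/continuousEP => y; rewrite /= /mkcts /=.
have e : (fun j : 'I_q.+1 => nth (end_ i (vertex R ord0)) (end_ i (vertex R ord0) ::
    map (end_ i) (behead (vertices R q))) j) = end_ i \o @vertex R q.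
  apply: funext => j; rewrite -[_ :: map _ _]/(map _ (_ :: _)) -vertices_cons.
  rewrite (nth_map (vertex R ord0)) ?size_vertices // (nth_map ord0) ?size_enum_ord //.
  by rewrite /=; congr (end_ _ (vertex _ _)); apply: val_inj; rewrite /= nth_enum_ord.
rewrite e /prism_map /prism_comb /=; congr pair; first by congr (s _); exact: simplex_comb_id.
by rewrite -mulr_suml; have [_ ->] := set_mem (valP y); rewrite mul1r.
Qed.

Lemma prismP q (u : cochain R (X * R)%type q.+1) s :
  coboundary (prism u) s + prism (coboundary u) s =
  u (slice_simplex s 0) + u (slice_simplex s 1).
Proof.
rewrite coboundary_vertices [X in _ + X]/prism -(ldiff_seq_eval (prism_simplex s) u).
have -> : u (slice_simplex s 0) + u (slice_simplex s 1) =
    ends (seq_eval (prism_simplex s) u) (vertices R q.+1).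
  by rewrite /ends !seq_eval_end.
rewrite -(@cone_htpyP _ _ (@apex q.+1) (@ends q.+1)).
- rewrite size_vertices; congr (_ + _); apply: ldiff_ext => t.
  by rewrite size_vertices => -[st] _; exact: seq_eval_prism.
- by move=> phi psi l; rewrite /ends addrACA.
- by move=> phi; rewrite /ends /= F2_addxx.
by move=> phi x l; rewrite /ends !ldiff_map -ldiffD.
Qed.

Definition cylinder (A : set X) : set ((X * R)%type : topologicalType) :=
  fun y => A y.1 /\ 0 <= y.2 <= 1.

Lemma vanishes_prism q (A : set X) (u : cochain R (X * R)%type q.+1) :
  vanishes_on (cylinder A) u -> vanishes_on A (prism u).
Proof.
move=> uA s sA; rewrite /prism cone_htpy0 //.
  by move=> phi psi l; rewrite /ends addrACA.
case=> // y l; rewrite /seq_eval; case: eqP => // _; apply: uA => z /=.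
rewrite /mkcts /= /prism_map /=; split; first exact: sA.
exact: (simplex_coord01 (prism_comb (fun i : 'I_q.+2 => nth y (y :: l) i) z).2).
Qed.

(** Cohomology of [A] vanishes in positive degrees, with primitives taken among cochains of the
    whole space. Since degree 0 is left out, the empty set qualifies. *)
Definition acyclic_on (A : set X) : Prop := forall q (c : cochain R X q.+1),
  vanishes_on A (coboundary c) -> exists g, vanishes_on A (c + coboundary g).

Lemma F2_mulrn_odd (a : 'F_2) n : a *+ n = if odd n then a else 0.
Proof.
elim: n => // n IH; rewrite mulrS IH /=; case: odd => /=; first exact: F2_addxx.
by rewrite addr0.
Qed.

(** The prism deforms [c] to its value [a] on a constant simplex, which need not be 0. For odd [q]
    the constant cochain [a] is itself a coboundary; for even [q] the cocycle condition on a
    constant simplex forces [a = 0]. *)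
Lemma contractible_acyclic (A : set X) (h : X * R -> X) (x0 : X) :
  continuous_on (cylinder A) h ->
  (forall y, cylinder A y -> A (h y)) ->
  (forall x, A x -> h (x, 0) = x) -> (forall x, A x -> h (x, 1) = x0) ->
  acyclic_on A.
Proof.
move=> hc hA h0 h1 q c dc; pose a := c (cst x0).
pose k : cochain R X q := fun=> a.
exists (prism (pull h c) + (if odd q then k else 0) : cochain R X q) => s sA.
have slice_in (t : R) : 0 <= t <= 1 ->
    inside (cylinder A) (slice_simplex s t).
  by move=> t01 x; split=> //; exact: sA.
have hs t : 0 <= t <= 1 -> post h (slice_simplex s t) =1 h \o slice_simplex s t.
  by move=> t01; apply: postE; apply: hc; [exact: cts_fun|exact: slice_in].
have dp : coboundary (prism (pull h c)) s = c s + a.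
  have := prismP (pull h c) s.
  rewrite (_ : prism _ s = 0) ?addr0; last first.
    apply: vanishes_prism sA => s' s'A; rewrite coboundary_pull; last first.
      by apply: hc => //; exact: cts_fun.
    by apply: dc; exact: inside_post hc hA s'A.
  rewrite {2 3}/pull => ->; congr (c _ + c _).
    apply/continuousEP => x; rewrite hs ?lexx ?ler01 //=.
    by rewrite /mkcts h0 //; exact: sA.
  apply/continuousEP => x; rewrite hs ?lexx ?ler01 //=.
  by rewrite /mkcts h1 //; exact: sA.
rewrite cochainDE coboundaryD cochainDE dp addrA addrA F2_addxx add0r.
have kE : coboundary k s = a *+ q.+2 by rewrite /coboundary sumr_const card_ord.
case: ifPn => qo; first by rewrite kE F2_mulrn_odd /= negbK qo F2_addxx.
rewrite coboundary0 addr0.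
have /dc : inside A (cst x0 : singular_simplex R X q.+2).
  move=> x; rewrite /= (_ : x0 = h (s (centroid R q.+1), 1)); last first.
    by rewrite h1 //; exact: sA.
  by apply: hA; split; [exact: sA|rewrite /= ler01 lexx].
have -> : coboundary c (cst x0 : singular_simplex R X q.+2) = a *+ q.+3.
  rewrite /coboundary (eq_bigr (fun=> a)) ?sumr_const ?card_ord // => i _.
  by congr c; exact/continuousEP.
by rewrite F2_mulrn_odd /= negbK qo.
Qed.

End Prism.

(** * Steenrod squares, retracts and connecting maps *)

Section SteenrodSquares.
Variables (R : realType) (X : topologicalType).

Lemma cohomology_pi_eq0 p (z : cocycle R X p) :
  (\pi_(cohomology R X p) z = 0)%qT <-> is_coboundary (cocycle_val z).
Proof.
have e : (\pi_(cohomology R X p) 0 = 0)%qT by rewrite piE.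
have := Quotient.idealrBE (@coboundary_pred R X p) z 0.
rewrite subr0 unfold_in e => h; split=> [z0|zc].
  by apply/asboolP; rewrite [asbool _]h z0.
by apply/eqP; rewrite -h; exact/asboolP.
Qed.

(* The degree of the square is [N.+1], which is [p + n] up to conversion only
   when [p] is a successor. *)
Lemma Sq_nonzeroP n : (0 < n)%N -> Sq_nonzero R X n <->
  exists p N (z : cochain R X p), [/\ (n <= p)%N, (p + n = N.+1)%N, coboundary z = 0 &
    forall w : cochain R X N, overlap (p - n).+1 z z <> coboundary w].
Proof.
move=> n0; split=> [[p [x Sx]]|[p [N [z [np pN z0 zw]]]]].
  have np : (n <= p)%N.
    rewrite leqNgt; apply/negP => pn; apply: Sx; apply/cohomology_pi_eq0.
    rewrite /= /steenrod_cochain leqNgt pn /=.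
    by case: (p + n)%N => //= N; exists 0; rewrite coboundary0.
  case: p x Sx np => [|p] x Sx np; first by rewrite leqNgt n0 in np.
  exists p.+1, (p + n)%N, (cocycle_val (repr x)); split=> //.
    by have /asboolP := cocycleP (repr x).
  move=> w zw; apply: Sx; apply/cohomology_pi_eq0; exists w.
  by rewrite /= /steenrod_cochain np.
case: p pN z np z0 zw => [|p] pN z np z0 zw; first by rewrite leqNgt n0 in np.
case: pN zw => <- {N} zw.
have zP : z \in @cocycle_pred R X p.+1 by exact/asboolP.
exists p.+1, (\pi_(cohomology R X p.+1) (Cocycle zP))%qT; rewrite Sq_pi.
by move=> /cohomology_pi_eq0 [w]; rewrite /= /steenrod_cochain np; exact: zw.
Qed.

Lemma overlap_coboundary p N m (u : cochain R X p) :
  overlap m.+2 (coboundary u) (coboundary u) =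
  coboundary (overlap m.+2 u (coboundary u) + overlap m.+1 u u : cochain R X N).
Proof.
rewrite coboundaryD !coboundary_overlapE coboundaryK overlap0r addr0.
rewrite -[X in _ = _ + X]addrA cochain_addxx addr0 -addrA.
by rewrite [X in _ = _ + X]addrA cochain_addxx add0r -addrA cochain_addxx addr0.
Qed.

Lemma coboundary_square p N m (u : cochain R X p) : coboundary u = 0 ->
  coboundary (overlap m.+1 u u : cochain R X N) = 0.
Proof.
by move=> u0; rewrite coboundary_overlapE u0 overlap0l overlap0r !add0r cochain_addxx.
Qed.

Lemma vanishes_overlapr p q N m A (u : cochain R X p) (v : cochain R X q) :
  vanishes_on A v -> vanishes_on A (overlap m u v : cochain R X N).
Proof.
move=> vA s sA; rewrite /overlap big1 // => J _.
rewrite [X in _ * X]/face_eval; case: ifP; rewrite ?mulr0 // => _.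
by rewrite vA ?mulr0 //; exact: inside_restr.
Qed.

End SteenrodSquares.

Lemma Sq_nonzero_retract (R : realType) (X Y : topologicalType) (s : X -> Y) (r : Y -> X) n :
  (0 < n)%N -> continuous s -> continuous r -> cancel s r ->
  Sq_nonzero R X n -> Sq_nonzero R Y n.
Proof.
move=> n0 sc rc sr /Sq_nonzeroP -/(_ n0)[p [N [z [np pN z0 zw]]]].
have rcs q (t : singular_simplex R Y q) : continuous (r \o t).
  by apply: continuous_compT rc; exact: cts_fun.
have scs q (t : singular_simplex R X q) : continuous (s \o t).
  by apply: continuous_compT sc; exact: cts_fun.
have post_sr q (t : singular_simplex R X q) : post r (post s t) = t.
  by apply/continuousEP => x; rewrite postE //= postE //= sr.
apply/Sq_nonzeroP => //; exists p, N, (pull r z); split=> //.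
  by apply: funext => t; rewrite coboundary_pull // z0.
move=> w e; apply: (zw (pull s w)); apply: funext => t.
by rewrite coboundary_pull // -e overlap_pull // post_sr.
Qed.

(* Mayer-Vietoris for [U] and the union of the [V i]: if [u] extends the pullback
   of a cocycle [x] by zero, then [coboundary u] on [U] and [0] on the [V i] glue
   to a cocycle [y] representing the connecting map at [x], and its square is the
   connecting map at the square of [x] by [overlap_coboundary].  The hypothesis on
   extensions says that cohomology classes of the union of the [V i] extend to
   [Q], so that together with the acyclicity of [U] the connecting map is
   injective. *)
Lemma Sq_nonzero_connecting (R : realType) (Q X : topologicalType) (U : set Q) (I : Type)
    (V : I -> set Q) (r : Q -> X) (s : X -> Q) n :
  (0 < n)%N ->
  (forall x : Q, nbhs x U \/ exists i, nbhs x (V i)) ->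
  (forall q (c : cochain R Q q.+1), (forall i, vanishes_on (V i) (coboundary c)) ->
     exists2 c', coboundary c' = coboundary c & forall i, vanishes_on (V i) c') ->
  acyclic_on R U ->
  continuous_on [set x | U x /\ exists i, V i x] r ->
  continuous s -> cancel s r -> (forall x, U (s x)) ->
  (forall x : X, exists i, nbhs x (s @^-1` V i)) ->
  Sq_nonzero R X n -> Sq_nonzero R Q n.
Proof.
move=> n0 cov ext acU rc sc sr sU scov /Sq_nonzeroP -/(_ n0)[p [N [x [np pN x0 xw]]]].
pose UV i : set Q := U `&` V i.
have rUV q i (t : singular_simplex R Q q) : inside (UV i) t -> continuous (r \o t).
  by move=> tUV; apply: rc => [|y]; [exact: cts_fun|have [] := tUV y; split; last exists i].
pose u : cochain R Q p := fun t =>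
  if pselect (exists i, inside (UV i) t) then pull r x t else 0.
have uE i t : inside (UV i) t -> u t = pull r x t.
  by move=> tUV; rewrite /u; case: pselect => // -[]; exists i.
have duV i : vanishes_on (UV i) (coboundary u).
  move=> t tUV; rewrite (@coboundary_eq_on _ _ _ _ (pull r x)); last first.
    by move=> g; apply: (uE i); exact: inside_restr.
  by rewrite coboundary_pull ?x0 //; exact: rUV tUV.
pose z : cochain R Q p.+1 := fun t => if pselect (inside U t) then coboundary u t else 0.
have zU t : inside U t -> z t = coboundary u t by rewrite /z; case: pselect.
have zV i : vanishes_on (V i) z.
  by move=> t tV; rewrite /z; case: pselect => // tU; apply: (duV i) => y; split.
pose C (o : option I) : set Q := if o is Some i then V i else U.
(* [z] is known to be closed only on simplices inside one set of the cover; [w] repairs this without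
   changing [z] on them. *)
have [w dw wC] : exists2 w, coboundary w = coboundary z & forall o, vanishes_on (C o) w.
  apply: small_acyclic.
  - by move=> y; have [yU|[i yi]] := cov y; [exists None|exists (Some i)].
  - exact: coboundaryK.
  move=> [i|] /=; first by apply: vanishes_coboundary; exact: zV.
  move=> t tU; rewrite (@coboundary_eq_on _ _ _ _ (coboundary u)) ?coboundaryK //.
  by move=> g; apply: zU; exact: inside_restr.
pose y := z + w.
have yV i : vanishes_on (V i) y by apply: vanishes_add; [exact: zV|exact: (wC (Some i))].
have yU t : inside U t -> y t = coboundary u t.
  by move=> tU; rewrite /y cochainDE (wC None) // addr0 zU.
apply/Sq_nonzeroP => //; exists p.+1, N.+1, y; split; first exact: leqW.
- by rewrite addSn pN.
- by rewrite /y coboundaryD dw cochain_addxx.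
(* The degree has grown by one while [n] is fixed, so the cup-i index grows by one as well. *)
rewrite subSn // => c yc.
have [|c' dc' c'V] := ext _ c.
  by move=> i; rewrite -yc; apply: vanishes_overlapr; exact: yV.
set m := (p - n)%N in xw yc.
pose e : cochain R Q N.+1 := c' + (overlap m.+2 u (coboundary u) + overlap m.+1 u u).
have [|g eg] := acU _ e.
  move=> t tU; rewrite coboundaryD -overlap_coboundary dc' -yc cochainDE.
  by rewrite (@overlap_eq_on _ _ _ _ _ _ y (coboundary u) y (coboundary u)) ?F2_addxx // => f;
    apply: yU; exact: inside_restr.
pose f : cochain R X N.+1 := overlap m.+1 x x + coboundary (pull s g).
have scs q (t : singular_simplex R X q) : continuous (s \o t).
  by apply: continuous_compT sc; exact: cts_fun.
have [||w' dw' _] := @small_acyclic _ _ _ (fun i => s @^-1` V i) scov _ f.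
- by rewrite coboundaryD coboundaryK coboundary_square // addr0.
- move=> i t tV; have stUV : inside (UV i) (post s t).
    by move=> a; rewrite postE //; split; [exact: sU|exact: tV].
  have := eg (post s t); rewrite /e !cochainDE (c'V i); last by move=> a; have [] := stUV a.
  rewrite add0r (vanishes_overlapr _ _ (duV i)) // add0r -coboundary_pull //.
  rewrite (@overlap_eq_on _ _ _ _ _ _ u (pull r x) u (pull r x)); last 2 first.
  + by move=> h; apply: (uE i); exact: inside_restr.
  + by move=> h; apply: (uE i); exact: inside_restr.
  rewrite overlap_pull; last exact: rUV stUV.
  have -> : post r (post s t) = t.
    apply/continuousEP => a; rewrite postE; last exact: rUV stUV.
    by rewrite /= postE //= sr.
  by apply => a; have [] := stUV a.
apply: (xw (w' + pull s g)).
by rewrite coboundaryD dw' /f -addrA cochain_addxx addr0.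
Qed.

(** * Points of a realization given by unnormalized weights *)

Section Realization.
Variable R : realType.

(* Points of a subspace given by formulas that are only meaningful on part of
   the domain; the default [d] is returned elsewhere. *)
Definition sub_pt (T : topologicalType) (A : set T) (d : A) (x : T) : A :=
  if pselect (A x) is left Ax then SigSub (mem_set Ax) else d.

Lemma sub_ptE (T : topologicalType) (A : set T) (d : A) x : A x -> val (sub_pt d x) = x.
Proof. by rewrite /sub_pt; case: pselect. Qed.

Lemma continuous_on_sub_pt (X T : topologicalType) (A : set T) (d : A) (C : set X)
    (F : X -> T) : continuous_on C F -> (forall x, C x -> A (F x)) ->
  continuous_on C (sub_pt d \o F).
Proof.
move=> Fc CA B g gc gC; apply/continuous_comp_initial.
rewrite (_ : _ \o _ = F \o g); first exact: Fc.
by apply: funext => b /=; rewrite -[RHS](sub_ptE d (CA _ (gC b))).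
Qed.

Lemma continuous_onT (X Y : topologicalType) (A : set X) (f : X -> Y) :
  continuous f -> continuous_on A f.
Proof. by move=> fc B g gc _; exact: continuous_compT. Qed.

Lemma continuous_on_setT (X Y : topologicalType) (f : X -> Y) :
  continuous_on setT f -> continuous f.
Proof. by move=> fc; apply: (fc X id) => // x; exact: cvg_id. Qed.

Lemma continuous_on_ptws (X : topologicalType) (V : Type) (T : topologicalType)
    (A : set X) (F : X -> {ptws V -> T}) :
  (forall v, continuous_on A (fun x => F x v)) -> continuous_on A F.
Proof. by move=> Fc B g gc gA; apply: continuous_ptws => v; exact: Fc. Qed.

Section Coordinates.
Variables (V : finType) (K : {set {set V}}).
Local Notation X := (realization R K).
Implicit Types (x d : X) (f : V -> R).

Definition weight x v : R := val x v.

Lemma weight_ge0 x v : 0 <= weight x v.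
Proof. by have [[x0 _] _] := set_mem (valP x). Qed.

Lemma sum_weight x : \sum_v weight x v = 1.
Proof. by have [[_ x1] _] := set_mem (valP x). Qed.

Lemma support_weight x : [set v | weight x v != 0]%SET \in K.
Proof. by have [_ xK] := set_mem (valP x). Qed.

Lemma continuous_weight v : continuous (weight^~ v).
Proof.
have vc : continuous (val : X -> {ptws V -> R}) by exact: continuous_val.
exact: (continuous_compT vc (@continuous_eval V R v)).
Qed.

Lemma realization_ext x y : weight x =1 weight y -> x = y.
Proof. by move=> e; apply/val_inj/funext. Qed.

Lemma weight_neq0 x : exists v, weight x v != 0.
Proof.
apply/existsP; apply: contraT; rewrite negb_exists => /forallP x0.
have := sum_weight x; rewrite big1 => [/eqP|v _]; first by rewrite eq_sym oner_eq0.
by have := x0 v; rewrite negbK => /eqP.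
Qed.

Definition normalizable f : Prop :=
  [/\ forall v, 0 <= f v, exists v, f v != 0 & [set v | f v != 0]%SET \in K].

Definition normalize d f : X := sub_pt d (fun v => f v / \sum_w f w).

Lemma normalizable_sum_gt0 f : normalizable f -> 0 < \sum_w f w.
Proof.
case=> f0 [v fv] _; rewrite lt_neqAle eq_sym sumr_ge0 // andbT psumr_neq0 //.
by apply/hasP; exists v; rewrite ?mem_index_enum //= lt_neqAle eq_sym fv f0.
Qed.

Lemma normalizable_realization f : normalizable f ->
  barycentric (fun v => f v / \sum_w f w) /\
  [set v | f v / \sum_w f w != 0]%SET \in K.
Proof.
move=> nf; have s0 := normalizable_sum_gt0 nf; case: nf => f0 _ fK.
split; first split.
- by move=> w; rewrite divr_ge0 // ltW.
- by rewrite -mulr_suml mulfV // gt_eqF.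
rewrite (_ : [set v | _]%SET = [set v | f v != 0]%SET) //.
by apply/setP => w; rewrite !inE mulf_eq0 invr_eq0 [X in _ || X]gt_eqF // orbF.
Qed.

Lemma normalizable_point f : normalizable f -> exists x : X, True.
Proof.
move=> /normalizable_realization fP.
by pose x : X := SigSub (mem_set fP); exists x.
Qed.

Lemma weight_normalize d f v : normalizable f ->
  weight (normalize d f) v = f v / \sum_w f w.
Proof.
move=> nf; rewrite /weight /normalize sub_ptE //.
exact: normalizable_realization.
Qed.

Lemma weight_normalize_eq0 d f v : normalizable f ->
  (weight (normalize d f) v == 0) = (f v == 0).
Proof.
move=> nf; rewrite weight_normalize // mulf_eq0 invr_eq0.
by rewrite [X in _ || X]gt_eqF ?orbF // normalizable_sum_gt0.
Qed.

Lemma normalizeK d f c x : 0 < c -> (forall v, f v = c * weight x v) -> normalize d f = x.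
Proof.
move=> c0 fE; have nf : normalizable f.
  split.
  - by move=> v; rewrite fE mulr_ge0 ?weight_ge0 // ltW.
  - by have [v xv] := weight_neq0 x; exists v; rewrite fE mulf_neq0 // gt_eqF.
  rewrite (_ : [set v | _]%SET = [set v | weight x v != 0]%SET) ?support_weight //.
  by apply/setP => v; rewrite !inE fE mulf_eq0 gt_eqF.
apply: realization_ext => v; rewrite weight_normalize // (eq_bigr _ (fun v _ => fE v)).
by rewrite -mulr_sumr sum_weight mulr1 fE mulrC mulKf // gt_eqF.
Qed.

Lemma continuous_on_normalize d (B : topologicalType) (A : set B) (F : B -> V -> R) :
  (forall v, continuous (F^~ v)) -> (forall b, A b -> normalizable (F b)) ->
  continuous_on A (fun b => normalize d (F b)).
Proof.
move=> Fc nF; rewrite -/(sub_pt d \o (fun b v => F b v / \sum_w F b w)).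
apply: continuous_on_sub_pt; last by move=> b /nF; exact: normalizable_realization.
apply: continuous_on_ptws => v C g gc gA.
apply: (@continuous_divr R C (fun c => F (g c) v) (fun c => \sum_w F (g c) w)).
- exact: continuous_compT gc (Fc v).
- by apply: continuous_sumr => w; exact: continuous_compT gc (Fc w).
by move=> c; rewrite gt_eqF // normalizable_sum_gt0 //; exact: nF.
Qed.

Lemma nbhs_weight_neq0 x v : weight x v != 0 -> nbhs x [set y | weight y v != 0].
Proof.
move=> xv; have : nbhs (weight x v) [set t : R | t != 0].
  by apply: open_nbhs_nbhs; split=> //; exact: open_neq.
exact: (@continuous_weight v x).
Qed.

End Coordinates.
End Realization.

(* Dispatching on the head symbol avoids failed unifications, which are very
   slow here. *)
Ltac continuity := repeat lazymatch goal with
  | |- forall x, @continuous_at _ _ x (fun y => Algebra.add _ _) => apply: continuous_addr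
  | |- forall x, @continuous_at _ _ x (fun y => GRing.mul _ _) => apply: continuous_mulr
  | |- forall x, @continuous_at _ _ x (fun y => Algebra.opp _) => apply: continuous_oppr
  | |- forall x, @continuous_at _ _ x (fun y => GRing.exp _ _) => apply: continuous_exprn
  | |- forall x, @continuous_at _ _ x (fun y => Order.max _ _) => apply: continuous_maxr
  | |- forall x, @continuous_at _ _ x (fun y => Order.min _ _) => apply: continuous_minr
  | |- forall x, @continuous_at _ _ x (fun y => Num.norm _) => apply: continuous_normr
  | |- forall x, @continuous_at _ _ x (fun y => Num.sqrt _) => apply: continuous_sqrtr
  | |- _ => first [assumption | exact: continuous_cst]
  end.

(** * Contractible subsets of a realization *)

Section Contractions.
Variables (R : realType) (V : finType) (K : {set {set V}}).
Local Notation X := (realization R K).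

Lemma continuous_weight_fst v : continuous (fun y : X * R => weight y.1 v).
Proof.
apply: (@continuous_compT (X * R)%type X R fst (fun x => weight x v)).
  by move=> y; exact: cvg_fst.
exact: continuous_weight.
Qed.

Lemma continuous_snd_real : continuous (fun y : X * R => y.2).
Proof. by move=> y; exact: cvg_snd. Qed.

Lemma acyclic_on_set0 (Y : topologicalType) : acyclic_on R (set0 : set Y).
Proof. by move=> q c _; exists 0 => s /(_ (centroid R q.+1)). Qed.

Definition toward (a : V) (x : X) (t : R) v : R := (1 - t) * weight x v + t * (v == a)%:R.

Lemma toward_ge0 a x t v : 0 <= t <= 1 -> 0 <= toward a x t v.
Proof.
move=> /andP[t0 t1]; rewrite addr_ge0 ?mulr_ge0 ?ler0n ?weight_ge0 //.
by rewrite subr_ge0.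
Qed.

Lemma toward_eq0 a x t v : v != a -> weight x v = 0 -> toward a x t v = 0.
Proof. by rewrite /toward => /negPf -> ->; rewrite !mulr0 addr0. Qed.

Lemma toward_neq0 a x t : 0 <= t <= 1 -> exists v, toward a x t v != 0.
Proof.
move=> /andP[t0 t1]; have [t1' | t1'] := eqVneq t 1.
  by exists a; rewrite /toward t1' subrr mul0r add0r mul1r eqxx oner_eq0.
have [v xv] := weight_neq0 x; exists v.
rewrite gt_eqF // ltr_pwDl ?mulr_ge0 ?ler0n // mulr_gt0 //.
  by rewrite subr_gt0 lt_neqAle t1' t1.
by rewrite lt_neqAle eq_sym xv weight_ge0.
Qed.

Hypothesis Kc : simplicial_complex K.

Lemma normalizable_toward a x t : 0 <= t <= 1 ->
  (a |: [set v | weight x v != 0])%SET \in K -> normalizable K (toward a x t).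
Proof.
move=> t01 aK; split; [by move=> v; exact: toward_ge0|exact: toward_neq0|].
have [_ Kdown] := Kc; apply: Kdown aK _; apply/fintype.subsetP => v; rewrite !inE.
apply: contraNT; rewrite negb_or => /andP[va]; rewrite negbK => /eqP xv.
by rewrite toward_eq0.
Qed.

Lemma acyclic_star a : acyclic_on R [set x : X | weight x a != 0].
Proof.
have [[d da]|A0] := pselect (exists d : X, weight d a != 0); last first.
  rewrite (_ : [set x | _] = set0); first exact: acyclic_on_set0.
  by apply/seteqP; split=> // x xa; apply: A0; exists x.
have nf (x : X) t : weight x a != 0 -> 0 <= t <= 1 -> normalizable K (toward a x t).
  move=> xa t01; apply: normalizable_toward => //.
  rewrite (_ : (_ |: _)%SET = [set v | weight x v != 0]%SET) ?support_weight //.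
  by apply/finset.setUidPr; rewrite finset.sub1set inE.
apply: (@contractible_acyclic R X _ (fun y => normalize d (toward a y.1 y.2))
  (normalize d (toward a d 1))).
- apply: continuous_on_normalize => [v|y [ya y01]]; last exact: nf.
  have := @continuous_snd_real; have := @continuous_weight_fst v => c1 c2.
  by rewrite /toward; continuity.
- move=> y [ya y01] /=; rewrite weight_normalize_eq0; last exact: nf.
  rewrite gt_eqF // /toward eqxx mulr1; case/andP: y01 => t0 t1.
  have := weight_ge0 y.1 a; rewrite le_eqVlt eq_sym (negPf ya) /= => xa.
  by have [->|t0'] := eqVneq y.2 0; [lra|nra].
- by move=> x xa; apply: (@normalizeK _ _ _ _ _ 1) => // v; rewrite /toward /=; lra.
move=> x xa; congr normalize; apply: funext => v.
by rewrite /toward /= subrr !mul0r.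
Qed.

(* The contraction first moves the weight at [b] to [0], then moves everything
   to [a]; the two stages do not interfere because [a] and [b] need not span an
   edge with the rest of the support. *)
Definition avoid_toward (a b : V) (x : X) (t : R) v : R :=
  if v == b then Num.max 0 (1 - 2 * t) * weight x v
  else Num.min 1 (2 - 2 * t) * weight x v + Num.max 0 (2 * t - 1) * (v == a)%:R.

(** The set is the complement of the vertex [b]; it deforms to the faces without [b], which by
    hypothesis form a cone with apex [a]. *)
Lemma acyclic_push a b : a != b ->
  (forall s, s \in K -> (a |: (s :\ b))%SET \in K) ->
  acyclic_on R [set x : X | exists2 v, v != b & weight x v != 0].
Proof.
move=> ab Kab; set A := [set x | _].
have [[d Ad]|A0] := pselect (exists d, A d); last first.
  rewrite (_ : A = set0); first exact: acyclic_on_set0.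
  by apply/seteqP; split=> // x xa; apply: A0; exists x.
have [_ Kdown] := Kc.
have neq0 (x : X) t : A x -> 0 <= t <= 1 ->
    exists2 v, v != b & avoid_toward a b x t v != 0.
  move=> [v vb xv] /andP[t0 t1]; rewrite /avoid_toward.
  have xv0 : 0 < weight x v by rewrite lt_neqAle eq_sym xv weight_ge0.
  have [t2|t2] := leP t (1 / 2); last first.
    exists a => //; rewrite (negPf ab) eqxx mulr1 gt_eqF //; apply: ltr_wpDl.
      by rewrite mulr_ge0 ?weight_ge0 // le_min ler01 /=; lra.
    by rewrite lt_max; apply/orP; right; lra.
  exists v => //; rewrite (negPf vb) gt_eqF //; apply: ltr_pwDl.
    by rewrite mulr_gt0 // lt_min ltr01 /=; lra.
  by rewrite mulr_ge0 ?ler0n // le_max lexx.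
have nf (x : X) t : A x -> 0 <= t <= 1 -> normalizable K (avoid_toward a b x t).
  move=> Ax t01; case/andP: (t01) => t0 t1; split.
  - move=> v; rewrite /avoid_toward; case: ifP => _.
      by rewrite mulr_ge0 ?weight_ge0 // le_max lexx.
    rewrite addr_ge0 ?mulr_ge0 ?weight_ge0 ?ler0n // ?le_max ?lexx //.
    by rewrite le_min ler01 /=; lra.
  - by have [v _ fv] := neq0 x t Ax t01; exists v.
  have sx := support_weight x; have [t2|t2] := leP t (1 / 2).
    apply: Kdown sx _; apply/fintype.subsetP => v; rewrite !inE.
    apply: contra_neq => xv; rewrite /avoid_toward xv !mulr0 add0r.
    by case: ifP => // _; rewrite max_l ?mul0r //; lra.
  apply: Kdown (Kab _ sx) _; apply/fintype.subsetP => v; rewrite !inE /avoid_toward.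
  case: (eqVneq v b) => [->|vb] /=.
    by rewrite max_l ?mul0r ?eqxx //; lra.
  by case: (eqVneq v a) => // va; apply: contra_neq => ->; rewrite !mulr0 addr0.
apply: (@contractible_acyclic R X _ (fun y => normalize d (avoid_toward a b y.1 y.2))
  (normalize d (avoid_toward a b d 1))).
- apply: continuous_on_normalize => [v|y [ya y01]]; last exact: nf.
  have := @continuous_snd_real; have := @continuous_weight_fst v => c1 c2.
  by rewrite /avoid_toward; case: (v == b); continuity.
- move=> y [ya y01]; have [v vb fv] := neq0 _ _ ya y01; exists v => //.
  by rewrite weight_normalize_eq0 //; exact: nf.
- move=> x xa; apply: (@normalizeK _ _ _ _ _ 1) => // v; rewrite /avoid_toward /=.
  rewrite mulr0 subr0 sub0r subr0 max_r ?ler01 // max_l ?lerN10 // mul0r addr0.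
  by rewrite min_l ?if_same //; lra.
move=> x xa; congr normalize; apply: funext => v; rewrite /avoid_toward /= mulr1.
by rewrite max_l ?mul0r; [rewrite subrr min_r ?ler01 // !mul0r|lra].
Qed.

Lemma cone_contractible a : (forall s, s \in K -> (a |: s)%SET \in K) -> contractible R X.
Proof.
move=> aK; have [K0 Kdown] := Kc.
have dX : barycentric (fun v => (v == a)%:R : R) /\ [set v | (v == a)%:R != 0 :> R]%SET \in K.
  split; first split=> [v|]; first exact: ler0n.
    by rewrite (bigD1 a) //= eqxx big1 ?addr0 // => v /negPf ->.
  apply: Kdown (aK _ K0) _; apply/fintype.subsetP => v; rewrite !inE.
  by rewrite orbF; apply: contraNT => /negPf ->; exact: eqxx.
pose d : X := SigSub (mem_set dX).
pose c (t : R) : R := Num.max 0 (Num.min 1 t).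
have c01 t : 0 <= c t <= 1.
  by rewrite /c le_max lexx /= ge_max ler01 /= ge_min lexx.
exists (normalize d (toward a d 1)), (fun y => normalize d (toward a y.1 (c y.2))).
have nf (y : X * R) : normalizable K (toward a y.1 (c y.2)).
  by apply: normalizable_toward => //; apply: aK; exact: support_weight.
split.
- apply: continuous_subspaceT; apply: continuous_on_setT.
  apply: continuous_on_normalize => // v.
  have := @continuous_snd_real; have := @continuous_weight_fst v => c1 c2.
  by rewrite /toward /c; continuity.
- move=> x; apply: (@normalizeK _ _ _ _ _ 1) => // v; rewrite /toward /c /=.
  by rewrite min_r ?ler01 // max_l //; lra.
move=> x; congr normalize; apply: funext => v.
by rewrite /toward /c /= minxx max_r ?ler01 // subrr !mul0r.
Qed.

End Contractions.

(** With a single acyclic [V] the extension hypothesis is automatic: acyclicity corrects [c] by a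
    coboundary, which leaves [coboundary c] unchanged. *)
Lemma Sq_nonzero_suspension (R : realType) (Q X : topologicalType) (U V : set Q)
    (r : Q -> X) (s : X -> Q) n :
  (0 < n)%N -> (forall x : Q, nbhs x U \/ nbhs x V) ->
  acyclic_on R U -> acyclic_on R V -> continuous_on (U `&` V) r ->
  continuous s -> cancel s r -> (forall x, (U `&` V) (s x)) ->
  Sq_nonzero R X n -> Sq_nonzero R Q n.
Proof.
move=> n0 cov acU acV rc sc sr sUV.
apply: (@Sq_nonzero_connecting R Q X U unit (fun=> V) r s) => //.
- by move=> x; case: (cov x); [left|right; exists tt].
- move=> q c cV; have [g gV] := acV q c (cV tt); exists (c + coboundary g).
    by rewrite coboundaryD coboundaryK addr0.
  by move=> _.
- by move=> B g gc gA; apply: rc => // b; have [gU [_ gV]] := gA b.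
- by move=> x; have [] := sUV x.
move=> x; exists tt; rewrite (_ : _ @^-1` _ = setT); first exact: filterT.
by apply/seteqP; split=> // y _; have [] := sUV y.
Qed.

Lemma Sq_nonzero_point (R : realType) (X : topologicalType) n :
  (0 < n)%N -> Sq_nonzero R X n -> exists x : X, True.
Proof.
move=> n0 /Sq_nonzeroP -/(_ n0)[p [N [z [np pN z0 zw]]]].
apply: contrapT => X0; apply: (zw 0); apply: funext => s.
by case: X0; exists (s (centroid R N.+1)).
Qed.

(** * Suspensions of simplicial complexes *)

Section Suspensions.
Variables (R : realType) (V : finType).
Implicit Types (K N : {set {set V}}) (s t : {set V}).

Lemma nbhs_avoid K (x : realization R K) b v : v != b -> weight x v != 0 ->
  nbhs x [set y : realization R K | exists2 v, v != b & weight y v != 0].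
Proof. by move=> vb xv; apply: filterS (nbhs_weight_neq0 xv) => y yv; exists v. Qed.

Section ConeGlue.
Variables (N : {set {set V}}) (D : {set V}) (e : V).
Hypotheses (Nc : simplicial_complex N) (ND : forall s, s \in N -> s \subset D).
Hypothesis eD : e \notin D.

(** The cone over [N] with apex [e], together with the full simplex on [D]. Both are contractible
    and they meet in [N], so this is the suspension of [N] up to homotopy. *)
Definition cone_glue : {set {set V}} :=
  [set s | (s :\ e \in N) || (s \subset D)]%SET.

Lemma cone_glue_complex : simplicial_complex cone_glue.
Proof.
have [N0 Ndown] := Nc; split=> [|s t]; first by rewrite inE finset.sub0set orbT.
rewrite !inE => /orP[tN|tD] st; apply/orP; last by right; exact: fintype.subset_trans st tD.
by left; apply: Ndown tN _; exact: finset.setSD.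
Qed.

Lemma Sq_nonzero_cone_glue n : (0 < n)%N ->
  Sq_nonzero R (realization R N) n -> Sq_nonzero R (realization R cone_glue) n.
Proof.
move=> n0 Nn; have [d _] := Sq_nonzero_point n0 Nn.
have We (y : realization R N) : weight y e = 0.
  apply/eqP; apply: contraNT eD => ye; apply: (fintype.subsetP (ND (support_weight y))).
  by rewrite inE.
(* Weight 1 at [e] against total weight 1 elsewhere: after normalization, the slice of the cone at
   half height. *)
pose S (y : realization R N) v : R := if v == e then 1 else weight y v.
have nS y : normalizable cone_glue (S y).
  split; first by move=> v; rewrite /S; case: ifP => // _; exact: weight_ge0.
    by exists e; rewrite /S eqxx oner_eq0.
  rewrite inE (_ : (_ :\ e)%SET = [set v | weight y v != 0]%SET) ?support_weight //.
  by apply/setP => v; rewrite !inE /S; case: eqP => //= ->; rewrite We eqxx.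
have [d' _] := normalizable_point (nS d).
have [v0 v0D] : exists v0, v0 \in D.
  have [v dv] := weight_neq0 d; exists v.
  by apply: (fintype.subsetP (ND (support_weight d))); rewrite inE.
pose T (x : realization R cone_glue) v : R := if v == e then 0 else weight x v.
pose A : set (realization R cone_glue) := [set x | weight x e != 0].
pose B : set (realization R cone_glue) := [set x | exists2 v, v != e & weight x v != 0].
have nT x : (A `&` B) x -> normalizable N (T x).
  move=> [xe [v ve xv]]; split.
  - by move=> w; rewrite /T; case: ifP => // _; exact: weight_ge0.
  - by exists v; rewrite /T (negPf ve).
  have := support_weight x; rewrite inE => /orP[|/fintype.subsetP/(_ e)]; last first.
    by rewrite inE (negPf eD) => /(_ xe).
  rewrite (_ : (_ :\ e)%SET = [set w | T x w != 0]%SET) //.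
  by apply/setP => w; rewrite !inE /T; case: eqP => //= _; rewrite eqxx.
apply: (@Sq_nonzero_suspension R (realization R cone_glue) _ A B
  (fun x => normalize d (T x)) (fun y => normalize d' (S y))) Nn => //.
- move=> x; have [xe|xe] := eqVneq (weight x e) 0; last by left; exact: nbhs_weight_neq0.
  have [v xv] := weight_neq0 x; right; apply: (nbhs_avoid (v := v)) => //.
  by apply: contra_neq xv => ->.
- exact: (@acyclic_star R V cone_glue cone_glue_complex e).
- apply: (@acyclic_push R _ _ cone_glue_complex v0).
    by apply: contraNneq eD => <-.
  move=> s; rewrite !inE => sN; apply/orP; right.
  apply/fintype.subsetP => v; rewrite !inE => /orP[/eqP -> //|/andP[ve vs]].
  case/orP: sN => [/ND/fintype.subsetP|/fintype.subsetP]; last exact.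
  by apply; rewrite !inE ve.
- apply: continuous_on_normalize => // v; rewrite /T.
  by case: (v == e); [exact: continuous_cst|exact: continuous_weight].
- apply: continuous_on_setT; apply: continuous_on_normalize => // v; rewrite /S.
  by case: (v == e); [exact: continuous_cst|exact: continuous_weight].
- move=> y; have s0 := normalizable_sum_gt0 (nS y).
  apply: (@normalizeK _ _ _ _ _ (\sum_w S y w)^-1); first by rewrite invr_gt0.
  move=> v; rewrite /T; case: eqVneq => [->|ve]; first by rewrite We mulr0.
  by rewrite weight_normalize // /S (negPf ve) mulrC.
move=> y; split; rewrite /A /B /=.
  by rewrite weight_normalize_eq0 // /S eqxx oner_eq0.
have [v yv] := weight_neq0 y; have ve : v != e by apply: contra_neq yv => ->; exact: We.
by exists v => //; rewrite weight_normalize_eq0 // /S (negPf ve).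
Qed.

End ConeGlue.

Section VertexDoubling.
Variables (N : {set {set V}}) (a b : V).
Hypotheses (Nc : simplicial_complex N) (ab : a != b).
Hypothesis Nb : forall s, s \in N -> b \notin s.

(* [N] with its vertex [a] replaced by the edge [a b]: up to homotopy, the
   suspension of [N], which sits inside it as the locus where the weights of [a]
   and [b] agree. *)
Definition double_vertex : {set {set V}} :=
  [set s : {set V} | (if b \in s then s :\ b else s :\ a) \in N]%SET.

Lemma double_vertex_complex : simplicial_complex double_vertex.
Proof.
have [N0 Ndown] := Nc; split=> [|s t].
  by rewrite inE finset.in_set0 finset.set0D.
rewrite !inE => tN /[dup] st /fintype.subsetP st'; case: ifP => bs.
  by rewrite (st' _ bs) in tN; apply: Ndown tN _; exact: finset.setSD.
apply: Ndown tN _; apply/fintype.subsetP => v; rewrite !inE => /andP[va vs].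
case: ifP => _; rewrite !inE st' // andbT //.
by apply: contraFneq bs => <-.
Qed.

(** The complements of the vertices [b] and [a] cover and are acyclic: deleting one of the two
    vertices leaves a cone with the other as apex. *)
Lemma Sq_nonzero_double_vertex n : (0 < n)%N ->
  Sq_nonzero R (realization R N) n -> Sq_nonzero R (realization R double_vertex) n.
Proof.
move=> n0 Nn; have [d _] := Sq_nonzero_point n0 Nn; have [_ Ndown] := Nc.
have ba : b != a by rewrite eq_sym.
have Wb (y : realization R N) : weight y b = 0.
  by apply/eqP; apply: contraTT (support_weight y) => yb; apply/negP => /Nb; rewrite inE yb.
pose S (y : realization R N) v : R :=
  if (v == a) || (v == b) then weight y a / 2 else weight y v.
have S0 y v : 0 <= S y v.
  by rewrite /S; case: ifP => _; rewrite ?divr_ge0 ?weight_ge0.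
have nS y : normalizable double_vertex (S y).
  split=> //.
    have [v yv] := weight_neq0 y; exists v; rewrite /S; case: (eqVneq v a) => [va|va] /=.
      by rewrite -va mulf_neq0 // invr_eq0 pnatr_eq0.
    by case: (eqVneq v b) => [vb|//]; rewrite vb Wb eqxx in yv.
  rewrite inE inE /S eqxx orbT; apply: Ndown (support_weight y) _.
  case: ifP => [ya|ya]; apply/fintype.subsetP => v; rewrite !inE => /andP[vb].
    rewrite (negPf vb) orbF; case: (eqVneq v a) => [->|//].
    by apply: contra_neq => ->; rewrite mul0r.
  by rewrite (negPf vb) /=; case: (eqVneq v b) => [_|//]; rewrite ya.
have [d' _] := normalizable_point (nS d).
(* The minimum vanishes exactly when [a] or [b] is missing from the support, the case in which a
   face may have to lose [a] to lie in [N]. The factor 2 undoes the halving in [S]. *)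
pose T (x : realization R double_vertex) v : R :=
  if v == a then 2 * Num.min (weight x a) (weight x b)
  else if v == b then 0 else weight x v.
pose A c : set (realization R double_vertex) :=
  [set x | exists2 v, v != c & weight x v != 0].
have nT x : (A b `&` A a) x -> normalizable N (T x).
  have x0 := weight_ge0 x => -[[v vb xv] [w wa xw]]; split.
  - move=> u; rewrite /T; case: ifP => _; first by rewrite mulr_ge0 // le_min !x0.
    by case: ifP.
  - have [va|va] := eqVneq v a; last by exists v; rewrite /T (negPf va) (negPf vb).
    have [wb|wb] := eqVneq w b; last by exists w; rewrite /T (negPf wa) (negPf wb).
    exists a; rewrite /T eqxx gt_eqF // mulr_gt0 // lt_min.
    by rewrite -va -wb !lt_neqAle eq_sym xv eq_sym xw !x0.
  have := support_weight x; rewrite inE => sN; apply: Ndown sN _.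
  apply/fintype.subsetP => u; rewrite !inE /T; case: (eqVneq u a) => [->|ua].
    rewrite mulf_eq0 pnatr_eq0 /= => m0.
    have : (0 < weight x a) && (0 < weight x b).
      by rewrite -lt_min lt_neqAle eq_sym m0 le_min !x0.
    by case/andP => xa xb; rewrite !gt_eqF //= !inE ab gt_eqF.
  case: (eqVneq u b) => [_|ub]; first by rewrite eqxx.
  by move=> xu; case: ifP; rewrite !inE xu ?ua ?ub.
have nbA (x : realization R double_vertex) : nbhs x (A b) \/ nbhs x (A a).
  have [v xv] := weight_neq0 x; have [vb|vb] := eqVneq v b.
    by right; apply: (nbhs_avoid (v := v)); rewrite ?vb // -vb.
  by left; exact: (nbhs_avoid (v := v)).
apply: (@Sq_nonzero_suspension R (realization R double_vertex) _ (A b) (A a)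
  (fun x => normalize d (T x)) (fun y => normalize d' (S y))) Nn => //.
- apply: (@acyclic_push R _ _ double_vertex_complex a b ab) => s; rewrite !inE.
  rewrite eqxx (negPf ba) /= => sN; apply: Ndown sN _; apply/fintype.subsetP => v.
  by rewrite !inE; case: ifP => bs /andP[va]; rewrite (negPf va) /= !inE => /andP[vb ->];
    rewrite ?va ?vb.
- apply: (@acyclic_push R _ _ double_vertex_complex b a ba) => s; rewrite !inE.
  rewrite eqxx /= => sN; apply: Ndown sN _; apply/fintype.subsetP => v.
  by rewrite !inE; case: ifP => bs /andP[vb]; rewrite (negPf vb) /= !inE => /andP[va ->];
    rewrite ?va ?vb.
- apply: continuous_on_normalize => // v; rewrite /T.
  have ca := @continuous_weight R V double_vertex.
  by case: (v == a); [continuity; exact: ca|case: (v == b); [continuity|exact: ca]].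
- apply: continuous_on_setT; apply: continuous_on_normalize => // v; rewrite /S.
  have ca := @continuous_weight R V N.
  by case: (_ || _); [continuity; exact: ca|exact: ca].
- move=> y; have s0 := normalizable_sum_gt0 (nS y).
  apply: (@normalizeK _ _ _ _ _ (\sum_w S y w)^-1); first by rewrite invr_gt0.
  move=> v; rewrite /T !weight_normalize //; case: (eqVneq v a) => [->|va].
    by rewrite /S !eqxx orbT minxx mulrA mulrCA divff ?pnatr_eq0 // mulr1 mulrC.
  case: (eqVneq v b) => [->|vb]; first by rewrite Wb mulr0.
  by rewrite /S (negPf va) (negPf vb) mulrC.
move=> y; have [v yv] := weight_neq0 y.
have vb : v != b by apply: contra_neq yv => ->; exact: Wb.
have Sv : S y v != 0.
  rewrite /S (negPf vb) orbF; case: (eqVneq v a) => // va.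
  by rewrite -va mulf_neq0 // invr_eq0 pnatr_eq0.
split; rewrite /A /=; first by exists v => //; rewrite weight_normalize_eq0.
have [va|va] := eqVneq v a; last by exists v => //; rewrite weight_normalize_eq0.
by exists b => //; rewrite weight_normalize_eq0 // /S eqxx orbT -va mulf_neq0 // invr_eq0 pnatr_eq0.
Qed.

End VertexDoubling.
End Suspensions.

(** * Block complexes as iterated suspensions *)

Section BlockComplexes.
Variables (T V : finType) (K : {set {set T}}) (pi : V -> option T).
Implicit Types (D s t c : {set V}).

Definition full_blocks D s : {set T} :=
  [set i | [forall v, (v \in D) && (pi v == Some i) ==> (v \in s)]].

Definition misses_none D s : bool := [exists v, [&& v \in D, pi v == None & v \notin s]].

(* With E the block [pi v = None] and P the polyhedral join over [K] of the pairs
   (simplex, boundary) on the other blocks, this is the union of P * (simplex on E)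
   and (simplex on the other blocks) * (boundary of E): up to homotopy P if E is
   empty, and the suspension of P * (boundary of E) otherwise. *)
Definition block_complex D : {set {set V}} :=
  [set s : {set V} | (s \subset D) && ((full_blocks D s \in K) || misses_none D s)].

Lemma full_blocksP D s i :
  reflect (forall v, v \in D -> pi v = Some i -> v \in s) (i \in full_blocks D s).
Proof.
rewrite inE; apply: (iffP forallP) => h v.
  by move=> vD pv; have := h v; rewrite vD pv eqxx.
by apply/implyP => /andP[vD /eqP pv]; exact: h.
Qed.

Lemma misses_noneP D s :
  reflect (exists2 v, v \in D & pi v = None /\ v \notin s) (misses_none D s).
Proof.
apply: (iffP existsP) => [[v /and3P[vD /eqP pv vs]]|[v vD [pv vs]]]; exists v => //.
by rewrite vD pv eqxx.
Qed.

Lemma full_blocksS D s t : s \subset t -> full_blocks D s \subset full_blocks D t.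
Proof.
move=> /fintype.subsetP st; apply/fintype.subsetP => i /full_blocksP h.
by apply/full_blocksP => v vD pv; apply: st; exact: h.
Qed.

(** Applied with [c] the face of the smaller complex obtained from [s]. If [s] lacks [v], then [c]
    lacks some vertex of the same block, so that this block is full on neither side. *)
Lemma full_blocksU1 D s v c :
  (forall w, w \in D -> w \in c = (w \in s) \/ (pi w = pi v /\ v \notin s)) ->
  (v \notin s -> exists2 w, w \in D & pi w = pi v /\ w \notin c) ->
  full_blocks D c = full_blocks (v |: D)%SET s.
Proof.
move=> h1 h2; apply/setP => i; apply/full_blocksP/full_blocksP => h w.
  rewrite !inE => /orP[/eqP -> pv|wD pw].
    apply: contraT => /[dup] vs /h2[u uD [pu uc]].
    by move/negP: uc; case; apply: h => //; rewrite pu.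
  case: (h1 w wD) => [<-|[wv vs]]; first exact: h.
  have [u uD [pu uc]] := h2 vs.
  by move/negP: uc; case; apply: h => //; rewrite pu -wv.
move=> wD pw; case: (h1 w wD) => [->|[wv vs]].
  by apply: h => //; rewrite !inE wD orbT.
by move/negP: vs; case; apply: h; rewrite ?finset.setU11 // -wv.
Qed.

Hypothesis Kc : simplicial_complex K.
Variable sec : T -> V.
Hypothesis secK : forall i, pi (sec i) = Some i.

Let D0 : {set V} := [set sec i | i : T].

Lemma block_complexP D : D0 \subset D -> simplicial_complex (block_complex D).
Proof.
move=> /fintype.subsetP D0D; have [K0 Kdown] := Kc; split=> [|s t].
  rewrite inE finset.sub0set /= (_ : full_blocks D _ = finset.set0) ?K0 //.
  apply/setP => i; rewrite finset.in_set0; apply/negbTE/negP => /full_blocksP.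
  by move=> /(_ (sec i)); rewrite secK finset.in_set0 D0D ?imset_f // => /(_ isT erefl).
rewrite !inE => /andP[tD tK] st; rewrite (fintype.subset_trans st tD) /=.
case/orP: tK => [tK|/misses_noneP[v vD [pv vt]]].
  by rewrite (Kdown _ _ tK (full_blocksS _ st)).
apply/orP; right; apply/misses_noneP; exists v => //; split=> //.
by apply: contra vt; exact: (fintype.subsetP st).
Qed.

(** In [double_vertex] the vertex [a] survives only if [v] is present too, just as a block
    containing both is full only when neither is missing. *)
Lemma block_complex_double D v a : v \notin D -> a \in D -> pi v = pi a ->
  double_vertex (block_complex D) a v = block_complex (v |: D)%SET.
Proof.
move=> vD aD pva; have va : a != v by apply: contraNneq vD => <-.
apply/setP => s; pose c := (if v \in s then s :\ v else s :\ a)%SET.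
have -> : (s \in double_vertex (block_complex D) a v) = (c \in block_complex D).
  by rewrite /double_vertex inE.
rewrite !inE.
have -> : (c \subset D) = (s \subset v |: D)%SET.
  rewrite /c; case: ifP => vs; first by rewrite finset.subDset.
  apply/fintype.subsetP/fintype.subsetP => h w; last first.
    rewrite !inE => /andP[wa ws]; have := h w ws; rewrite !inE => /orP[/eqP wv|//].
    by rewrite wv vs in ws.
  move=> ws; rewrite !inE; have [->|wa] := eqVneq w a; first by rewrite aD orbT.
  by rewrite h ?orbT // !inE wa.
have -> : full_blocks D c = full_blocks (v |: D)%SET s.
  apply: full_blocksU1 => [w wD|vs]; rewrite /c.
    case: ifP => vs; rewrite !inE; first by left; case: eqP => // wv; rewrite -wv wD in vD.
    by have [->|] := eqVneq w a; [right|left].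
  by exists a => //; rewrite (negPf vs) pva !inE eqxx.
congr (_ && (_ || _)); apply/misses_noneP/misses_noneP => -[w]; rewrite /c.
  case: ifP => vs wD [pw]; rewrite !inE negb_and negbK => /orP[/eqP wE|ws].
  - by rewrite wE (negPf vD) in wD.
  - by exists w; rewrite ?inE ?wD ?orbT.
  - by exists v; rewrite ?finset.setU11 // vs pva -wE.
  by exists w; rewrite ?inE ?wD ?orbT.
rewrite !inE => /orP[/eqP -> [pv vs]|wD [pw ws]].
  by exists a => //; rewrite (negPf vs) -pva !inE eqxx.
by exists w => //; case: ifP => _; rewrite !inE (negPf ws) andbF.
Qed.

(** As long as [D] lies in the blocks, faces are governed by full blocks alone. The first vertex [v]
    outside the blocks cones this complex off, while every subset of [D] becomes a face because it
    misses [v]. *)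
Lemma block_complex_glue D v : v \notin D -> pi v = None ->
  (forall w, w \in D -> pi w <> None) ->
  cone_glue (block_complex D) D v = block_complex (v |: D)%SET.
Proof.
move=> vD pv Dn; apply/setP => s; rewrite !inE finset.subDset.
have mD c : misses_none D c = false.
  by apply/negbTE/negP => /misses_noneP[w /Dn wn [/wn]].
rewrite mD orbF; have [vs|vs] := boolP (v \in s).
  have sD : (s \subset D) = false.
    by apply/negbTE/negP => /fintype.subsetP/(_ v vs); rewrite (negPf vD).
  have mvD : misses_none (v |: D)%SET s = false.
    apply/negbTE/negP => /misses_noneP[w]; rewrite !inE => /orP[/eqP -> [_]|/Dn wn []//].
    by rewrite vs.
  rewrite sD mvD !orbF; congr (_ && (_ \in K)).
  apply: full_blocksU1 => [w wD|]; last by rewrite vs.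
  by left; rewrite !inE; case: eqP => // wv; rewrite -wv wD in vD.
have -> : misses_none (v |: D)%SET s.
  by apply/misses_noneP; exists v => //; exact: finset.setU11.
rewrite orbT andbT; have -> : (s \subset v |: D)%SET = (s \subset D).
  apply/fintype.subsetP/fintype.subsetP => h w ws; last by rewrite !inE h ?orbT.
  by have := h w ws; rewrite !inE => /orP[/eqP wv|//]; rewrite wv (negPf vs) in ws.
by case: (s \subset D); rewrite /= ?orbT.
Qed.

Lemma block_complex_sub D s : s \in block_complex D -> s \subset D.
Proof. by rewrite inE => /andP[]. Qed.

Variable R : realType.

(** With one vertex per block, a block is full when its vertex is present, so this is [K] renamed
    along [sec]. The vertex types differ, hence a retraction instead of an equality. *)
Lemma Sq_nonzero_block_base n : (0 < n)%N -> Sq_nonzero R (realization R K) n ->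
  Sq_nonzero R (realization R (block_complex D0)) n.
Proof.
move=> n0 Kn; have [d _] := Sq_nonzero_point n0 Kn.
have fullD0 s : full_blocks D0 s = [set i | sec i \in s]%SET.
  apply/setP => i; rewrite [RHS]inE; apply/full_blocksP/idP => [h|si v].
    by apply: h; rewrite ?secK ?imset_f.
  by case/imsetP => j _ ->; rewrite secK => -[->].
pose S (y : realization R K) v : R :=
  if pi v is Some i then (if v == sec i then weight y i else 0) else 0.
have Ssec y i : S y (sec i) = weight y i by rewrite /S secK eqxx.
have SD0 y v : S y v != 0 -> v \in D0.
  rewrite /S; case: (pi v) => [i|]; last by rewrite eqxx.
  by case: (eqVneq v (sec i)) => [-> _|_]; rewrite ?eqxx // imset_f.
have nS y : normalizable (block_complex D0) (S y).
  split.
  - by move=> v; rewrite /S; case: (pi v) => // i; case: ifP => // _; exact: weight_ge0.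
  - by have [i yi] := weight_neq0 y; exists (sec i); rewrite Ssec.
  rewrite inE; apply/andP; split.
    by apply/fintype.subsetP => v; rewrite inE; exact: SD0.
  rewrite fullD0 (_ : [set i | _]%SET = [set i | weight y i != 0]%SET) ?support_weight //.
  by apply/setP => i; rewrite !inE Ssec.
have [d' _] := normalizable_point (nS d).
pose F (x : realization R (block_complex D0)) i : R := weight x (sec i).
have nF x : normalizable K (F x).
  have := support_weight x; rewrite inE => /andP[xD xK]; split.
  - by move=> i; exact: weight_ge0.
  - have [v xv] := weight_neq0 x.
    have /imsetP[i _ vi] : v \in D0 by apply: (fintype.subsetP xD); rewrite inE.
    by exists i; rewrite /F -vi.
  case/orP: xK => [|/misses_noneP[v /imsetP[i _ ->]]]; last by rewrite secK => -[].
  by rewrite fullD0 (_ : [set i | _]%SET = [set i | F x i != 0]%SET) //;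
    apply/setP => i; rewrite !inE.
apply: (@Sq_nonzero_retract R _ _ (fun y => normalize d' (S y))
  (fun x => normalize d (F x)) n n0) Kn.
- apply: continuous_on_setT; apply: continuous_on_normalize => // v; rewrite /S.
  case: (pi v) => [i|]; last exact: continuous_cst.
  by case: (v == sec i); [exact: continuous_weight|exact: continuous_cst].
- apply: continuous_on_setT; apply: continuous_on_normalize => // i.
  exact: continuous_weight.
move=> y; have s0 := normalizable_sum_gt0 (nS y).
apply: (@normalizeK _ _ _ _ _ (\sum_w S y w)^-1); first by rewrite invr_gt0.
by move=> i; rewrite /F weight_normalize // Ssec mulrC.
Qed.

Lemma Sq_nonzero_block_complex n D : (0 < n)%N -> D0 \subset D ->
  Sq_nonzero R (realization R K) n -> Sq_nonzero R (realization R (block_complex D)) n.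
Proof.
move=> n0; move: {2}#|D :\: D0| (erefl #|D :\: D0|) => k.
elim: k D => [|k IH] D kD D0D Kn.
  have -> : D = D0; last exact: Sq_nonzero_block_base.
  by apply/eqP; rewrite finset.eqEsubset D0D andbT -finset.setD_eq0 -cards_eq0 kD.
have [v] : exists v, v \in D :\: D0 by apply/card_gt0P; rewrite kD.
rewrite inE => /andP[vD0 vD].
have D0D' : D0 \subset D :\ v by rewrite finset.subsetD1 D0D.
have vD' : v \notin D :\ v by rewrite finset.setD11.
have {}IH : Sq_nonzero R (realization R (block_complex (D :\ v))) n.
  apply: IH => //; have := cardsD1 v (D :\: D0); rewrite inE vD0 vD kD => -[->].
  by apply: eq_card => w; rewrite !inE; case: (w == v); rewrite ?andbF.
have Dc := block_complexP D0D'.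
have vN s : s \in block_complex (D :\ v) -> v \notin s.
  by move=> /block_complex_sub/fintype.subsetP sD; apply: contra vD'; exact: sD.
rewrite -(finset.setD1K vD).
(* A companion of [v] under [pi] gives a vertex doubling. Without one, [v] is outside all blocks, as
   block [i] always contains [sec i], and it is the first such vertex. *)
have [[a aD pva]|noa] := pselect (exists2 a, a \in D :\ v & pi v = pi a).
  rewrite -(block_complex_double vD' aD pva); apply: Sq_nonzero_double_vertex => //.
  by apply: contraNneq vD' => av; rewrite -{1}av.
case pv: (pi v) => [i|].
  case: noa; exists (sec i); rewrite ?secK //.
  by apply: (fintype.subsetP D0D'); exact: imset_f.
rewrite -block_complex_glue //; last by move=> w wD pw; apply: noa; exists w; rewrite ?pv.
by apply: Sq_nonzero_cone_glue => // s; exact: block_complex_sub.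
Qed.

End BlockComplexes.

(* With [e i] acting on cochains, [c] is replaced by its image under the product
   of the [1 + e i]. *)
Lemma retractions_extension (R : realType) (Q : topologicalType) (I : eqType)
    (V : I -> set Q) (e : I -> Q -> Q) (l : seq I) :
  (forall i, i \in l -> continuous (e i)) -> (forall i x, i \in l -> V i (e i x)) ->
  (forall i x, i \in l -> V i x -> e i x = x) ->
  (forall i j x, i \in l -> V j x -> V j (e i x)) ->
  forall q (c : cochain R Q q),
  (forall i, i \in l -> vanishes_on (V i) (coboundary c)) ->
  exists2 c', coboundary c' = coboundary c & forall i, i \in l -> vanishes_on (V i) c'.
Proof.
elim: l => [|i l IH] ec eV eK eS q c dc; first by exists c.
have sub_l j : j \in l -> j \in i :: l by rewrite inE => ->; rewrite orbT.
have [c' dc' c'V] : exists2 c' : cochain R Q q,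
    coboundary c' = coboundary c & forall j, j \in l -> vanishes_on (V j) c'.
  by apply: IH => [j|j x|j x|j k x|j] /sub_l; [exact: ec|exact: eV|exact: eK|exact: eS|exact: dc].
have il : i \in i :: l by rewrite inE eqxx.
have es p (s : singular_simplex R Q p) : continuous (e i \o s).
  by apply: continuous_compT (ec i il); exact: cts_fun.
exists (c' + pull (e i) c').
  rewrite coboundaryD dc' -[RHS]addr0; congr (_ + _); apply: funext => s.
  rewrite coboundary_pull // dc'; apply: (dc i il) => x.
  by rewrite postE //; exact: eV.
move=> j; rewrite inE; have [->|ji] /= := eqVneq j i.
  move=> _ s sV; rewrite cochainDE /pull (_ : post (e i) s = s) ?F2_addxx //.
  by apply/continuousEP => x; rewrite postE //=; exact: eK.
move=> jl s sV; rewrite cochainDE /pull !(c'V j) ?addr0 // => x.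
by rewrite postE //=; exact: eS.
Qed.

(** * Cubical complexes and their connecting map *)

Section CubicalComplexes.
Variables (R : realType) (V : finType) (N : {set {set V}}) (D : {set V}).

(* The polyhedral product of the pairs ([-1, 1], {-1, 1}) over [N], with the
   coordinates of the ghost vertices outside [D] frozen to 1. *)
Definition cube_set : set {ptws V -> R} := [set z |
  [/\ forall v, `|z v| <= 1, [set v | `|z v| != 1]%SET \in N &
      forall v, v \notin D -> z v = 1]].

Definition cubical : topologicalType := set_type cube_set.

Lemma continuous_cubical_coord v : continuous (fun z : cubical => val z v).
Proof.
have vc : continuous (val : cubical -> {ptws V -> R}) by exact: continuous_val.
exact: (continuous_compT vc (@continuous_eval V R v)).
Qed.

Lemma nbhs_gt0 (X : topologicalType) (f : X -> R) z : continuous f -> 0 < f z ->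
  nbhs z [set y | 0 < f y].
Proof.
move=> fc fz; have : nbhs (f z) [set t : R | 0 < t].
  by apply: open_nbhs_nbhs; split=> //; exact: open_gt.
exact: (fc z).
Qed.

Definition reflect_fun (v : V) (z : cubical) : {ptws V -> R} :=
  fun w => if w == v then - `|val z w| else val z w.

Definition reflect v (z : cubical) : cubical := sub_pt z (reflect_fun v z).

Lemma val_reflect v z : v \in D -> val (reflect v z) = reflect_fun v z.
Proof.
move=> vD; apply: sub_ptE; have [z1 zN zD] := set_mem (valP z).
have en w : `|reflect_fun v z w| = `|val z w|.
  by rewrite /reflect_fun; case: ifP => _ //; rewrite normrN normr_id.
split=> [w||w wD]; first by rewrite en.
  by rewrite (_ : [set w | _]%SET = [set w | `|val z w| != 1]%SET) //;
    apply/setP => w; rewrite !inE en.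
by rewrite /reflect_fun ifN ?zD //; apply: contraNneq wD => ->.
Qed.

Hypotheses (Nc : simplicial_complex N) (ND : forall s, s \in N -> s \subset D).

(** For [v] in [D], [W v] is the half onto which [reflect v] retracts. [U] is the positive orthant,
    thickened so that the interiors of these sets cover. *)
Let W v : set cubical := [set z | val z v <= 0].
Let U : set cubical := [set z | forall v, -1 < val z v].

Let U_bounds z : U z -> forall v, -1 < val z v <= 1.
Proof.
move=> Uz v; rewrite Uz /=; have [z1 _ _] := set_mem (valP z).
by have := z1 v; rewrite ler_norml => /andP[].
Qed.

Let U_support z : U z -> [set v | val z v != 1]%SET \in N.
Proof.
move=> Uz; have [_ zN _] := set_mem (valP z).
rewrite (_ : [set v | _]%SET = [set v | `|val z v| != 1]%SET) //.
apply/setP => v; rewrite !inE; congr negb; have /andP[z1 z1'] := U_bounds Uz v.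
rewrite eqr_norml ler01 andbT; case: (eqVneq (val z v) 1) => //= _.
by apply/esym/negbTE; rewrite gt_eqF.
Qed.

Let cube_one : cube_set (fun=> 1).
Proof.
have [N0 _] := Nc; split=> // [v|]; first by rewrite normr1.
rewrite (_ : [set v | _]%SET = finset.set0) //.
by apply/setP => v; rewrite !inE normr1 eqxx.
Qed.

Lemma acyclic_cubical_positive : acyclic_on R U.
Proof.
pose d : cubical := SigSub (mem_set cube_one).
pose F (y : cubical * R) : {ptws V -> R} := fun v => val y.1 v + y.2 * (1 - val y.1 v).
have Fb (y : cubical * R) v : U y.1 -> 0 <= y.2 <= 1 -> -1 < F y v <= 1.
  move=> Uy /andP[t0 t1]; have /andP[z0 z1] := U_bounds Uy v.
  by rewrite /F; apply/andP; split; nra.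
have FU y : cylinder U y -> cube_set (F y).
  move=> [Uy t01]; have [_ Ndown] := Nc; have [_ _ zD] := set_mem (valP y.1); split.
  - by move=> v; rewrite ler_norml; have /andP[/ltW -> ->] := Fb y v Uy t01.
  - apply: Ndown (U_support Uy) _; apply/fintype.subsetP => v; rewrite !inE.
    by apply: contra_neq => zv; rewrite /F zv subrr mulr0 addr0 normr1.
  by move=> v vD; rewrite /F zD // subrr mulr0 addr0.
apply: (@contractible_acyclic R cubical U (fun y => sub_pt d (F y)) d).
- apply: (@continuous_on_sub_pt (cubical * R)%type {ptws V -> R} cube_set d) => //.
  apply: continuous_onT; apply: continuous_ptws => v.
  have c1 : continuous (fun y : cubical * R => val y.1 v).
    apply: (@continuous_compT (cubical * R)%type cubical R fst (fun x => val x v)).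
      by move=> y; exact: cvg_fst.
    exact: continuous_cubical_coord.
  have c2 : continuous (fun y : cubical * R => y.2) by move=> y; exact: cvg_snd.
  by rewrite /F; continuity.
- move=> y yU v; rewrite [X in _ < X _]sub_ptE; last exact: FU.
  by have /andP[] := Fb y v yU.1 yU.2.
- move=> x Ux; apply/val_inj; rewrite sub_ptE.
    by apply: funext => v; rewrite /F mul0r addr0.
  by apply: FU; split=> //=; rewrite lexx ler01.
move=> x Ux; apply/val_inj; rewrite sub_ptE.
  by apply: funext => v; rewrite /F mul1r addrC subrK.
by apply: FU; split=> //=; rewrite lexx ler01.
Qed.

Lemma Sq_nonzero_cubical n : (0 < n)%N ->
  Sq_nonzero R (realization R N) n -> Sq_nonzero R cubical n.
Proof.
move=> n0 Nn; have [d _] := Sq_nonzero_point n0 Nn.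
pose d' : cubical := SigSub (mem_set cube_one).
pose k : R := #|V|%:R.
have k0 : 0 <= k by rewrite ler0n.
(* [S] sends the weight [x] to the coordinate [(1 - (k + 1) x) / (1 + k x)],
   which decreases from 1 to a value above -1 and is negative at [x = 1 / k];
   [G] is the inverse formula. *)
pose S (x : realization R N) : {ptws V -> R} :=
  fun v => (1 - (k + 1) * weight x v) / (1 + k * weight x v).
pose G (z : cubical) v : R := (1 - val z v) / (k + 1 + k * val z v).
have w01 (x : realization R N) v : 0 <= weight x v <= 1.
  rewrite weight_ge0 -(sum_weight x) (bigD1 v) //= lerDl.
  by apply: sumr_ge0 => i _; exact: weight_ge0.
have den (x : realization R N) v : 0 < 1 + k * weight x v.
  by have /andP[x0 _] := w01 x v; rewrite ltr_pwDl // mulr_ge0.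
have S1 x v : S x v = 1 - (2 * k + 1) * weight x v / (1 + k * weight x v).
  by rewrite /S; field; exact: lt0r_neq0.
have Sgt x v : -1 < S x v.
  rewrite /S ltr_pdivlMr //; have /andP[x0 x1] := w01 x v; lra.
have Sle x v : S x v <= 1.
  rewrite S1 gerBl; apply: divr_ge0; last exact: ltW.
  by apply: mulr_ge0; [lra|exact: weight_ge0].
have Sw x v : weight x v = 0 -> S x v = 1.
  by move=> xv; rewrite S1 xv mulr0 mul0r subr0.
have SC x : cube_set (S x).
  have [_ Ndown] := Nc; split.
  - by move=> v; rewrite ler_norml Sle ltW.
  - apply: Ndown (support_weight x) _; apply/fintype.subsetP => v; rewrite !inE.
    by apply: contra_neq => /Sw ->; rewrite normr1.
  move=> v vD; apply: Sw; apply/eqP; apply: contraNT vD => xv.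
  by apply: (fintype.subsetP (ND (support_weight x))); rewrite inE.
have denG z v : U z -> 0 < k + 1 + k * val z v.
  by move=> /(_ v) zv; nra.
have nG z : U z /\ (exists v, W v z) -> normalizable N (G z).
  move=> [Uz [v zv]]; have G0 w : (G z w != 0) = (val z w != 1).
    rewrite /G mulf_eq0 invr_eq0 [X in _ || X]gt_eqF ?orbF ?denG //.
    by rewrite subr_eq0 eq_sym.
  split.
  - move=> w; apply: divr_ge0; last by apply: ltW; exact: denG.
    by rewrite subr_ge0; have /andP[] := U_bounds Uz w.
  - by exists v; rewrite G0 lt_eqF // (le_lt_trans zv) // ltr01.
  by rewrite (_ : [set v | _]%SET = [set v | val z v != 1]%SET) ?U_support //;
    apply/setP => w; rewrite !inE G0.
have Scont v : continuous (fun x => S x v).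
  have cv := @continuous_weight R V N v.
  apply: continuous_divr; [by continuity|by continuity|].
  by move=> x; rewrite lt0r_neq0.
apply: (@Sq_nonzero_connecting R cubical _ U V W (fun z => normalize d (G z))
  (fun x => sub_pt d' (S x))) Nn => //.
- move=> z; have [[v zv]|z0] := pselect (exists v, val z v < 0).
    right; exists v; apply: (@filterS _ _ _ [set y | 0 < - val y v]).
      by move=> y /=; rewrite oppr_gt0 => /ltW.
    apply: nbhs_gt0; last by rewrite oppr_gt0.
    by apply: continuous_oppr; exact: continuous_cubical_coord.
  left; apply: (@filterS _ _ _ [set y | forall v, 0 < val y v + 1]).
    by move=> y y0 v; have := y0 v; lra.
  apply: (@filter_forall cubical V (fun v y => 0 < val y v + 1 : Prop) (nbhs z)) => v.
  apply: nbhs_gt0.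
    by apply: continuous_addr; [exact: continuous_cubical_coord|exact: continuous_cst].
  have : ~ val z v < 0 by move=> zv; apply: z0; exists v.
  by move/negP; rewrite -leNgt => zv; lra.
- move=> q c cW; have [c' dc' c'W] : exists2 c' : cochain R cubical q.+1,
      coboundary c' = coboundary c & forall v, v \in enum D -> vanishes_on (W v) c'.
    apply: (@retractions_extension R cubical V W reflect) => [v|v z|v z|v w z|v _];
      last exact: cW; rewrite mem_enum => vD.
    + apply/continuous_comp_initial.
      rewrite (_ : _ \o _ = reflect_fun v); last by apply: funext => z; exact: val_reflect.
      apply: continuous_ptws => w; have cw := @continuous_cubical_coord w.
      by rewrite /reflect_fun; case: (w == v); continuity.
    + by rewrite /W /= val_reflect // /reflect_fun eqxx oppr_le0.
    + move=> zv; apply/val_inj; rewrite val_reflect //.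
      apply: funext => w; rewrite /reflect_fun; case: eqP => // ->.
      by rewrite ler0_norm ?opprK.
    + move=> zw; rewrite /W /= val_reflect // /reflect_fun.
      by case: ifP => // _; rewrite oppr_le0.
  exists c' => // v; have [vD|vD] := boolP (v \in D).
    by apply: c'W; rewrite mem_enum.
  (* A coordinate outside [D] is frozen at 1, so here [W v] is empty. *)
  move=> s /(_ (centroid R _)); rewrite /W /=.
  by have [_ _ ->] := set_mem (valP (s (centroid R q.+1))); rewrite // ler10.
- exact: acyclic_cubical_positive.
- apply: (@continuous_on_sub_pt cubical {ptws V -> R}).
    apply: continuous_on_ptws => v B g gc gA; have gU b : U (g b) by have [] := gA b.
    have cg w : continuous (fun b => val (g b) w).
      exact: continuous_compT gc (@continuous_cubical_coord w).
    have cG w : continuous (fun b => G (g b) w).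
      apply: continuous_divr; [by continuity|by continuity|].
      by move=> b; rewrite lt0r_neq0 ?denG.
    apply: (@continuous_divr R B (fun b => G (g b) v) (fun b => \sum_w G (g b) w)) => //.
      exact: continuous_sumr.
    by move=> b; rewrite gt_eqF //; apply: normalizable_sum_gt0; exact: nG (gA b).
  by move=> z /nG; exact: normalizable_realization.
- apply: continuous_on_setT; apply: continuous_on_sub_pt => //.
  by apply: continuous_onT; exact: continuous_ptws.
- move=> x; apply: (@normalizeK _ _ _ _ _ 1) => // v; rewrite mul1r /G sub_ptE //.
  have xd := den x v; have -> : 1 - S x v = (2 * k + 1) * weight x v / (1 + k * weight x v).
    by rewrite S1; ring.
  have -> : k + 1 + k * S x v = (2 * k + 1) / (1 + k * weight x v).
    by rewrite /S; field; exact: lt0r_neq0.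
  rewrite invf_div mulrA divfK ?lt0r_neq0 // mulrAC divff ?mul1r //.
  by rewrite lt0r_neq0 //; lra.
- by move=> x v; rewrite [X in _ < X _]sub_ptE.
(* The weights of the [#|V|] vertices sum to 1, so one of them exceeds 1 / (k + 1), the zero of the
   numerator of [S]. *)
move=> x; have [v xv] : exists v, 1 < (k + 1) * weight x v.
  apply/existsP; apply: contraT; rewrite negb_exists => /forallP xle.
  have : \sum_v (k + 1) * weight x v <= \sum_(v : V) 1.
    by apply: ler_sum => v _; rewrite leNgt; exact: xle.
  by rewrite -mulr_sumr sum_weight mulr1 sumr_const -/k gerDl ler10.
exists v; apply: (@filterS _ _ _ [set y | 0 < (k + 1) * weight y v - 1]).
  move=> y /= yv; suff : val (sub_pt d' (S y)) v <= 0 by [].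
  by rewrite sub_ptE // /S pmulr_lle0 ?invr_gt0 //; lra.
apply: nbhs_gt0; last by rewrite subr_gt0.
by have cv := @continuous_weight R V N v; continuity.
Qed.

End CubicalComplexes.

(** * The square and the disk *)

Section SquareAndDisk.
Variable R : realType.
Implicit Types x y u v : R.

Lemma sqr_le1 x : `|x| <= 1 -> x ^+ 2 <= 1.
Proof. by move=> x1; rewrite -real_normK ?num_real // expr_le1. Qed.

Lemma sqrt2_sqr : Num.sqrt 2 ^+ 2 = 2 :> R.
Proof. by rewrite sqr_sqrtr. Qed.

(* The elliptical homeomorphism from the square [-1, 1]^2 to the unit disk. *)
Definition square_disk x y : R * R :=
  (x * Num.sqrt (1 - y ^+ 2 / 2), y * Num.sqrt (1 - x ^+ 2 / 2)).

(** First coordinate of the inverse map; by symmetry the second is [disk_square v u]. *)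
Definition disk_square u v : R :=
  (Num.sqrt (2 + u ^+ 2 - v ^+ 2 + 2 * Num.sqrt 2 * u) -
   Num.sqrt (2 + u ^+ 2 - v ^+ 2 - 2 * Num.sqrt 2 * u)) / 2.

(** In this form the boundary of the square, and nothing else of it, visibly goes to the circle. *)
Lemma square_disk_sqr x y : `|x| <= 1 -> `|y| <= 1 ->
  (square_disk x y).1 ^+ 2 + (square_disk x y).2 ^+ 2 =
  1 - (1 - x ^+ 2) * (1 - y ^+ 2).
Proof.
move=> /sqr_le1 x1 /sqr_le1 y1.
rewrite /= !exprMn !sqr_sqrtr ?subr_ge0; last 2 first.
- lra.
- lra.
by field.
Qed.

(** The radicands are the squares of [Num.sqrt 2 * s + x] and [Num.sqrt 2 * s - x]; both bases are
    nonnegative because the square of [Num.sqrt 2 * s] is 2 - y^2, which is at least 1. *)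
Lemma disk_squareK x y : `|x| <= 1 -> `|y| <= 1 ->
  disk_square (square_disk x y).1 (square_disk x y).2 = x.
Proof.
move=> /sqr_le1 x2 /sqr_le1 y2.
rewrite /disk_square /= !exprMn !sqr_sqrtr; [|lra|lra].
set s := Num.sqrt (1 - y ^+ 2 / 2).
have s2 : s ^+ 2 = 1 - y ^+ 2 / 2 by rewrite sqr_sqrtr //; lra.
have as0 : 0 <= Num.sqrt 2 * s by rewrite mulr_ge0 ?sqrtr_ge0.
have as2 : (Num.sqrt 2 * s) ^+ 2 = 2 - y ^+ 2 by rewrite exprMn sqrt2_sqr s2; lra.
have asx : `|x| <= Num.sqrt 2 * s.
  by rewrite -ler_sqr ?nnegrE // real_normK ?num_real // as2; lra.
have -> : 2 + x ^+ 2 * (1 - y ^+ 2 / 2) - y ^+ 2 * (1 - x ^+ 2 / 2) +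
    2 * Num.sqrt 2 * (x * s) = (Num.sqrt 2 * s + x) ^+ 2 by rewrite sqrrD as2; field.
have -> : 2 + x ^+ 2 * (1 - y ^+ 2 / 2) - y ^+ 2 * (1 - x ^+ 2 / 2) -
    2 * Num.sqrt 2 * (x * s) = (Num.sqrt 2 * s - x) ^+ 2 by rewrite sqrrB as2; field.
move: asx; rewrite ler_norml => /andP[x3 x4].
by rewrite !sqrtr_sqr !ger0_norm; [field|lra|lra].
Qed.

Lemma disk_square_sqr u v : u ^+ 2 + v ^+ 2 <= 1 ->
  disk_square u v ^+ 2 = (2 + (u ^+ 2 - v ^+ 2) -
    Num.sqrt ((u ^+ 2 - v ^+ 2) ^+ 2 + 4 * (1 - (u ^+ 2 + v ^+ 2)))) / 2.
Proof.
move=> uv; have a2 := sqrt2_sqr; rewrite /disk_square.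
set a := Num.sqrt 2 in a2 *.
set P := 2 + u ^+ 2 - v ^+ 2 + _; set Q := 2 + u ^+ 2 - v ^+ 2 - _.
have P0 : 0 <= P.
  have -> : P = (a * u + 1) ^+ 2 + (1 - (u ^+ 2 + v ^+ 2)).
    by rewrite sqrrD exprMn a2 /P; ring.
  by rewrite addr_ge0 ?sqr_ge0 ?subr_ge0.
have Q0 : 0 <= Q.
  have -> : Q = (a * u - 1) ^+ 2 + (1 - (u ^+ 2 + v ^+ 2)).
    by rewrite sqrrB exprMn a2 /Q; ring.
  by rewrite addr_ge0 ?sqr_ge0 ?subr_ge0.
have -> : (u ^+ 2 - v ^+ 2) ^+ 2 + 4 * (1 - (u ^+ 2 + v ^+ 2)) = P * Q.
  have -> : P * Q = (2 + u ^+ 2 - v ^+ 2) ^+ 2 - 4 * a ^+ 2 * u ^+ 2 by rewrite /P /Q; ring.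
  by rewrite a2; ring.
by rewrite sqrtrM // expr_div_n sqrrB !sqr_sqrtr // /P /Q; field.
Qed.

Lemma sqrt_disk_ge u v : u ^+ 2 + v ^+ 2 <= 1 ->
  `|u ^+ 2 - v ^+ 2| <=
    Num.sqrt ((u ^+ 2 - v ^+ 2) ^+ 2 + 4 * (1 - (u ^+ 2 + v ^+ 2))).
Proof.
by move=> uv; rewrite -sqrtr_sqr ler_wsqrtr // lerDl mulr_ge0 // subr_ge0.
Qed.

Lemma norm_disk_square u v : u ^+ 2 + v ^+ 2 <= 1 -> `|disk_square u v| <= 1.
Proof.
move=> uv; rewrite -(@ler_sqr R) ?nnegrE // real_normK ?num_real // expr1n disk_square_sqr //.
have := sqrt_disk_ge uv; have := ler_norm (u ^+ 2 - v ^+ 2); lra.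
Qed.

(** On the circle the root in [disk_square_sqr] is |u^2 - v^2|, so the coordinate belonging to the
    larger of u^2 and v^2 has absolute value 1. *)
Lemma circle_square u v : u ^+ 2 + v ^+ 2 = 1 ->
  `|disk_square u v| = 1 \/ `|disk_square v u| = 1.
Proof.
move=> uv; have vu : v ^+ 2 + u ^+ 2 = 1 by rewrite addrC.
have sq1 (t : R) : t ^+ 2 = 1 -> `|t| = 1.
  by move=> t2; apply/eqP; rewrite -(@eqrXn2 _ 2) ?ler01 // real_normK ?num_real // t2 expr1n.
have [w|w] := leP (u ^+ 2) (v ^+ 2); [right|left]; apply: sq1;
  rewrite disk_square_sqr ?uv ?vu // subrr mulr0 addr0 sqrtr_sqr ger0_norm; lra.
Qed.

End SquareAndDisk.

(** * From cubical complexes to moment-angle complexes *)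

Section MomentAngle.
Variables (R : realType) (T V : finType).
Variables (K : {set {set T}}) (M : {set {set V}}) (J : {set V}).
Variables (pi : V -> option T) (sec : T -> V).
Hypotheses (Kc : simplicial_complex K) (Mc : simplicial_complex M).
Hypothesis secK : forall i, pi (sec i) = Some i.
Hypothesis secJ : forall i, sec i \in J.
Hypothesis MJ : forall s : {set V}, s \subset J -> (s \in M) = (s \in block_complex K pi J).

(** Each vertex of [J] becomes the edge of its two real coordinates. Composing [pi] with [fst] keeps
    the result a block complex, with blocks of twice the size. *)
Let D : {set V * bool} := finset.setX J [set: bool].
Let N := block_complex K (pi \o fst) D.

Let DE v b : ((v, b) \in D) = (v \in J).
Proof. by rewrite /D finset.in_setX finset.in_setT andbT. Qed.

(** Coordinates outside [J] sit at the base point (1, 0) of the circle and are forgotten by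
    [square_point]; this is how the full subcomplex yields a retract. *)
Definition disk_point (q : cubical R N D) : {ptws V -> (R * R)%type} :=
  fun v => if v \in J then square_disk (val q (v, false)) (val q (v, true)) else (1, 0).

Definition square_point (z : moment_angle R M) : {ptws (V * bool) -> R} :=
  fun w => if w.1 \in J then
    if w.2 then disk_square (val z w.1).2 (val z w.1).1
    else disk_square (val z w.1).1 (val z w.1).2
  else 1.

Lemma disk_pointP q : (\bigcup_(s in [set` M])
    [set z : {ptws V -> (R * R)%type} |
      forall v, (if v \in s then @disk2 R else @circle1 R) (z v)]) (disk_point q).
Proof.
have [q1 qN qD] := set_mem (valP q); set S := [set w | _]%SET in qN.
pose s : {set V} := [set v in J | ((v, false) \in S) && ((v, true) \in S)]%SET.
have sJ : s \subset J by apply/fintype.subsetP => v; rewrite inE => /andP[].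
have SP w : w \notin S -> val q w ^+ 2 = 1.
  by rewrite inE negbK => /eqP e; rewrite -real_normK ?num_real // e expr1n.
exists s.
  rewrite /= MJ // inE sJ /=; move: qN; rewrite inE => /andP[_] /orP[NK|].
    rewrite (_ : full_blocks pi J s = full_blocks (pi \o fst) D S) ?NK //.
    apply/setP => i; apply/full_blocksP/full_blocksP => h.
      case=> v b; rewrite DE => vJ pv; have := h v vJ pv; rewrite inE => /and3P[_ v0 v1].
      by case: b pv.
    by move=> v vJ pv; rewrite inE vJ !h // DE.
  move=> /misses_noneP[[v b]]; rewrite DE => vJ [pv vS]; apply/orP; right.
  apply/misses_noneP; exists v => //; split=> //.
  by rewrite inE vJ /=; case: b pv vS => _ /negPf ->; rewrite ?andbF.
move=> v; rewrite /disk_point; case: ifP => vs.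
  have vJ : v \in J by apply: (fintype.subsetP sJ).
  rewrite vJ; suff : (square_disk (val q (v, false)) (val q (v, true))).1 ^+ 2 +
      (square_disk (val q (v, false)) (val q (v, true))).2 ^+ 2 <= 1 by [].
  rewrite square_disk_sqr // gerBl mulr_ge0 // subr_ge0; exact: sqr_le1.
case: ifP => vJ; last by rewrite /circle1 /= expr1n expr0n addr0.
suff : (square_disk (val q (v, false)) (val q (v, true))).1 ^+ 2 +
    (square_disk (val q (v, false)) (val q (v, true))).2 ^+ 2 = 1 by [].
rewrite square_disk_sqr //.
have : ((v, false) \notin S) || ((v, true) \notin S).
  by move: vs; rewrite inE vJ /= => /negbT; rewrite negb_and.
by case/orP => /SP ->; rewrite subrr ?mul0r ?mulr0 subr0.
Qed.

Lemma square_pointP z : cube_set N D (square_point z).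
Proof.
have [s /= sM sz] := set_mem (valP z).
have zdisk v : (val z v).1 ^+ 2 + (val z v).2 ^+ 2 <= 1.
  by have := sz v; case: ifP => _; rewrite /disk2 /circle1 /= => // ->.
have [_ Kdown] := Kc; have [_ Mdown] := Mc.
have sJ : s :&: J \subset J by exact: finset.subsetIr.
have : s :&: J \in block_complex K pi J.
  by rewrite -MJ //; apply: Mdown sM _; exact: finset.subsetIl.
rewrite inE sJ /= => sK.
set S := [set w | `|square_point z w| != 1]%SET.
have circ v : v \in J -> v \notin s -> exists b, (v, b) \notin S.
  move=> vJ /negPf vs; have := sz v; rewrite vs => /circle_square.
  by case=> e; [exists false|exists true]; rewrite inE /square_point /= vJ negbK e.
split.
- move=> [v b]; rewrite /square_point; case: ifP => _; last by rewrite normr1.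
  by case: ifP => _; apply: norm_disk_square => //; rewrite addrC.
- rewrite inE; apply/andP; split.
    apply/fintype.subsetP => -[v b]; rewrite DE inE /square_point /=.
    by case: ifP => // _; rewrite normr1 eqxx.
  case/orP: sK => [sK|/misses_noneP[v vJ [pv]]].
    apply/orP; left; apply: Kdown sK _; apply/fintype.subsetP => i /full_blocksP h.
    apply/full_blocksP => v vJ pv; rewrite inE vJ andbT; apply: contraT => vs.
    have [b] := circ v vJ vs; by rewrite h // DE.
  rewrite inE vJ andbT => vs; have [b vb] := circ v vJ vs.
  by apply/orP; right; apply/misses_noneP; exists (v, b); rewrite ?DE.
by move=> [v b]; rewrite DE /square_point => /negPf ->.
Qed.

Lemma Sq_nonzero_moment_angle n : (0 < n)%N ->
  Sq_nonzero R (realization R K) n -> Sq_nonzero R (moment_angle R M) n.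
Proof.
move=> n0 Kn; pose sec' i := (sec i, false).
have secK' i : (pi \o fst) (sec' i) = Some i by exact: secK.
have D0D : [set sec' i | i : T]%SET \subset D.
  by apply/fintype.subsetP => w /imsetP[i _ ->]; rewrite DE.
have Nc : simplicial_complex N := block_complexP Kc secK' D0D.
have : Sq_nonzero R (cubical R N D) n.
  apply: Sq_nonzero_cubical => //; first exact: block_complex_sub.
  exact: (Sq_nonzero_block_complex Kc secK' n0 D0D Kn).
have dc : continuous disk_point.
  apply: continuous_ptws => v; rewrite /disk_point.
  case: (v \in J); last by apply: continuous_pairT; exact: continuous_cst.
  have c0 := @continuous_cubical_coord R _ N D (v, false).
  have c1 := @continuous_cubical_coord R _ N D (v, true).
  by apply: continuous_pairT; continuity.
have sc : continuous square_point.
  apply: continuous_ptws => -[v b]; rewrite /square_point /=.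
  case: (v \in J); last exact: continuous_cst.
  have cv : continuous (fun z : moment_angle R M => val z v).
    have vc : continuous (val : moment_angle R M -> {ptws V -> (R * R)%type}).
      exact: continuous_val.
    exact: (continuous_compT vc (@continuous_eval V (R * R)%type v)).
  have c1 : continuous (fun z : moment_angle R M => (val z v).1).
    by apply: (continuous_compT cv) => y; exact: cvg_fst.
  have c2 : continuous (fun z : moment_angle R M => (val z v).2).
    by apply: (continuous_compT cv) => y; exact: cvg_snd.
  by case: b; rewrite /disk_square; continuity.
apply: (@Sq_nonzero_retract R _ _
  (fun q => SigSub (mem_set (disk_pointP q)) : moment_angle R M)
  (fun z => SigSub (mem_set (square_pointP z)) : cubical R N D)) => //.
- by apply/continuous_comp_initial; exact: dc.
- by apply/continuous_comp_initial; exact: sc.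
move=> q; apply/val_inj/funext => -[v b]; have [q1 _ qD] := set_mem (valP q).
rewrite /= /square_point /= /disk_point; have [vJ|vJ] := boolP (v \in J).
  case: b; first exact: (disk_squareK (q1 (v, true)) (q1 (v, false))).
  exact: (disk_squareK (q1 (v, false)) (q1 (v, true))).
by rewrite qD // DE.
Qed.

End MomentAngle.

(** * Minimal nonfaces and restrictions of the composition complex *)

Lemma minimal_nonface (V : finType) (K : {set {set V}}) : [set: V]%SET \notin K ->
  exists2 J : {set V}, J \notin K &
    forall s : {set V}, s \subset J -> ~~ (J \subset s) -> s \in K.
Proof.
move=> TK; pose P (J : {set V}) := J \notin K.
have [|J /minsetP[JK Jmin]] := @ex_minset V P; first by exists [set: V]%SET.
by exists J => // s sJ; apply: contraR => sK; rewrite (Jmin s sK sJ).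
Qed.

(** Take [t] minimal among the faces whose union with [a] is not a face. Subsets of [a |: t] that
    avoid [a] lie in [t]; proper ones that contain [a] are faces by minimality. *)
Lemma minimal_nonface_at (V : finType) (K : {set {set V}}) (a : V) :
  simplicial_complex K -> (exists2 s : {set V}, s \in K & (a |: s)%SET \notin K) ->
  exists2 J : {set V}, a \in J /\ J \notin K &
    forall s : {set V}, s \subset J -> ~~ (J \subset s) -> s \in K.
Proof.
move=> [_ Kdown] [s0 s0K as0]; pose P (s : {set V}) := (s \in K) && ((a |: s)%SET \notin K).
have [|t /minsetP[/andP[tK atK] tmin]] := @ex_minset V P; first by exists s0; rewrite /P s0K.
exists (a |: t)%SET; first by rewrite finset.setU11.
move=> s st; apply: contraR => sK; have [sa|sa] := boolP (a \in s); last first.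
  case/negP: sK; apply: Kdown tK _; apply/fintype.subsetP => v vs.
  have := fintype.subsetP st v vs; rewrite !inE => /orP[/eqP va|//].
  by rewrite -va vs in sa.
have sat : s :\ a \subset t by rewrite finset.subDset.
rewrite -(tmin _ _ sat) ?finset.setD1K // /P (Kdown _ _ tK sat).
by rewrite finset.setD1K.
Qed.

Section Composition.
Variables (R : realType) (m : nat) (nv : 'I_m -> nat).
Variables (K : {set {set 'I_m}}) (L : forall i : 'I_m, {set {set 'I_(nv i)}}).
Hypotheses (Kc : simplicial_complex K) (Lc : forall i, simplicial_complex (L i)).
Local Notation V := {i : 'I_m & 'I_(nv i)}.
Local Notation vtx j := (Tagged (fun i => 'I_(nv i)) j).

Lemma composition_complexE (s : {set V}) : s \in composition_complex K L <->
  exists2 t, t \in K & forall i, i \notin t -> slice s i \in L i.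
Proof.
split=> [/bigcupP[t tK]|[t tK tL]].
  by rewrite inE => /forallP h; exists t => // i /negPf it; have := h i; rewrite it.
apply/bigcupP; exists t => //; rewrite inE; apply/forallP => i.
by case: ifPn => [_|/tL //]; rewrite powersetE finset.subsetT.
Qed.

Lemma in_slice (s : {set V}) i (j : 'I_(nv i)) : (j \in slice s i) = (vtx j \in s).
Proof. by rewrite inE. Qed.

(** A slice inside the minimal nonface [F i] lies in [L i] unless it is all of [F i]. So a subset of
    [J] is a face exactly when the indices of its complete slices form a face of [K]: the blocks are
    the [F i]. *)
Lemma Sq_nonzero_composition_base n : (0 < n)%N ->
  (forall i, [set: 'I_(nv i)]%SET \notin L i) -> Sq_nonzero R (realization R K) n ->
  Sq_nonzero R (moment_angle R (composition_complex K L)) n.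
Proof.
move=> n0 LT Kn.
have FE i : exists J : {set 'I_(nv i)}, J \notin L i /\
    forall s : {set 'I_(nv i)}, s \subset J -> ~~ (J \subset s) -> s \in L i.
  by have [J] := minimal_nonface (LT i); exists J.
pose F i := projT1 (cid (FE i)); have FP i : F i \notin L i /\
    forall s : {set 'I_(nv i)}, s \subset F i -> ~~ (F i \subset s) -> s \in L i :=
  projT2 (cid (FE i)).
have fE i : exists j, j \in F i.
  by apply/finset.set0Pn; apply: contraNneq (FP i).1 => ->; exact: (Lc i).1.
pose f i := projT1 (cid (fE i)); have fP i : f i \in F i := projT2 (cid (fE i)).
pose J : {set V} := [set v | tagged v \in F (tag v)]%SET.
have Jv i (j : 'I_(nv i)) : (vtx j \in J) = (j \in F i) by rewrite inE.
apply: (@Sq_nonzero_moment_angle R _ _ K _ J (fun v => Some (tag v)) (fun i => vtx (f i))) => //.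
- exact: composition_complexP.
- by move=> i; rewrite Jv; exact: fP.
move=> s sJ; have slF i : slice s i \subset F i.
  apply/fintype.subsetP => j; rewrite in_slice -Jv; exact: fintype.subsetP.
rewrite inE sJ /= [misses_none _ _ _](_ : _ = false) ?orbF; last first.
  by apply/negbTE/negP => /misses_noneP[v _ []].
have fullE i : (i \in full_blocks (fun v : V => Some (tag v)) J s) = (F i \subset slice s i).
  apply/full_blocksP/fintype.subsetP => [h j jF|h [i' j] vJ [e]].
    by rewrite in_slice; apply: h; rewrite ?Jv.
  by subst i'; rewrite -in_slice; apply: h; rewrite -Jv.
have [_ Kdown] := Kc; apply/idP/idP => [/composition_complexE[t tK tL]|sK].
  apply: Kdown tK _; apply/fintype.subsetP => i; rewrite fullE => Fs.
  apply: contraT => /tL sL; case/negP: (FP i).1; have [_ Ldown] := Lc i.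
  exact: Ldown sL Fs.
apply/composition_complexE; exists (full_blocks (fun v : V => Some (tag v)) J s) => // i.
by rewrite fullE; exact: (FP i).2 _ (slF i).
Qed.

(** A subset of [J] is a face as soon as one slice over [I'] lies in its [L i], since [I'] without
    one index is in [K], and only then, since [I'] is not. Over [i0] each vertex is its own block;
    the vertices of [J] over other indices belong to no block. *)
Lemma Sq_nonzero_composition_fiber n (i0 : 'I_m) : (0 < n)%N ->
  (forall i, [set: 'I_(nv i)]%SET \notin L i) ->
  (exists2 s : {set 'I_m}, s \in K & (i0 |: s)%SET \notin K) ->
  Sq_nonzero R (realization R (L i0)) n ->
  Sq_nonzero R (moment_angle R (composition_complex K L)) n.
Proof.
move=> n0 LT Ki0 Ln; have [I' [i0I I'K] I'min] := minimal_nonface_at Kc Ki0.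
have FE i : exists J : {set 'I_(nv i)}, J \notin L i /\
    forall s : {set 'I_(nv i)}, s \subset J -> ~~ (J \subset s) -> s \in L i.
  by have [J] := minimal_nonface (LT i); exists J.
pose F i := projT1 (cid (FE i)); have FP i : F i \notin L i /\
    forall s : {set 'I_(nv i)}, s \subset F i -> ~~ (F i \subset s) -> s \in L i :=
  projT2 (cid (FE i)).
pose J : {set V} := [set v | (tag v \in I') && ((tag v == i0) || (tagged v \in F (tag v)))]%SET.
pose p (v : V) : option 'I_(nv i0) := [pick j | v == vtx j].
have pvtx (j : 'I_(nv i0)) : p (vtx j) = Some j.
  rewrite /p; case: pickP => [k|/(_ j)]; last by rewrite eqxx.
  by rewrite eq_Tagged => /eqP /= ->.
have pSome v j : p v = Some j -> v = vtx j.
  by rewrite /p; case: pickP => // k /eqP -> [->].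
have pNone i (j : 'I_(nv i)) : i != i0 -> p (vtx j) = None.
  move=> ii0; rewrite /p; case: pickP => // k /eqP /(congr1 (@tag _ _)) /= e.
  by rewrite e eqxx in ii0.
apply: (@Sq_nonzero_moment_angle R _ _ (L i0) _ J p (fun j => vtx j)) => //.
- exact: composition_complexP.
- by move=> j; rewrite inE /= i0I eqxx.
have [_ Kdown] := Kc; move=> s sJ; rewrite inE sJ /=.
have fullE : full_blocks p J s = slice s i0.
  apply/setP => j; rewrite in_slice; apply/full_blocksP/idP => [h|h v _ /pSome -> //].
  by apply: h; rewrite ?pvtx // inE /= i0I eqxx.
rewrite fullE.
have slice0 i : i \notin I' -> slice s i \in L i.
  move=> iI; rewrite (_ : slice s i = finset.set0); first exact: (Lc i).1.
  apply/setP => j; rewrite in_slice finset.in_set0; apply: contraNF iI.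
  by move=> /(fintype.subsetP sJ); rewrite inE => /andP[].
have face i : i \in I' -> slice s i \in L i -> s \in composition_complex K L.
  move=> iI sL; apply/composition_complexE; exists (I' :\ i)%SET.
    apply: I'min; first exact: finset.subD1set.
    by apply/negP => /fintype.subsetP/(_ i iI); rewrite finset.setD11.
  by move=> k; rewrite !inE negb_and negbK => /orP[/eqP -> //|]; exact: slice0.
apply/idP/orP => [/composition_complexE[t tK tL]|[sL|/misses_noneP[[i j]]]].
- have [i iI it] : exists2 i, i \in I' & i \notin t.
    apply/subsetPn; apply: contraNN I'K; exact: Kdown tK.
  have sL := tL i it; have [ii0|ii0] := eqVneq i i0; first by left; rewrite -ii0.
  right; have /subsetPn[j jF js] : ~~ (F i \subset slice s i).
    by apply: contraNN (FP i).1; have [_ Ldown] := Lc i; exact: Ldown sL.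
  apply/misses_noneP; exists (vtx j); first by rewrite inE /= iI jF orbT.
  by split; [exact: pNone|rewrite -in_slice].
- exact: face i0I sL.
rewrite inE /= => /andP[iI ijF] [pij sij].
have ii0 : i != i0 by apply: contra_eqN pij => /eqP e; subst i; rewrite pvtx.
rewrite (negPf ii0) /= in ijF; apply: (face i iI); apply: (FP i).2.
  apply/fintype.subsetP => k; rewrite in_slice => /(fintype.subsetP sJ).
  by rewrite inE /= (negPf ii0) /= => /andP[].
by apply/negP => /fintype.subsetP/(_ j ijF); rewrite in_slice (negPf sij).
Qed.

End Composition.

Theorem lemma6p4p1 (R : realType) (m : nat) (nv : 'I_m -> nat)
    (K : {set {set 'I_m}}) (L : forall i : 'I_m, {set {set 'I_(nv i)}}) :
  (forall i : 'I_m, (0 < nv i)%N) ->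
  simplicial_complex K ->
  (forall i : 'I_m, simplicial_complex (L i)) ->
  ~ contractible R (realization R K) ->
  (forall i : 'I_m, ~ contractible R (realization R (L i))) ->
  forall n : nat, (1 <= n)%N ->
    (Sq_nonzero R (realization R K) n \/
     exists i : 'I_m, Sq_nonzero R (realization R (L i)) n) ->
    Sq_nonzero R (moment_angle R (composition_complex K L)) n.
Proof.
move=> nv0 Kc Lc Knc Lnc n n0 SqKL.
(* A full simplex is a cone with any of its vertices as apex; [nv0] provides one. *)
have LT i : [set: 'I_(nv i)]%SET \notin L i.
  apply/negP => LT; apply: (Lnc i); apply: (cone_contractible R (Lc i) (a := Ordinal (nv0 i))).
  by move=> s _; have [_ Ldown] := Lc i; apply: Ldown LT _; exact: finset.subsetT.
case: SqKL => [SqK|[i0 SqL]]; first exact: Sq_nonzero_composition_base.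
apply: (Sq_nonzero_composition_fiber Kc Lc n0 LT _ SqL).
apply: contrapT => Kcone; apply: Knc; apply: (cone_contractible R Kc (a := i0)) => s sK.
by apply: contraT => sK'; case: Kcone; exists s.
Qed.
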